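(* Let $G$ be a finite simple planar graph with maximum degree $\Delta(G)=6$. Suppose that $G$ contains no 4-cycle $C$ satisfying at least one of the following: (i) $C$ is a chord-cycle; (ii) $C$ is adjacent to a 3-cycle; (iii) $C$ is incident with a vertex $v$ of degree 6 in $G$, and $C$ is adjacent to a cycle $C'\neq C$ of length at most 5 that is also incident with $v$. Then $G$ has a 7-total-coloring.
   Context: All graphs are simple, finite and undirected. A $k$-total-coloring of a graph $G$ is a map $f:V(G)\cup E(G)\to\{1,\dots,k\}$ with $f(x)\ne f(y)$ for every pair of adjacent or incident elements $x,y\in V(G)\cup E(G)$. A $k$-cycle is a cycle (subgraph) of length $k$. A chord of a cycle is an edge of $G$ joining two vertices of the cycle that is not an edge of the cycle; a cycle is a chord-cycle if it has at least one chord. Two cycles are adjacent if they share a common edge. A cycle is incident with a vertex if the vertex lies on it. *)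

(* Defs.v *)
From mathcomp Require Import all_boot all_order all_algebra.
From mathcomp Require Import classical_sets reals topology normedtype.
Import numFieldNormedType.Exports.

Set Implicit Arguments.
Unset Strict Implicit.
Unset Printing Implicit Defensive.

Record sgraph := SGraph {
  vertex :> finType;
  adj : rel vertex;
  adj_sym : symmetric adj;
  adj_irrefl : irreflexive adj }.

Section Graphs.
Variable G : sgraph.
Local Open Scope set_scope.

Definition edges : {set {set G}} :=
  [set [set p.1; p.2] | p : G * G & adj p.1 p.2].

Definition degree (v : G) : nat := #|[set u | adj v u]|.

Definition max_degree : nat := \max_(v : G) degree v.

(* A cycle is given by the list of its vertices in cyclic order. The list
   depends on a starting vertex and a direction, so two lists describe the same
   subgraph when their [cycle_edges] are equal. *)
Definition is_cycle (k : nat) (c : seq G) : bool :=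
  [&& 2 < k, size c == k, cycle (@adj G) c & uniq c].

Definition cycle_edges (c : seq G) : {set {set G}} :=
  [set [set x; next c x] | x in c].

Definition chord_cycle (c : seq G) : Prop :=
  exists x y : G,
    [/\ x \in c, y \in c, adj x y & [set x; y] \notin cycle_edges c].

Definition adjacent_cycles (c c' : seq G) : Prop :=
  exists e : {set G}, e \in cycle_edges c /\ e \in cycle_edges c'.

Definition element : Type := (G + {e : {set G} | e \in edges})%type.

Definition adjacent_or_incident (a b : element) : bool :=
  match a, b with
  | inl u, inl v => adj u v
  | inl u, inr e => u \in val e
  | inr e, inl u => u \in val e
  | inr e, inr e' => (e != e') && [exists u, (u \in val e) && (u \in val e')]
  end.

Definition total_coloring (k : nat) (f : element -> 'I_k) : Prop :=
  forall a b : element, adjacent_or_incident a b -> f a <> f b.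

End Graphs.

Section Planarity.
Variable R : realType.
Local Open Scope ring_scope.

Definition simple_arc (c : R -> R * R) : Prop :=
  {within `[0, 1], continuous c}%classic /\ {in `[0, 1] &, injective c}.

(* A drawing of G in the plane: vertices are distinct points, the edge e is the
   simple arc [arc e], run over the parameter interval [0, 1] and joining the
   two ends of e, and arcs meet vertices and each other only at their ends. *)
Definition plane_drawing (G : sgraph)
    (pt : G -> R * R) (arc : {set G} -> R -> R * R) : Prop :=
  [/\ injective pt,
      forall e, e \in edges G -> simple_arc (arc e),
      forall e, e \in edges G -> exists x y : G,
        [/\ e = [set x; y]%SET, arc e 0 = pt x & arc e 1 = pt y],
      forall e v (t : R), e \in edges G -> t \in `]0, 1[ -> arc e t <> pt v &
      forall e e' (t t' : R), e \in edges G -> e' \in edges G -> e != e' ->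
        t \in `]0, 1[ -> t' \in `]0, 1[ -> arc e t <> arc e' t'].

Definition planar (G : sgraph) : Prop :=
  exists (pt : G -> R * R) (arc : {set G} -> R -> R * R), plane_drawing pt arc.

End Planarity.

(* Main.v *)
(* Let D be a minimal set of edges of G that has no 7-total-colouring. Then the
   degrees u, v of an edge of D with u <= 3 have sum at least 8; a nonempty set of vertices of degree
   2 has more neighbours than elements; a vertex of degree 2 on a triangle is the only neighbour of
   degree 2 of its two neighbours; there is no triangle of degrees 4, 4, 4 and no 4-cycle of degrees
   5, 3, 5, 3. A plane drawing yields a family F of even sets of edges that plays the role of the
   faces, for which Euler's inequality |D| < |F| + |V(D)| holds. Give charge 2 d(v) - 6 to each vertex v and |f| - 6 to
   each face f, so that the total is negative; yet the charge can be moved from vertices of degree at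
   least 4 to faces of length at most 5 and to vertices of degree 2 so that nothing is negative.

   Faces are obtained without the Jordan curve theorem. On a fine grid the drawing becomes a minor of
   the square grid, where an even set of grid edges is the boundary of a set of squares by parity;
   merging squares across grid edges that no edge of G uses gives the faces. They span the cycle
   space of D and cover each edge at most twice, which implies Euler's inequality by counting. *)
Require Import Defs.
From mathcomp Require Import all_boot all_order all_algebra.
From mathcomp Require Import classical_sets reals topology normedtype.
From mathcomp Require Import boolp derive.
From mathcomp Require Import fintype finset lra zify.
Import numFieldNormedType.Exports.
Import Order.TTheory GRing.Theory Num.Theory.

Set Implicit Arguments.
Unset Strict Implicit.
Unset Printing Implicit Defensive.

(** * Separation and subdivision of plane arcs *)

Section Arcs.
Variable R : realType.
Local Open Scope ring_scope.
Local Open Scope classical_set_scope.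
Implicit Types a b : R -> R * R.

(** Nothing is known about a face except that it is an even set of edges. This suffices because an
    even set of at most five edges is a single cycle, while longer faces have no negative charge, so
    that their shape never matters. There is no cyclic order of the faces at a vertex either: charge
    is sent along edges, each of which lies on at most two faces. Where the order would help, at
    vertices of degree 5, the parity of the number of edges on triangular faces replaces it.

    Charge is counted in 24ths. Faces of length 3, 4, 5 need 72, 48, 24 and a vertex of degree 2
    needs 48; vertices of degree 4, 5, 6 can spend 48, 96, 144. The condition on 4-cycles keeps
    short faces apart: a second face on an edge of a triangular face has length at least 5, and a
    second face on an edge of a 4-face at a vertex of degree 6 has length at least 6 and needs
    nothing.

    Seven colours let a vertex of degree at most 3 be coloured last, as it sees at most three edges
    and three neighbours; until then it does not block the edges at it. *)

Definition dist1 (p q : R * R) : R := `|p.1 - q.1| + `|p.2 - q.2|.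

Lemma dist1_eq0 p q : (dist1 p q == 0) = (p == q).
Proof.
case: p q => [p1 p2] [q1 q2]; rewrite /dist1 paddr_eq0 ?normr_ge0 //= !normr_eq0 !subr_eq0.
by rewrite xpair_eqE.
Qed.

Lemma dist1_ge0 p q : 0 <= dist1 p q.
Proof. by rewrite addr_ge0. Qed.

Lemma dist1C p q : dist1 p q = dist1 q p.
Proof. by rewrite /dist1 distrC [X in _ + X]distrC. Qed.

Lemma dist1_triangle p q r : dist1 p r <= dist1 p q + dist1 q r.
Proof.
have := ler_distD q.1 p.1 r.1; have := ler_distD q.2 p.2 r.2; rewrite /dist1; lra.
Qed.

(** By compactness, the distance attains its minimum on the product of the two images. *)
Lemma disjoint_arcs_dist a b (x y x' y' : R) :
  {within `[x, y], continuous a} -> {within `[x', y'], continuous b} ->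
  (forall s t, s \in `[x, y]%R -> t \in `[x', y']%R -> a s <> b t) ->
  exists2 d : R, 0 < d & forall s t, s \in `[x, y]%R -> t \in `[x', y']%R ->
    d <= dist1 (a s) (b t).
Proof.
move=> ca cb ab.
have [xy|yx] := leP x y; last first.
  exists 1 => // s t; rewrite in_itv /= => /andP[h1 h2].
  by have := le_lt_trans (le_trans h1 h2) yx; rewrite ltxx.
have [xy'|yx'] := leP x' y'; last first.
  exists 1 => // s t _; rewrite in_itv /= => /andP[h1 h2].
  by have := le_lt_trans (le_trans h1 h2) yx'; rewrite ltxx.
pose K := (a @` `[x, y]) `*` (b @` `[x', y']).
have cK : compact K.
  by apply: compact_setX; apply: continuous_compact => //; exact: segment_compact.
pose f (p : (R * R) * (R * R)) := dist1 p.1 p.2.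
have cf : continuous f.
  move=> p; rewrite /f /dist1; apply: (@cvgD _ R); apply: (@cvg_norm _ R); apply: (@cvgB _ R).
  - by apply: cvg_comp; [exact: cvg_fst | exact: cvg_fst].
  - by apply: cvg_comp; [exact: cvg_snd | exact: cvg_fst].
  - by apply: cvg_comp; [exact: cvg_fst | exact: cvg_snd].
  - by apply: cvg_comp; [exact: cvg_snd | exact: cvg_snd].
have [||c cKc minc] := @compact_EVT_min _ R f K _ cK.
- exists (a x, b x') => /=; split; [exists x|exists x'] => //=; by rewrite in_itv /= lexx.
- exact: continuous_subspaceT.
exists (f c).
  move: cKc; rewrite classical_sets.in_setE => -[[s sI es] [t tI et]].
  rewrite lt_def dist1_ge0 andbT dist1_eq0 -es -et; apply/eqP; exact: ab.
move=> s t sI tI; apply: (minc (a s, b t)); rewrite classical_sets.in_setE; split => /=; [exists s|exists t] => //.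
Qed.

(** Heine-Cantor, from the near-covering form of the compactness of the segment. *)
Lemma within_unif_continuous (f : R -> R) (d : R) : 0 < d -> {within `[0, 1], continuous f} ->
  exists2 e : R, 0 < e & forall s t, s \in `[0, 1]%R -> t \in `[0, 1]%R ->
    `|s - t| < e -> `|f s - f t| < d.
Proof.
move=> d0 cf.
have /compact_near_coveringP nc := @segment_compact R 0 1.
pose P (e s : R) : Prop := s \in `[(0:R), 1]%R -> forall t : R, t \in `[0, 1]%R -> `|s - t| < e -> `|f s - f t| < d.
have {}nc : \forall e \near (0:R)^'+, `[(0:R), 1] `<=` P e.
  apply: nc => s sI.
  have /subspace_continuousP /(_ s sI) := cf.
  move=> /cvgrPdist_lt /(_ (d / 2)) /(_ (divr_gt0 d0 (ltr0Sn _ _))).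
  rewrite near_withinE near_nbhs_norm => -[r /= r0 Hr].
  have r20 : 0 < r / 2 by apply: divr_gt0 => //; exact: ltr0Sn.
  exists (ball s (r / 2), [set e | e < r / 2]).
    split; first exact: nbhsx_ballx.
    exact: nbhs_right_lt.
  move=> [s' e] /= [ss' er] s'I t tI s't.
  have h1 : `|f s - f s'| < d / 2.
    apply: Hr => //=; apply: lt_trans ss' _; lra.
  have h2 : `|f s - f t| < d / 2.
    apply: Hr => //=.
    have := ler_distD s' s t; move: ss'; rewrite /ball /= => ss'; lra.
  have := ler_distD (f s) (f s') (f t); rewrite (distrC (f s') (f s)); lra.
have [e [e0 He]] : exists e : R, 0 < e /\ `[0, 1] `<=` P e.
  near (0:R)^'+ => e; exists e; split; near: e => //; exact: nbhs_right_gt.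
by exists e => // s t sI tI; apply: (He s).
Unshelve. all: by end_near.
Qed.

Lemma within_fst a A : {within A, continuous a} -> {within A, continuous (fun t => (a t).1)}.
Proof. by move=> ca t; apply: cvg_comp; [exact: ca | exact: cvg_fst]. Qed.

Lemma within_snd a A : {within A, continuous a} -> {within A, continuous (fun t => (a t).2)}.
Proof. by move=> ca t; apply: cvg_comp; [exact: ca | exact: cvg_snd]. Qed.

(** The bound covers every large [m], so that one [m] can later serve all edges. *)
Lemma arc_subdivision a (d : R) : 0 < d -> {within `[0, 1], continuous a} ->
  exists2 n : nat, (0 < n)%N &
    forall m i, (n <= m)%N -> (i < m)%N -> dist1 (a (i%:R / m%:R)) (a (i.+1%:R / m%:R)) < d.
Proof.
move=> d0 ca.
have d20 : 0 < d / 2 by apply: divr_gt0 => //; exact: ltr0Sn.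
have [e e0 He] := within_unif_continuous d20 (within_fst ca).
have [e' e'0 He'] := within_unif_continuous d20 (within_snd ca).
pose e1 := Num.min e e'; have e10 : 0 < e1 by rewrite lt_min e0.
exists (Num.truncn e1^-1).+1 => // m i nm im.
have m0 : 0 < m%:R :> R by rewrite ltr0n; exact: leq_ltn_trans im.
have me : m%:R^-1 < e1.
  rewrite -[e1]invrK ltf_pV2 ?posrE ?invr_gt0 //.
  apply: lt_le_trans (truncnS_gt _) _; by rewrite ler_nat.
have I1 j : (j <= m)%N -> j%:R / m%:R \in `[(0:R), 1]%R.
  move=> jm; rewrite in_itv /= divr_ge0 ?ler0n //= ler_pdivrMr // mul1r ler_nat //.
have dd : `|i%:R / m%:R - i.+1%:R / m%:R| < e1.
  by rewrite -mulrBl -natr1 opprD addrA subrr sub0r mulN1r normrN gtr0_norm ?invr_gt0.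
move: dd; rewrite lt_min => /andP[dd dd'].
have := He _ _ (I1 _ (ltnW im)) (I1 _ im) dd.
have := He' _ _ (I1 _ (ltnW im)) (I1 _ im) dd'.
rewrite /dist1; lra.
Qed.

End Arcs.

(** * Grid minors of plane drawings *)

(** Equality is allowed because consecutive points of a subdivided arc may fall into the same cell;
    [gadj] below is the strict relation. *)
Definition gstep (p q : nat * nat) : bool :=
  [|| (p.1 == q.1) && [|| p.2 == q.2, p.2 == q.2.+1 | q.2 == p.2.+1]
    | (p.2 == q.2) && ((p.1 == q.1.+1) || (q.1 == p.1.+1))].

Definition reach (U : nat * nat -> Prop) (p q : nat * nat) : Prop :=
  exists (n : nat) (g : nat -> nat * nat),
    [/\ g 0 = p, g n = q, forall k, k <= n -> U (g k) &
        forall k, k < n -> gstep (g k) (g k.+1)].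

(* [U v] is the branch set of [v], and only its part that is connected to [o v] matters. The
   branch sets avoid the coordinate axes because predecessor is truncated in [nbr4]. *)
Definition grid_minor (V : finType) (D : {set {set V}}) : Prop :=
  exists (U : V -> nat * nat -> Prop) (o : V -> nat * nat),
  [/\ forall u v p, U u p -> U v p -> u = v,
      forall v p, U v p -> 0 < p.1 /\ 0 < p.2 &
      forall e, e \in D -> exists x y p q,
        [/\ e = [set x; y], x != y, gstep p q,
            reach (U x) (o x) p & reach (U y) (o y) q]].

Lemma gstep_sym p q : gstep p q = gstep q p.
Proof.
rewrite /gstep (eq_sym q.1) (eq_sym q.2 p.2).
by congr (_ && _ || _ && _); rewrite ?(orbC (p.2 == _.+1)) // orbC.
Qed.

Lemma reach_rev U p q : reach U p q -> reach U q p.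
Proof.
case=> n [g [g0 gn gU gs]]; exists n, (fun k => g (n - k)); split.
- by rewrite subn0.
- by rewrite subnn.
- by move=> k _; apply: gU; rewrite leq_subr.
- move=> k kn; rewrite gstep_sym.
  have -> : n - k = (n - k.+1).+1 by rewrite subnSK.
  by apply: gs; lia.
Qed.

Section Fin.
Local Open Scope ring_scope.

Lemma uniform_pos (R : realType) (T : finType) (P : T -> R -> Prop) :
  (forall t d d', d' <= d -> P t d -> P t d') ->
  (forall t, exists2 d, 0 < d & P t d) -> exists2 d, 0 < d & forall t, P t d.
Proof.
move=> mono /(_ _)/cid2-/all_sig2[f f0 Pf].
exists (\big[Num.min/1]_(t : T) f t).
  by elim/big_ind: _ => // x y; rewrite lt_min => -> ->.
by move=> t; apply: mono (Pf t); rewrite (bigD1 t) //= ge_min lexx.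
Qed.

Lemma uniform_nat (T : finType) (P : T -> nat -> Prop) :
  (forall t n n', (n <= n')%N -> P t n -> P t n') ->
  (forall t, exists n, P t n) -> exists n, forall t, P t n.
Proof.
move=> mono /(_ _)/cid-/all_sig[f Pf].
exists (\max_(t : T) f t)%N => t; apply: mono (Pf t).
exact: leq_bigmax.
Qed.

End Fin.

Section Grid.
Variable R : realType.
Local Open Scope ring_scope.

Variables (d B : R).
Hypothesis d0 : 0 < d.

(** The shift [B] makes the arguments in question at least 1, so that truncation is the floor and no
    cell lies on an axis. *)
Definition cell1 (x : R) : nat := Num.truncn (x / d + B).
Definition gridpt (p : R * R) : nat * nat := (cell1 p.1, cell1 p.2).

Lemma cell1_near x y : 1 <= x / d + B -> 1 <= y / d + B -> cell1 x = cell1 y -> `|x - y| < d.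
Proof.
move=> x1 y1 E.
have /truncn_itv : 0 <= x / d + B by lra.
have /truncn_itv : 0 <= y / d + B by lra.
rewrite -/(cell1 x) -/(cell1 y) E -natr1 => /andP[h1 h2] /andP[h3 h4].
have : `|x / d - y / d| < 1 by rewrite ltr_norml; apply/andP; split; lra.
by rewrite -mulrBl normrM normfV (gtr0_norm d0) ltr_pdivrMr // mul1r.
Qed.

Lemma cell1_step x y : 1 <= x / d + B -> 1 <= y / d + B -> `|x - y| < d ->
  [\/ cell1 x = cell1 y, cell1 x = (cell1 y).+1 | cell1 y = (cell1 x).+1].
Proof.
move=> x1 y1 xy.
have /truncn_itv : 0 <= x / d + B by lra.
have /truncn_itv : 0 <= y / d + B by lra.
rewrite -/(cell1 x) -/(cell1 y) -!natr1 => /andP[h1 h2] /andP[h3 h4].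
have : `|x / d - y / d| < 1.
  by rewrite -mulrBl normrM normfV (gtr0_norm d0) ltr_pdivrMr // mul1r.
rewrite ltr_norml => /andP[h5 h6].
have h7 : (cell1 x < (cell1 y).+2)%N by rewrite -(ltr_nat R) -!natr1; lra.
have h8 : (cell1 y < (cell1 x).+2)%N by rewrite -(ltr_nat R) -!natr1; lra.
have : [|| cell1 x == cell1 y, cell1 x == (cell1 y).+1 | cell1 y == (cell1 x).+1] by lia.
by case/or3P => /eqP ->; [constructor 1 | constructor 2 | constructor 3].
Qed.

Lemma cell1_gt0 x : 1 <= x / d + B -> (0 < cell1 x)%N.
Proof. by move=> h; rewrite /cell1 truncn_gt0. Qed.

End Grid.

Lemma uniform_up (R : realType) (T : finType) (P : T -> R -> Prop) :
  (forall t d d', (d <= d')%R -> P t d -> P t d') ->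
  (forall t, exists d, P t d) -> exists d, forall t, P t d.
Proof.
move=> mono /(_ _)/cid-/all_sig[f Pf].
exists (\big[Num.max/0%R]_(t : T) f t) => t; apply: mono (Pf t).
by rewrite (bigD1 t) //= le_max lexx.
Qed.

Section PlanarMinor.
Variable R : realType.
Local Open Scope ring_scope.
Variables (G : sgraph) (pt : G -> R * R) (arc : {set G} -> R -> R * R).
Hypothesis drawing : plane_drawing pt arc.

Let E : {set {set G}} := edges G.

Let pt_inj : injective pt.
Proof. by case: drawing. Qed.

Let arc_cont e : e \in E -> {within `[(0:R), 1], continuous (arc e)}%classic.
Proof. by case: drawing => _ sa _ _ _ /sa[]. Qed.

Let arc_inj e : e \in E -> {in `[(0:R), 1] &, injective (arc e)}.
Proof. by case: drawing => _ sa _ _ _ /sa[]. Qed.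

Let edge_ends_exist (v0 : G) : exists st en : {set G} -> G, forall e, e \in E ->
  [/\ e = [set st e; en e]%SET, st e != en e, arc e 0 = pt (st e) & arc e 1 = pt (en e)].
Proof.
have /choice[f Hf] : forall e : {set G}, exists p : G * G, e \in E ->
    [/\ e = [set p.1; p.2]%SET, p.1 != p.2, arc e 0 = pt p.1 & arc e 1 = pt p.2].
  move=> e; case: (boolP (e \in E)) => [eE|]; last by exists (v0, v0).
  case: drawing => _ _ /(_ e eE)[x [y [E' a0 a1]]] _ _; exists (x, y) => _ /=.
  split=> //; apply/eqP => xy.
  have /(arc_inj eE) : arc e 0 = arc e 1 by rewrite a0 a1 xy.
  rewrite !in_itv /= !lexx ler01 => /(_ isT isT) /eqP.
  by rewrite eq_sym oner_eq0.
by exists (fun e => (f e).1), (fun e => (f e).2) => e /Hf.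
Qed.

Section Ends.
Variables st en : {set G} -> G.
Hypothesis ends : forall e, e \in E ->
  [/\ e = [set st e; en e]%SET, st e != en e, arc e 0 = pt (st e) & arc e 1 = pt (en e)].

Let itv01 (t : R) : t \in `[0, 1] -> [\/ t = 0, t = 1 | t \in `]0, 1[].
Proof.
rewrite !in_itv /=; case: (eqVneq t 0) => [->|t0]; first by constructor 1.
case: (eqVneq t 1) => [->|t1]; first by constructor 2.
by rewrite le_eqVlt eq_sym (negPf t0) le_eqVlt (negPf t1) /=; constructor 3.
Qed.

Let endP e (t : R) : e \in E -> t = 0 \/ t = 1 -> exists v, arc e t = pt v.
Proof. by case/ends => _ _ h0 h1 [->|->]; [exists (st e)|exists (en e)]. Qed.

Let meet_ends e e' (s t : R) : e \in E -> e' \in E -> e != e' ->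
  s \in `[0, 1] -> t \in `[0, 1] -> arc e s = arc e' t -> (s = 0 \/ s = 1) /\ (t = 0 \/ t = 1).
Proof.
move=> eE eE' ee' /itv01 hs /itv01 ht H.
case: drawing => _ _ _ nv ne.
have hs' : s = 0 \/ s = 1.
  case: hs => [||sI]; [by left|by right|exfalso].
  case: ht => [t0|t1|tI]; last exact: (ne e e' s t).
  - by have [|v hv] := @endP e' t eE' _; [left|apply: (nv e v s eE sI); rewrite H].
  - by have [|v hv] := @endP e' t eE' _; [right|apply: (nv e v s eE sI); rewrite H].
split=> //; case: ht => [||tI]; [by left|by right|exfalso].
by have [v hv] := endP eE hs'; apply: (nv e' v t eE' tI); rewrite -H.
Qed.

Let c0 : R := 0.
(** With this value, that the parameter [i / m] is past the cut becomes [2 m <= 3 i], an inequality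
    of integers. *)
Let c1 : R := 2%:R / 3%:R.
Let c2 : R := 1.

Let sub_c (x y t : R) : c0 <= x -> y <= c2 -> t \in `[x, y] -> t \in `[(0:R), 1].
Proof. by rewrite /c0 /c2 !in_itv /= => h1 h2 /andP[h3 h4]; apply/andP; split; lra. Qed.

Let within_sub e (x y : R) : e \in E -> c0 <= x -> y <= c2 -> {within `[x, y], continuous (arc e)}%classic.
Proof.
move=> eE h1 h2; apply: continuous_subspaceW (arc_cont eE) => t /= ht; exact: sub_c h1 h2 ht.
Qed.

(* Each arc is cut at [c1], well past its middle: its long first part belongs to the start of the
   edge and its last part to the end of the edge. Parts of different vertices meet at most within
   one arc, so distinct ones of different arcs have positive distance. *)
Let dist_cond (ee : {set G} * {set G}) (d : R) : Prop :=
  let: (e, e') := ee in e \in E -> e' \in E ->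
  [/\ en e != en e' -> forall s t, s \in `[c1, c2] -> t \in `[c1, c2] ->
        d <= dist1 (arc e s) (arc e' t),
      st e != st e' -> forall s t, s \in `[c0, c1] -> t \in `[c0, c1] ->
        d <= dist1 (arc e s) (arc e' t),
      e != e' -> st e != en e' -> forall s t, s \in `[c0, c1] -> t \in `[c1, c2] ->
        d <= dist1 (arc e s) (arc e' t) &
      st e != en e' -> forall t, t \in `[c1, c2] -> d <= dist1 (arc e 0) (arc e' t)].

Let dist_aux e e' (x y x' y' : R) (Q : bool) : e \in E -> e' \in E ->
  c0 <= x -> y <= c2 -> c0 <= x' -> y' <= c2 ->
  (Q -> forall s t, s \in `[x, y] -> t \in `[x', y'] -> arc e s <> arc e' t) ->
  exists2 d : R, 0 < d & Q -> forall s t, s \in `[x, y] -> t \in `[x', y'] ->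
    d <= dist1 (arc e s) (arc e' t).
Proof.
move=> eE eE' h1 h2 h3 h4; case: Q => [|_]; last by exists 1.
move=> /(_ isT) H; have [d d0 hd] := disjoint_arcs_dist (within_sub eE h1 h2) (within_sub eE' h3 h4) H.
by exists d.
Qed.

Let ge_c1 (t : R) : c1 <= t -> t = 0 -> False.
Proof. by move=> h t0; move: h; rewrite t0 /c1; lra. Qed.

Let le_c1 (t : R) : t <= c1 -> t = 1 -> False.
Proof. by move=> h t0; move: h; rewrite t0 /c1; lra. Qed.

Let dist_cond_ex ee : exists2 d : R, 0 < d & dist_cond ee d.
Proof.
case: ee => e e'.
case: (boolP (e \in E)) => [eE|/negPf eE]; last by exists 1 => //=; rewrite eE.
case: (boolP (e' \in E)) => [eE'|/negPf eE']; last by exists 1 => //=; rewrite eE'.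
have [_ ne1 a0 a1] := ends eE; have [_ ne2 b0 b1] := ends eE'.
have c00 : c0 <= c0 by []. have c22 : c2 <= c2 by [].
have c01 : c0 <= c1 by rewrite /c0 /c1; lra.
have c12 : c1 <= c2 by rewrite /c2 /c1; lra.
have c02 : c0 <= c2 by rewrite /c0 /c2; lra.
have [|d1 d10 h1] := @dist_aux e e' c1 c2 c1 c2 (en e != en e') eE eE' c01 c22 c01 c22.
  move=> ne s t hs ht H; have ee' : e != e' by apply: contraNneq ne => ->.
  case: (meet_ends eE eE' ee' (sub_c c01 c22 hs) (sub_c c01 c22 ht) H).
  move: hs ht; rewrite !in_itv /= => /andP[hs _] /andP[ht _].
  case=> [/(ge_c1 hs)//|s1] [/(ge_c1 ht)//|t1].
  by case/eqP: ne; apply: pt_inj; rewrite -a1 -b1 -s1 H t1 s1.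
have [|d2 d20 h2] := @dist_aux e e' c0 c1 c0 c1 (st e != st e') eE eE' c00 c12 c00 c12.
  move=> ne s t hs ht H; have ee' : e != e' by apply: contraNneq ne => ->.
  case: (meet_ends eE eE' ee' (sub_c c00 c12 hs) (sub_c c00 c12 ht) H).
  move: hs ht; rewrite !in_itv /= => /andP[_ hs] /andP[_ ht].
  case=> [s0|/(le_c1 hs)//] [t0|/(le_c1 ht)//].
  by case/eqP: ne; apply: pt_inj; rewrite -a0 -b0 -s0 H t0 s0.
have [|d3 d30 h3] := @dist_aux e e' c0 c1 c1 c2 ((e != e') && (st e != en e')) eE eE' c00 c12 c01 c22.
  move=> /andP[ee' ne] s t hs ht H.
  case: (meet_ends eE eE' ee' (sub_c c00 c12 hs) (sub_c c01 c22 ht) H).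
  move: hs ht; rewrite !in_itv /= => /andP[_ hs] /andP[ht _].
  case=> [s0|/(le_c1 hs)//] [/(ge_c1 ht)//|t1].
  by case/eqP: ne; apply: pt_inj; rewrite -a0 -b1 -s0 H t1.
(* This includes [e = e'], which the previous clause excludes: injectivity keeps the start of an arc
   away from its own last part. *)
have [|d4 d40 h4] := @dist_aux e e' c0 c0 c1 c2 (st e != en e') eE eE' c00 c02 c01 c22.
  move=> ne s t hs ht; have s0 : s = 0.
    by move: hs; rewrite in_itv /= /c0 => hs; apply/eqP; rewrite eq_le andbC.
  have I0 : (0:R) \in `[0, 1] by rewrite in_itv /= lexx ler01.
  rewrite s0 => H; case: (eqVneq e e') => [ee|ee'].
    have /esym t0 : 0 = t by apply: (arc_inj eE) => //; [exact: sub_c ht | rewrite {2}ee].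
    by move: ht; rewrite in_itv /= => /andP[/ge_c1/(_ t0)].
  case: (meet_ends eE eE' ee' I0 (sub_c c01 c22 ht) H) => _.
  move: ht; rewrite in_itv /= => /andP[ht _] [/(ge_c1 ht)//|t1].
  by case/eqP: ne; apply: pt_inj; rewrite -a0 -b1 H t1.
exists (Num.min (Num.min d1 d2) (Num.min d3 d4)); first by rewrite !lt_min d10 d20 d30 d40.
move=> _ _; split.
- by move=> ne s t hs ht; apply: le_trans (h1 ne s t hs ht); rewrite !ge_min lexx.
- by move=> ne s t hs ht; apply: le_trans (h2 ne s t hs ht); rewrite !ge_min lexx ?orbT.
- move=> ee' ne s t hs ht; apply: le_trans (h3 _ s t hs ht); rewrite ?ge_min ?lexx ?orbT //.
  by rewrite ee'.
- move=> ne t ht; apply: le_trans (h4 ne 0 t _ ht); rewrite ?ge_min ?lexx ?orbT //.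
  by rewrite in_itv /= /c0 lexx.
Qed.

Let arc_pt (m : nat) (e : {set G}) (i : nat) : R * R := arc e (i%:R / m%:R).
(* The odd points change one coordinate at a time, so that consecutive points lie in the same
   grid cell or in cells with a common side. *)
Let chain m e k : R * R :=
  if odd k then ((arc_pt m e k./2.+1).1, (arc_pt m e k./2).2) else arc_pt m e k./2.

Lemma drawing_grid_minor : grid_minor E.
Proof.
have [d d0 hd] : exists2 d : R, 0 < d & forall ee, dist_cond ee d.
  apply: uniform_pos dist_cond_ex => -[e e'] x y yx H eE eE'.
  case: (H eE eE') => h1 h2 h3 h4; split.
  - by move=> *; apply: le_trans yx _; apply: h1.
  - by move=> *; apply: le_trans yx _; apply: h2.
  - by move=> *; apply: le_trans yx _; apply: h3.
  - by move=> *; apply: le_trans yx _; apply: h4.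
(* Two chain points in one cell are at distance below [2 dl], and each is within [dl] of its arc
   point, so the arc points are closer than [4 dl < d]. *)
pose dl := d / 8%:R; have dl0 : 0 < dl by apply: divr_gt0 => //; rewrite ltr0n.
have [m hm] : exists m : nat, forall e, e \in E -> (0 < m)%N /\
    forall i, (i < m)%N -> dist1 (arc_pt m e i) (arc_pt m e i.+1) < dl.
  pose P e n := e \in E -> (0 < n)%N /\ forall m, (n <= m)%N ->
    forall i, (i < m)%N -> dist1 (arc_pt m e i) (arc_pt m e i.+1) < dl.
  have [n Pn] : exists n, forall e, P e n.
    apply: uniform_nat => [e n n' nn' Pn eE | e].
      case: (Pn eE) => n0 H; split; first exact: leq_trans nn'.
      by move=> m /(leq_trans nn'); exact: H.
    case: (boolP (e \in E)) => [eE|/negPf eE]; last by exists 1%N; rewrite /P eE.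
    have [n n0 Hn] := arc_subdivision dl0 (arc_cont eE).
    by exists n => _; split=> // m nm i im; exact: Hn.
  by exists n => e /Pn[n0 H]; split=> //; apply: H.
have [B hB] : exists B, forall ei : {set G} * 'I_m.+1,
    1 <= (arc_pt m ei.1 ei.2).1 / dl + B /\ 1 <= (arc_pt m ei.1 ei.2).2 / dl + B.
  apply: uniform_up => [[e i] x y xy [h1 h2] | [e i]]; first by split; lra.
  set u := _.1 / _; set v := _.2 / _; exists (1 + `|u| + `|v|).
  have := ler_norm (- u); have := ler_norm (- v); have := normr_ge0 u; have := normr_ge0 v.
  rewrite !normrN /=; split; lra.
have {}hB e i : (i <= m)%N -> 1 <= (arc_pt m e i).1 / dl + B /\ 1 <= (arc_pt m e i).2 / dl + B.
  by rewrite -ltnS => im; exact: (hB (e, Ordinal im)).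
have hBc e k : (k <= m.*2)%N -> 1 <= (chain m e k).1 / dl + B /\ 1 <= (chain m e k).2 / dl + B.
  move=> km; rewrite /chain; have km' : (k./2 <= m)%N by lia.
  case: ifP => ok /=; last exact: hB.
  have km2 : (k./2.+1 <= m)%N by lia.
  by split; [case: (hB e _ km2) | case: (hB e _ km')].
pose g e k := gridpt dl B (chain m e k).
have g_pos e k : (k <= m.*2)%N -> (0 < (g e k).1 /\ 0 < (g e k).2)%N.
  by move=> km; case: (hBc e k km) => h1 h2; split; apply: cell1_gt0.
have half e i : e \in E -> (i < m)%N -> `|(arc_pt m e i).1 - (arc_pt m e i.+1).1| < dl /\
    `|(arc_pt m e i).2 - (arc_pt m e i.+1).2| < dl.
  move=> eE im; case: (hm e eE) => _ /(_ i im); rewrite /dist1.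
  have := normr_ge0 ((arc_pt m e i).1 - (arc_pt m e i.+1).1).
  have := normr_ge0 ((arc_pt m e i).2 - (arc_pt m e i.+1).2).
  by move=> h1 h2 h3; split; lra.
have g_step e k : e \in E -> (k < m.*2)%N -> gstep (g e k) (g e k.+1).
  move=> eE km; have im : (k./2 < m)%N by lia.
  have [h1 h2] := half e _ eE im.
  have := hBc e k (ltnW km); have := hBc e k.+1 km.
  rewrite /g /chain /= /gstep uphalf_half; case: (odd k) => /=; rewrite ?add0n ?add1n => -[b1 b2] [b3 b4].
    by rewrite eqxx; case: (cell1_step dl0 b4 b2 h2) => ->; rewrite !eqxx ?orbT.
  by rewrite eqxx /=; case: (cell1_step dl0 b3 b1 h1) => ->; rewrite !eqxx ?orbT.
have chain_near e k : e \in E -> (k <= m.*2)%N ->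
    dist1 (chain m e k) (arc_pt m e k./2) < dl.
  move=> eE km; rewrite /chain; case: ifP => ok; last by rewrite /dist1 !subrr normr0 addr0.
  have im : (k./2 < m)%N by lia.
  by have [h1 _] := half e _ eE im; rewrite /dist1 /= subrr normr0 addr0 distrC.
have near_pts e k e' k' : e \in E -> e' \in E -> (k <= m.*2)%N -> (k' <= m.*2)%N ->
    g e k = g e' k' -> dist1 (arc_pt m e k./2) (arc_pt m e' k'./2) < d.
  move=> eE eE' km km' [E1 E2].
  have [b1 b2] := hBc e k km; have [b3 b4] := hBc e' k' km'.
  have n1 := cell1_near dl0 b1 b3 E1; have n2 := cell1_near dl0 b2 b4 E2.
  have c1' := chain_near e k eE km; have c2' := chain_near e' k' eE' km'.
  have t1 := dist1_triangle (arc_pt m e k./2) (chain m e k) (arc_pt m e' k'./2).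
  have t2 := dist1_triangle (chain m e k) (chain m e' k') (arc_pt m e' k'./2).
  have t3 : dist1 (chain m e k) (chain m e' k') < dl + dl by rewrite /dist1; lra.
  move: c1'; rewrite dist1C => c1''; rewrite /dl in c1'' c2' t3; lra.
have m0 e : e \in E -> (0 < m)%N by case/hm.
have tau e k : e \in E -> (k <= m.*2)%N -> let t := (k./2)%:R / m%:R : R in
    [/\ 0 <= t, t <= 1, (m.*2 <= 3 * k./2)%N -> c1 <= t & (3 * k./2 <= m.*2)%N -> t <= c1].
  move=> eE km t; have mp : 0 < m%:R :> R by rewrite ltr0n; exact: m0 eE.
  have tm : t * m%:R = (k./2)%:R by rewrite /t divfK // gt_eqF.
  have km2 : (k./2 <= m)%N by lia.
  split.
  - by rewrite /t divr_ge0 // ler0n.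
  - by rewrite /t ler_pdivrMr // mul1r ler_nat.
  - move=> h; rewrite /t ler_pdivlMr // /c1 mulrAC ler_pdivrMr ?ltr0n //.
    by rewrite -!natrM ler_nat; lia.
  - move=> h; rewrite /t ler_pdivrMr // /c1 mulrAC ler_pdivlMr ?ltr0n //.
    by rewrite -!natrM ler_nat; lia.
(* [Q v] consists of the last parts of the arcs that end at [v]; to it [U v] adds, for each arc
   that starts at [v], the cells met before the arc first enters [Q] of its end. *)
pose inR k := (k <= m.*2)%N && (m.*2 <= 3 * k./2)%N.
pose Q v p := exists e k, [/\ e \in E, en e = v, inR k & g e k = p].
pose pre e k := (k <= m.*2)%N /\ forall k', (k' <= k)%N -> ~ Q (en e) (g e k').
pose U v p := Q v p \/ exists e k, [/\ e \in E, st e = v, pre e k & g e k = p].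
have inRmem e k : e \in E -> inR k -> ((k./2)%:R / m%:R : R) \in `[c1, c2].
  by move=> eE /andP[km h]; case: (tau e k eE km) => t0 t1 t2 t3; rewrite in_itv /= t2.
have preL e k : e \in E -> pre e k -> (k <= m.*2)%N /\ ((k./2)%:R / m%:R : R) \in `[c0, c1].
  move=> eE [km H]; split=> //; case: (tau e k eE km) => t0 t1 t2 t3; rewrite in_itv /= t0 /=.
  apply: t3; case: (leqP (3 * k./2) m.*2) => // /ltnW h; case: (H k (leqnn _)).
  by exists e, k; split=> //; rewrite /inR km.
have QQ u v p : Q u p -> Q v p -> u = v.
  move=> [e [k [eE eu kR <-]]] [e' [k' [eE' ev kR' H]]].
  have [km _] := andP kR; have [km' _] := andP kR'.
  case: (hd (e, e') eE eE') => h _ _ _; apply/eqP; rewrite -eu -ev; apply/negPn/negP => ne.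
  have := h ne _ _ (inRmem e k eE kR) (inRmem e' k' eE' kR').
  by rewrite leNgt (near_pts _ _ _ _ eE eE' km km' (esym H)).
(* By the choice of [pre], these cells avoid [Q] of the end of [e]; distance keeps them away from
   [Q] of every other vertex but the start. *)
have QP u e k : e \in E -> pre e k -> Q u (g e k) -> u = st e.
  move=> eE pk; have [km kL] := preL _ _ eE pk; case: (pk) => _ nk.
  case: (eqVneq u (en e)) => [->|ue] Qu; first by case: (nk k (leqnn _)).
  case: Qu => e' [k' [eE' eu kR' H]]; have [km' _] := andP kR'.
  case: (hd (e, e') eE eE') => _ _ h _; apply/eqP; rewrite -eu; apply/negPn/negP => ne.
  have ee' : e != e' by apply: contraNneq ue => ->; rewrite eu.
  rewrite eq_sym in ne.
  have := h ee' ne _ _ kL (inRmem e' k' eE' kR').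
  by rewrite leNgt (near_pts _ _ _ _ eE eE' km km' (esym H)).
have first_not_Q e u : e \in E -> Q u (g e 0%N) -> u <> st e -> False.
  move=> eE [e' [k' [eE' eu kR' H]]] ne; have [km' _] := andP kR'.
  case: (hd (e, e') eE eE') => _ _ _ h.
  have := h _ _ (inRmem e' k' eE' kR'); rewrite eu => /(_ _).
  have ne' : st e != u by apply/eqP => /esym.
  move=> /(_ ne'); rewrite leNgt.
  have -> : arc e 0 = arc_pt m e (0./2) by rewrite /arc_pt /= mul0r.
  by rewrite (near_pts _ _ _ _ eE eE' (leq0n _) km' (esym H)).
exists U, (fun v => gridpt dl B (pt v)); split.
- move=> u v p [Qu|[e [k [eE eu pk Eg]]]] [Qv|[e' [k' [eE' ev pk' Eg']]]].
  + exact: QQ Qu Qv.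
  + by rewrite -ev; apply: (QP u e' k') => //; rewrite Eg'.
  + by rewrite -eu; apply/esym; apply: (QP v e k) => //; rewrite Eg.
  + have [km kL] := preL _ _ eE pk; have [km' kL'] := preL _ _ eE' pk'.
    case: (hd (e, e') eE eE') => _ h _ _; apply/eqP; rewrite -eu -ev; apply/negPn/negP => ne.
    have := h ne _ _ kL kL'.
    by rewrite leNgt (near_pts _ _ _ _ eE eE' km km') // Eg Eg'.
- move=> v p [[e [k [eE _ /andP[km _] <-]]]|[e [k [eE _ [km _] <-]]]]; exact: g_pos.
move=> e eE; have [ee ne a0 a1] := ends eE.
have mp := m0 e eE.
have gstart f : f \in E -> g f 0%N = gridpt dl B (pt (st f)).
  by move=> fE; case: (ends fE) => _ _ b0 _; rewrite /g /chain /= /arc_pt mul0r b0.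
have gend f : f \in E -> g f m.*2 = gridpt dl B (pt (en f)).
  move=> fE; case: (ends fE) => _ _ _ b1; rewrite /g /chain odd_double /arc_pt doubleK divff ?b1 //.
  by rewrite pnatr_eq0 -lt0n.
have exQ : exists k, (k <= m.*2)%N && `[< Q (en e) (g e k) >].
  exists m.*2; rewrite leqnn /=; apply/asboolP; exists e, m.*2; split=> //.
  by rewrite /inR leqnn doubleK /=; lia.
case: (ex_minnP exQ) => k /andP[km /asboolP Qk] kmin.
have k0 : (0 < k)%N.
  rewrite lt0n; apply/eqP => k0; rewrite k0 in Qk.
  by apply: (first_not_Q e (en e) eE Qk) => /eqP; rewrite eq_sym (negPf ne).
have pre_lt i : (i < k)%N -> pre e i.
  move=> ik; split; first by apply: leq_trans km; exact: ltnW.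
  move=> k' k'i Qk'; have : (k <= k')%N; last by rewrite leqNgt (leq_ltn_trans k'i ik).
  apply: kmin; apply/andP; split; last exact/asboolP.
  by rewrite (leq_trans k'i) // (leq_trans (ltnW ik)).
exists (st e), (en e), (g e k.-1), (g e k); split=> //.
- have := g_step e k.-1 eE; rewrite prednK //; exact.
- exists k.-1, (g e); split=> //; first exact: gstart.
  + move=> i ik; right; exists e, i; split=> //; apply: pre_lt.
    by rewrite -(prednK k0).
  + move=> i ik; apply: g_step => //; lia.
(* The cell where [e] enters [Q] may belong to another arc [e'] with the same end; following [e']
   forwards leads to that end. *)
- case: (Qk) => e' [k' [eE' ev /andP[km' kR'] <-]].
  apply: reach_rev; exists (m.*2 - k')%N, (fun i => g e' (k' + i)%N); split.
  + by rewrite addn0.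
  + by rewrite subnKC // gend // ev.
  + move=> i ik; left; exists e', (k' + i)%N; split=> //.
    rewrite /inR; apply/andP; split; lia.
  + move=> i ik; rewrite addnS; apply: g_step => //; lia.
Qed.
End Ends.

Lemma planar_grid_minor : grid_minor E.
Proof.
case: (set_0Vmem E) => [E0|[e eE]].
  by exists (fun _ _ => False), (fun _ => (0, 0)%N); split=> // e; rewrite E0 inE.
have [v0 _] : exists v0 : G, True.
  by case: drawing => _ _ /(_ e eE)[x _] _ _; exists x.
by have [st [en H]] := edge_ends_exist v0; exact: drawing_grid_minor H.
Qed.

End PlanarMinor.

(** * Facial families *)

Notation "\xor_ ( i <- r | P ) F" := (\big[addb/false]_(i <- r | P) F)
  (at level 41, F at level 41, i, r at level 50).
Notation "\xor_ ( i <- r ) F" := (\big[addb/false]_(i <- r) F)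
  (at level 41, F at level 41, i, r at level 50).
Notation "\xor_ ( i < n ) F" := (\big[addb/false]_(i < n) F)
  (at level 41, F at level 41, i, n at level 50).
Notation "\xor_ ( i | P ) F" := (\big[addb/false]_(i | P) F)
  (at level 41, F at level 41, i at level 50).
Notation "\xor_ ( i 'in' A ) F" := (\big[addb/false]_(i in A) F)
  (at level 41, F at level 41, i, A at level 50).
Notation "\xor_ ( i : t ) F" := (\big[addb/false]_(i : t) F)
  (at level 41, F at level 41, i at level 50).

Lemma odd_card_xor (T : finType) (A : {pred T}) : odd #|A| = \xor_(x : T) (x \in A).
Proof.
rewrite -sum1_card (big_morph odd oddD (erefl _)) big_mkcond /=.
by apply: eq_bigr => x _; case: (x \in A).
Qed.

Definition even_set (V : finType) (Z : {set {set V}}) : Prop :=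
  forall v, \xor_(e in Z) (v \in e) = false.

(* The condition of Mac Lane's planarity criterion: a family of even sets that spans the cycle space
   and covers each edge at most twice, like the face boundaries of a plane graph. *)
Definition facial_family (V : finType) (D : {set {set V}}) (F : {set {set {set V}}}) : Prop :=
  [/\ forall f, f \in F -> [/\ f \subset D, f != set0 & even_set f],
      forall e, e \in D -> #|[set f in F | e \in f]| <= 2 &
      forall Z : {set {set V}}, Z \subset D -> even_set Z -> exists2 T : {set {set {set V}}}, T \subset F &
        forall e, e \in D -> (e \in Z) = \xor_(f in T) (e \in f)].

Definition nbr4 (w : nat * nat) : seq (nat * nat) :=
  [:: (w.1.+1, w.2); (w.1.-1, w.2); (w.1, w.2.+1); (w.1, w.2.-1)].

Definition gadj (p q : nat * nat) := gstep p q && (p != q).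

Lemma gadj_sym p q : gadj p q = gadj q p.
Proof. by rewrite /gadj gstep_sym eq_sym. Qed.

Lemma nbr4_gadj w w' : 0 < w.1 -> 0 < w.2 -> (w' \in nbr4 w) = gadj w w'.
Proof.
case: w w' => [x y] [x' y'] /= x0 y0.
rewrite !inE /gadj /gstep !xpair_eqE /=; lia.
Qed.

Lemma nbr4_uniq w : 0 < w.1 -> 0 < w.2 -> uniq (nbr4 w).
Proof. case: w => x y /= x0 y0; rewrite !inE !xpair_eqE /=; lia. Qed.

(** A path as a chain modulo 2: a stationary step counts twice and cancels, and so do a step and its
    reverse. *)
Definition traversals (n : nat) (g : nat -> nat * nat) (w w' : nat * nat) : bool :=
  \xor_(k < n) (((g k, g k.+1) == (w, w')) (+) ((g k, g k.+1) == (w', w))).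

Lemma traversals_sym n g w w' : traversals n g w w' = traversals n g w' w.
Proof. by apply: eq_bigr => k _; rewrite addbC. Qed.

Lemma xor_uniq_pred1 (T : eqType) (s : seq T) (x : T) : uniq s ->
  \xor_(y <- s) (x == y) = (x \in s).
Proof.
elim: s => [|y s IH] /=; first by rewrite big_nil.
by case/andP=> ys us; rewrite big_cons IH // inE; case: eqP => // ->; rewrite (negPf ys).
Qed.

(** The boundary of a path modulo 2 is the sum of its two ends, as each step moves the boundary
    point along. *)
Lemma traversals_star n g w : (forall k, k < n -> gstep (g k) (g k.+1)) -> 0 < w.1 -> 0 < w.2 ->
  \xor_(w' <- nbr4 w) traversals n g w w' = (g 0 == w) (+) (g n == w).
Proof.
move=> gs w1 w2; rewrite exchange_big /=.
elim: n gs => [|n IH] gs; first by rewrite big_ord0 addbb.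
rewrite big_ord_recr /= IH; last by move=> k kn; apply: gs; exact: ltnW.
suff -> : \xor_(j <- nbr4 w) (((g n, g n.+1) == (w, j)) (+) ((g n, g n.+1) == (j, w))) =
   (g n == w) (+) (g n.+1 == w) by rewrite addbA -(addbA (g 0 == w)) addbb addbF.
have gn := gs n (ltnSn _); rewrite big_split /=.
have key a b : gstep a b -> \xor_(j <- nbr4 w) ((a, b) == (w, j)) = (a == w) && (b != w).
  move=> ab; case: eqP => [aw|nw] /=; last first.
    by rewrite big1 // => j _; rewrite xpair_eqE; case: eqP.
  transitivity (\xor_(j <- nbr4 w) (b == j)).
    by apply: eq_bigr => j _; rewrite xpair_eqE aw eqxx.
  by rewrite xor_uniq_pred1 ?nbr4_uniq // nbr4_gadj // /gadj -aw ab eq_sym.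
rewrite key //.
have -> : \xor_(i <- nbr4 w) ((g n, g n.+1) == (i, w)) = \xor_(i <- nbr4 w) ((g n.+1, g n) == (w, i)).
  by apply: eq_bigr => i _; rewrite !xpair_eqE andbC.
by rewrite key 1?gstep_sym //; case: (g n == w); case: (g n.+1 == w).
Qed.

(* The two unit squares on either side of the grid edge [ww'], named by their upper right corner. *)
Definition cellA (w w' : nat * nat) := (maxn w.1 w'.1, maxn w.2 w'.2).
Definition cellB (w w' : nat * nat) :=
  if w.2 == w'.2 then (maxn w.1 w'.1, (maxn w.2 w'.2).+1) else ((maxn w.1 w'.1).+1, maxn w.2 w'.2).

(** The discrete substitute for the Jordan curve theorem: modulo 2, every cycle of the quarter grid
    bounds a set of squares. *)
Lemma even_grid_boundary (Z : nat * nat -> nat * nat -> bool) :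
  (forall w w', Z w w' = Z w' w) ->
  (forall w w', (w.1 == 0) || (w.2 == 0) -> Z w w' = false) ->
  (forall w, 0 < w.1 -> 0 < w.2 -> \xor_(w' <- nbr4 w) Z w w' = false) ->
  exists s : nat * nat -> bool, forall w w', gadj w w' -> Z w w' = s (cellA w w') (+) s (cellB w w').
Proof.
move=> Zsym Z0 Zeven.
pose vt x y := Z (x, y) (x, y.+1); pose h x y := Z (x, y) (x.+1, y).
(* The parity of the edges of [Z] crossed by the horizontal ray from the square [c] to the left. *)
pose s (c : nat * nat) := if c.2 is j.+1 then \xor_(x < c.1) vt x j else false.
have vtE x y : vt x y = s (x, y.+1) (+) s (x.+1, y.+1).
  by rewrite /s /= big_ord_recr /= addbA addbb.
have vt0 x : vt x 0 = false by rewrite /vt Z0 //= orbT.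
have v0t y : vt 0 y = false by rewrite /vt Z0.
(* Induction from the axis, where [Z] vanishes: evenness at a grid point determines the edge to its
   right from the three other edges. *)
have hE x y : h x y = s (x.+1, y) (+) s (x.+1, y.+1).
  case: y => [|y].
    by rewrite /h Z0 ?orbT //= /s /= big1.
  elim: x => [|x IH]; first by rewrite /h Z0 //= /s /= !big_ord_recr !big_ord0 /= !v0t.
  have := Zeven (x.+1, y.+1) isT isT; rewrite /nbr4 !big_cons big_nil /= addbF.
  rewrite -/(h x.+1 y.+1) (Zsym _ (x, y.+1)) -/(h x y.+1) -/(vt x.+1 y.+1) (Zsym _ (x.+1, y)) -/(vt x.+1 y).
  rewrite IH /s /= [in X in _ -> _ = X]big_ord_recr /= [in X in _ -> _ = _ (+) X]big_ord_recr /=.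
  case: (h _ _); case: (vt x.+1 y.+1); case: (vt x.+1 y); do 2 case: (\big[_/_]_(_ < _) _) => //.
exists s => -[x y] [x' y']; rewrite /gadj /gstep /cellA /cellB /= xpair_eqE.
case: (eqVneq y y') => [<-|yy'] /=.
  rewrite maxnn andbT => /andP[+ xx']; rewrite (negPf xx') /= => /orP[] /eqP ->.
  - by rewrite (maxn_idPl (leqnSn _)) Zsym -/(h x' y) hE.
  - by rewrite (maxn_idPr (leqnSn _)) -/(h x y) hE.
rewrite orbF => /andP[/andP[/eqP <- +] _]; rewrite maxnn => /orP[] /eqP ->.
- by rewrite (maxn_idPl (leqnSn _)) Zsym -/(vt x y') vtE.
- by rewrite (maxn_idPr (leqnSn _)) -/(vt x y) vtE.
Qed.

Lemma reach_bounded U p q : reach U p q ->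
  exists m, forall M, m <= M -> reach (fun w => [/\ U w, w.1 < M & w.2 < M]) p q.
Proof.
case=> n [g [g0 gn gU gs]].
exists (\max_(k < n.+1) maxn (g k).1.+1 (g k).2.+1) => M mM; exists n, g; split=> // k kn.
have := leq_trans (@leq_bigmax _ (fun k : 'I_n.+1 => maxn (g k).1.+1 (g k).2.+1) (Ordinal (kn : k < n.+1))) mM.
by rewrite geq_max => /andP[]; split=> //; exact: gU.
Qed.

Lemma traversals_eq0 n g w w' : (forall k, k < n -> (g k, g k.+1) <> (w, w')) ->
  (forall k, k < n -> (g k, g k.+1) <> (w', w)) -> traversals n g w w' = false.
Proof.
move=> h1 h2; apply: big1 => -[k kn] _ /=.
by apply/negbTE; rewrite negb_add; move/eqP/negPf: (h1 k kn) => ->; move/eqP/negPf: (h2 k kn) => ->.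
Qed.

(** * Faces of a minor of a bounded grid *)

Section MacLane.
Variables (V : finType) (D : {set {set V}}).
Variables (U : V -> nat * nat -> Prop) (o : V -> nat * nat) (M : nat).
Hypothesis U_disj : forall u v p, U u p -> U v p -> u = v.
Hypothesis U_bnd : forall v p, U v p -> [/\ 0 < p.1, 0 < p.2, p.1 < M & p.2 < M].
Variables (ex ey : {set V} -> V) (ep eq : {set V} -> nat * nat).
Variables (nx ny : {set V} -> nat) (gx gy : {set V} -> nat -> nat * nat).
Hypothesis De : forall e, e \in D -> e = [set ex e; ey e] /\ ex e != ey e.
Hypothesis Dp : forall e, e \in D -> gstep (ep e) (eq e).
Hypothesis Dgx : forall e, e \in D ->
  [/\ gx e 0 = o (ex e), gx e (nx e) = ep e, forall k, k <= nx e -> U (ex e) (gx e k) &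
      forall k, k < nx e -> gstep (gx e k) (gx e k.+1)].
Hypothesis Dgy : forall e, e \in D ->
  [/\ gy e 0 = o (ey e), gy e (ny e) = eq e, forall k, k <= ny e -> U (ey e) (gy e k) &
      forall k, k < ny e -> gstep (gy e k) (gy e k.+1)].

Let Up e : e \in D -> U (ex e) (ep e).
Proof. by case/Dgx => _ <- H _; exact: H. Qed.

Let Uq e : e \in D -> U (ey e) (eq e).
Proof. by case/Dgy => _ <- H _; exact: H. Qed.

Let gadj_pq e : e \in D -> gadj (ep e) (eq e).
Proof.
move=> eD; rewrite /gadj Dp //=; apply/eqP => E.
have [_ /eqP[]] := De eD; apply: (U_disj (Up eD)); rewrite E; exact: Uq.
Qed.

Let isp e (w w' : nat * nat) := ((ep e, eq e) == (w, w')) (+) ((ep e, eq e) == (w', w)).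

(* The grid edges traversed an odd number of times by the walk from [o (ex e)] to [o (ey e)] that
   crosses from the branch set of [ex e] to that of [ey e] along [e]. *)
Let W e w w' := traversals (nx e) (gx e) w w' (+) traversals (ny e) (gy e) w w' (+) isp e w w'.

Let isp_traversal e w w' : isp e w w' = traversals 1 (fun k => if k == 0 then ep e else eq e) w w'.
Proof. by rewrite /traversals big_ord_recr big_ord0. Qed.

Let W_sym e w w' : W e w w' = W e w' w.
Proof. by rewrite /W !isp_traversal !(traversals_sym _ _ w). Qed.

(** The inner ends [ep e] and [eq e] of the three pieces cancel. *)
Let W_star e w : e \in D -> 0 < w.1 -> 0 < w.2 ->
  \xor_(w' <- nbr4 w) W e w w' = (o (ex e) == w) (+) (o (ey e) == w).
Proof.
move=> eD w1 w2; have [x0 xn _ xs] := Dgx eD; have [y0 yn _ ys] := Dgy eD.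
have -> : \xor_(w' <- nbr4 w) W e w w' = \xor_(w' <- nbr4 w) traversals (nx e) (gx e) w w' (+)
    \xor_(w' <- nbr4 w) traversals (ny e) (gy e) w w' (+)
    \xor_(w' <- nbr4 w) traversals 1 (fun k => if k == 0 then ep e else eq e) w w'.
  by rewrite -!big_split; apply: eq_bigr => w' _; rewrite /W isp_traversal.
rewrite !traversals_star //; last by case=> // _ /=; exact: Dp.
rewrite x0 xn y0 yn /=.
by case: (_ == w); case: (_ == w); case: (_ == w); case: (_ == w).
Qed.

Let W_off e w w' : e \in D -> (w.1 == 0) || (w.2 == 0) -> W e w w' = false.
Proof.
move=> eD w0; have nU v : ~ U v w by case/U_bnd; case/orP: w0 => /eqP ->.
have [_ xn xU _] := Dgx eD; have [_ yn yU _] := Dgy eD.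
rewrite /W !traversals_eq0 => [/=||||].
- have h1 : (ep e == w) = false by apply/eqP => E; apply: (nU (ex e)); rewrite -E; exact: Up.
  have h2 : (eq e == w) = false by apply/eqP => E; apply: (nU (ey e)); rewrite -E; exact: Uq.
  by rewrite /isp !xpair_eqE h1 h2 andbF.
- by move=> k kn [E _]; apply: (nU (ey e)); rewrite -E; apply: yU; exact: ltnW.
- by move=> k kn [_ E]; apply: (nU (ey e)); rewrite -E; apply: yU.
- by move=> k kn [E _]; apply: (nU (ex e)); rewrite -E; apply: xU; exact: ltnW.
- by move=> k kn [_ E]; apply: (nU (ex e)); rewrite -E; apply: xU.
Qed.

(** All grid edges inside a branch set are included, used by a walk or not; hence the boundary of a
    face can leave a branch set only along edges of [D]. *)
Let supp (w w' : nat * nat) : Prop :=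
  (exists v, U v w /\ U v w') \/ (exists2 e, e \in D & isp e w w').

Let W_supp e w w' : e \in D -> W e w w' -> supp w w'.
Proof.
move=> eD; have [_ xn xU _] := Dgx eD; have [_ yn yU _] := Dgy eD.
have st n g v : (forall k, k <= n -> U v (g k)) -> traversals n g w w' -> U v w /\ U v w'.
  move=> gU H; apply: contrapT => nUU; move: H; rewrite traversals_eq0 // => k kn [E1 E2]; apply: nUU;
  by rewrite -E1 -E2; split; apply: gU => //; exact: ltnW.
rewrite /W; case: (boolP (traversals (nx e) _ _ _)) => [/(st _ _ _ xU)|_ /=]; first by left; exists (ex e).
case: (boolP (traversals (ny e) _ _ _)) => [/(st _ _ _ yU)|_ /=]; first by left; exists (ey e).
by right; exists e.
Qed.

Let isp_cross e e' : e \in D -> e' \in D -> isp e (ep e') (eq e') = (e == e').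
Proof.
move=> eD eD'; have [E' ne'] := De eD'; have [E ne] := De eD.
rewrite /isp; case: (eqVneq e e') => [<-|ne2].
  rewrite eqxx xpair_eqE; case: eqP => [E2|//]; case/eqP: ne; apply: (U_disj (Up eD)); rewrite E2; exact: Uq.
apply/negbTE; rewrite negb_add !xpair_eqE; apply/eqP; transitivity false.
  apply/negbTE/negP => /andP[/eqP h1 /eqP h2]; case/eqP: ne2; rewrite E E'.
  congr [set _; _]; [apply: (U_disj (Up eD)); rewrite h1; exact: Up |].
  by apply: (U_disj (Uq eD)); rewrite h2; exact: Uq.
apply/esym/negbTE/negP => /andP[/eqP h1 /eqP h2]; case/eqP: ne2; rewrite E E' setUC.
congr [set _; _]; [apply: (U_disj (Uq eD)); rewrite h2; exact: Up |].
by apply: (U_disj (Up eD)); rewrite h1; exact: Uq.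
Qed.

(** The pieces inside branch sets never pass from one branch set to another. Hence the crossing
    edges reveal which edges of [D] a sum of walks contains. *)
Let W_cross e e' : e \in D -> e' \in D -> W e (ep e') (eq e') = (e == e').
Proof.
move=> eD eD'; have [_ xn xU _] := Dgx eD; have [_ yn yU _] := Dgy eD.
have [E' ne'] := De eD'.
have nn n g v : (forall k, k <= n -> U v (g k)) -> traversals n g (ep e') (eq e') = false.
  move=> gU; apply: traversals_eq0 => k kn [h1 h2].
    have := gU k (ltnW kn); have := gU k.+1 kn; rewrite h1 h2 => u2 u1.
    by case/eqP: ne'; rewrite (U_disj (Up eD') u1) (U_disj (Uq eD') u2).
  have := gU k (ltnW kn); have := gU k.+1 kn; rewrite h1 h2 => u2 u1.
  by case/eqP: ne'; rewrite (U_disj (Up eD') u2) (U_disj (Uq eD') u1).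
by rewrite /W !(nn _ _ _ xU) !(nn _ _ _ yU) isp_cross.
Qed.

(** The grid points considered have coordinates at most [M]; a square, named by its upper right
    corner, may exceed this by one. *)
Let cell : finType := ('I_M.+2 * 'I_M.+2)%type.
Let toc (p : nat * nat) : cell := (inord p.1, inord p.2).
Let ofc (c : cell) : nat * nat := (val c.1, val c.2).

Let tocK p : p.1 <= M.+1 -> p.2 <= M.+1 -> ofc (toc p) = p.
Proof. by case: p => i j /= h1 h2; rewrite /ofc /= !inordK. Qed.

(* The faces are the classes of squares that can be joined without crossing a grid edge used by
   some walk [W e]; the boundary of such a class is a set of edges of [D]. *)
Let crel : rel cell := fun c c' => `[< exists w w', [/\ gadj w w', ~ supp w w' &
  (ofc c = cellA w w' /\ ofc c' = cellB w w') \/ (ofc c' = cellA w w' /\ ofc c = cellB w w')] >].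

Let crel_sym : connect_sym crel.
Proof.
apply: sym_connect_sym => c c'; apply/asbool_equiv_eq.
by split=> -[w [w' [h1 h2 h3]]]; exists w, w'; split=> //; case: h3; [right|left|right|left].
Qed.

Let bd (K : cell) (w w' : nat * nat) : bool :=
  (fingraph.root crel (toc (cellA w w')) == K) (+) (fingraph.root crel (toc (cellB w w')) == K).

Let cell_bnd w w' : gadj w w' -> w.1 <= M -> w.2 <= M -> w'.1 <= M -> w'.2 <= M ->
  ofc (toc (cellA w w')) = cellA w w' /\ ofc (toc (cellB w w')) = cellB w w'.
Proof.
move=> _ h1 h2 h3 h4; rewrite !tocK // /cellA /cellB /=; try case: ifP => _ /=; rewrite ?ltnS ?geq_max ?h1 ?h2 ?h3 ?h4 //.
all: by rewrite ?(leq_trans _ (leqnSn _)) // geq_max h1 h2 h3 h4.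
Qed.

Let bd_supp K w w' : gadj w w' -> w.1 <= M -> w.2 <= M -> w'.1 <= M -> w'.2 <= M ->
  bd K w w' -> supp w w'.
Proof.
move=> ww h1 h2 h3 h4 H; apply: contrapT => nS; move: H.
have [eA eB] := cell_bnd ww h1 h2 h3 h4.
have /connect1/(fingraph.rootP crel_sym) E : crel (toc (cellA w w')) (toc (cellB w w')).
  by apply/asboolP; exists w, w'; split=> //; left.
by rewrite /bd E addbb.
Qed.

Let bd_sym K w w' : bd K w w' = bd K w' w.
Proof.
have -> : bd K w w' = (fingraph.root crel (toc (cellA w' w)) == K) (+) (fingraph.root crel (toc (cellB w' w)) == K); last by [].
by rewrite /bd /cellA /cellB (maxnC w'.1) (maxnC w'.2) (eq_sym w'.2).
Qed.

(** Each of the four squares around [w] borders two of the four grid edges at [w]. *)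
Let bd_star K w : 0 < w.1 -> 0 < w.2 -> \xor_(w' <- nbr4 w) bd K w w' = false.
Proof.
case: w => x y /= x0 y0; rewrite /nbr4 !big_cons big_nil /bd /cellA /cellB /= !eqxx !maxnn.
have -> : (y == y.+1) = false by lia.
have -> : (y == y.-1) = false by lia.
have -> : maxn x x.+1 = x.+1 by lia. have -> : maxn x x.-1 = x by lia.
have -> : maxn y y.+1 = y.+1 by lia. have -> : maxn y y.-1 = y by lia.
by do 4 case: (_ == K).
Qed.

Let fK (K : cell) : {set {set V}} := [set e in D | bd K (ep e) (eq e)].
Let F : {set {set {set V}}} := [set fK K | K : cell] :\ set0.

Let bnd v p : U v p -> p.1 <= M /\ p.2 <= M.
Proof. by case/U_bnd => _ _ h1 h2; split; exact: ltnW. Qed.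

Let pq_bnd e : e \in D -> [/\ (ep e).1 <= M, (ep e).2 <= M, (eq e).1 <= M & (eq e).2 <= M].
Proof. by move=> eD; case: (bnd (Up eD)) => ? ?; case: (bnd (Uq eD)). Qed.

Let nbr_bnd v w w' : U v w -> gadj w w' -> [/\ w.1 <= M, w.2 <= M, w'.1 <= M & w'.2 <= M].
Proof.
case/U_bnd; case: w w' => [x y] [x' y'] /= h1 h2 h3 h4; rewrite /gadj /gstep /= xpair_eqE.
by move=> H; split; lia.
Qed.

Let mem_e e v : e \in D -> (v \in e) = (v == ex e) (+) (v == ey e).
Proof.
move=> /De[E ne]; rewrite {1}E in_set2.
by case: eqP => [->|_]; [rewrite (negPf ne)|case: eqP].
Qed.

Let pts : finType := ('I_M.+1 * 'I_M.+1)%type.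
Let opt (p : pts) : nat * nat := (val p.1, val p.2).
Let top (p : nat * nat) : pts := (inord p.1, inord p.2).

Let topK p : p.1 <= M -> p.2 <= M -> opt (top p) = p.
Proof. by case: p => i j /= h1 h2; rewrite /opt /= !inordK. Qed.

Let optK p : top (opt p) = p.
Proof. by case: p => i j; rewrite /top /opt /= !inord_val. Qed.

Let inU v p : bool := `[< U v (opt p) >].

Let star_pts K v p : inU v p -> \xor_(q : pts) (gadj (opt p) (opt q) && bd K (opt p) (opt q)) = false.
Proof.
move=> /asboolP Up'; have [p1 p2 _ _] := U_bnd Up'.
transitivity (\xor_(w <- nbr4 (opt p)) bd K (opt p) w); last exact: bd_star.
have -> : nbr4 (opt p) = map opt (map top (nbr4 (opt p))).
  rewrite -map_comp -[LHS]map_id; apply/eq_in_map => w wn /=; rewrite topK //;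
  by have [] := nbr_bnd Up' (_ : gadj (opt p) w); rewrite -?nbr4_gadj.
transitivity (\xor_(q | gadj (opt p) (opt q)) bd K (opt p) (opt q)).
  by rewrite [RHS]big_mkcond.
rewrite big_map big_uniq.
  apply: eq_bigl => q; rewrite -nbr4_gadj //.
  apply/idP/mapP => [qn|[w wn ->]]; first by exists (opt q).
  rewrite topK //; by have [] := nbr_bnd Up' (_ : gadj (opt p) w); rewrite -?nbr4_gadj.
rewrite map_inj_in_uniq ?nbr4_uniq // => w w' wn wn' E.
have [_ _ h1 h2] : [/\ (opt p).1 <= M, (opt p).2 <= M, w.1 <= M & w.2 <= M].
  by apply: (nbr_bnd Up'); rewrite -nbr4_gadj.
have [_ _ h3 h4] : [/\ (opt p).1 <= M, (opt p).2 <= M, w'.1 <= M & w'.2 <= M].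
  by apply: (nbr_bnd Up'); rewrite -nbr4_gadj.
by rewrite -(topK h1 h2) -(topK h3 h4) E.
Qed.

Let b K p q := gadj (opt p) (opt q) && bd K (opt p) (opt q).

Let b_sym K p q : b K p q = b K q p.
Proof. by rewrite /b gadj_sym bd_sym. Qed.

Lemma xor_sym0 (T : finType) (A : pred T) (r : T -> T -> bool) :
  (forall x y, r x y = r y x) -> (forall x, r x x = false) ->
  \xor_(x | A x) \xor_(y | A y) r x y = false.
Proof.
move=> rs r0.
have [n Hn] : exists n, n = #|A| by exists #|A|.
elim: n A Hn => [|n IH] A cA.
  by apply: big1 => x xA; move: (esym cA) => /card0_eq/(_ x); rewrite unfold_in xA.
have [x xA] : exists x, x \in A by apply/card_gt0P; rewrite -cA.
have cA' : n = #|[pred y | A y & y != x]|.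
  move: cA; rewrite (cardD1 x) xA /= add1n => -[->]; apply: eq_card => y.
  by rewrite !inE andbC.
rewrite (bigD1 x) //= (bigD1 x (P := A)) //= r0 addFb.
transitivity (\xor_(y | A y && (y != x)) r x y (+) \xor_(y | A y && (y != x)) (r y x (+) \xor_(z | A z && (z != x)) r y z)).
  congr (_ (+) _); apply: eq_bigr => y /andP[yA yx]; by rewrite (bigD1 x).
rewrite big_split /= (IH _ cA') addbF.
rewrite -big_split big1 //= => y _; by rewrite rs addbb.
Qed.

(** Summing the even stars of the points of the branch set of [v] counts inner boundary edges twice
    and leaves those that lead out. *)
Let cut_even K v : \xor_(p | inU v p) \xor_(q | ~~ inU v q) b K p q = false.
Proof.
have : \xor_(p | inU v p) \xor_(q : pts) b K p q = false by apply: big1 => p /star_pts ->.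
under eq_bigr => p _ do rewrite (bigID (inU v)) /=.
have b0 x : b K x x = false by rewrite /b /gadj eqxx andbF.
by rewrite big_split /= (xor_sym0 _ (b_sym K) b0).
Qed.

Let xor_pred1 (T : finType) (P : pred T) (x : T) (r : T -> bool) :
  \xor_(y | P y) ((x == y) && r y) = P x && r x.
Proof.
rewrite -big_mkcondr /=; case: (boolP (P x)) => Px /=.
  by rewrite (big_pred1 x) // => y /=; rewrite (eq_sym y) andbC; case: eqP => [<-|//]; rewrite Px.
by rewrite big1 // => y /andP[Py /eqP xy]; rewrite xy Py in Px.
Qed.

(** By [bd_supp], a boundary edge that leaves the branch set of [v] is the crossing edge of an edge
    of [D] at [v], so [cut_even] is the claim. The two summands are the two orientations of a
    crossing edge. *)
Let fK_even K : even_set (fK K).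
Proof.
move=> v; transitivity (\xor_(p | inU v p) \xor_(q | ~~ inU v q) b K p q); last exact: cut_even.
rewrite big_mkcond /=.
transitivity (\xor_(e in D) \xor_(p | inU v p) \xor_(q | ~~ inU v q)
   (((top (ep e) == p) && (top (eq e) == q) && bd K (opt p) (opt q)) (+)
    ((top (eq e) == p) && (top (ep e) == q) && bd K (opt p) (opt q)))).
  rewrite [RHS]big_mkcond; apply: eq_bigr => e _; rewrite inE; case: (boolP (e \in D)) => //= eD.
  have [h1 h2 h3 h4] := pq_bnd eD.
  transitivity (((v == ex e) && (v != ey e) && bd K (ep e) (eq e)) (+)
                ((v == ey e) && (v != ex e) && bd K (ep e) (eq e))).
    rewrite mem_e //; case: (bd _ _ _); rewrite ?andbF ?andbT //.
    by case: (v == ex e); case: (v == ey e).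
  have iE w u : U u w -> w.1 <= M -> w.2 <= M -> inU v (top w) = (v == u).
    move=> uw w1 w2; apply/asboolP/eqP => [|->]; rewrite topK // => vw; exact: U_disj vw uw.
  transitivity (\xor_(p | inU v p) \xor_(q | ~~ inU v q)
     ((top (ep e) == p) && (top (eq e) == q) && bd K (opt p) (opt q)) (+)
     \xor_(p | inU v p) \xor_(q | ~~ inU v q)
      ((top (eq e) == p) && (top (ep e) == q) && bd K (opt p) (opt q))); last first.
    by rewrite -big_split; apply: eq_bigr => p _; rewrite -big_split.
  congr (_ (+) _).
    transitivity (\xor_(p | inU v p) ((top (ep e) == p) && (~~ inU v (top (eq e)) && bd K (opt p) (opt (top (eq e)))))).
      by rewrite xor_pred1 (iE _ _ (Up eD)) // (iE _ _ (Uq eD)) // !topK // andbA.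
    apply: eq_bigr => p _; transitivity ((top (ep e) == p) && \xor_(q | ~~ inU v q) ((top (eq e) == q) && bd K (opt p) (opt q)));
      first by rewrite xor_pred1.
    by rewrite big_distrr; apply: eq_bigr => q _ /=; rewrite andbA.
  transitivity (\xor_(p | inU v p) ((top (eq e) == p) && (~~ inU v (top (ep e)) && bd K (opt p) (opt (top (ep e)))))).
    by rewrite xor_pred1 (iE _ _ (Up eD)) // (iE _ _ (Uq eD)) // !topK // andbA bd_sym.
  apply: eq_bigr => p _; transitivity ((top (eq e) == p) && \xor_(q | ~~ inU v q) ((top (ep e) == q) && bd K (opt p) (opt q)));
      first by rewrite xor_pred1.
  by rewrite big_distrr; apply: eq_bigr => q _ /=; rewrite andbA.
rewrite exchange_big; apply: eq_bigr => p pU; rewrite exchange_big; apply: eq_bigr => q qU /=.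
have E e : e \in D -> ((top (ep e) == p) && (top (eq e) == q) && bd K (opt p) (opt q)) (+)
    ((top (eq e) == p) && (top (ep e) == q) && bd K (opt p) (opt q)) = isp e (opt p) (opt q) && bd K (opt p) (opt q).
  move=> eD; have [h1 h2 h3 h4] := pq_bnd eD.
  have tE w r : w.1 <= M -> w.2 <= M -> (top w == r) = (w == opt r).
    by move=> w1 w2; apply/eqP/eqP => [<-|->]; rewrite ?topK ?optK.
  by rewrite /isp !xpair_eqE !tE // -andb_addl; congr ((_ (+) _) && _); rewrite andbC.
rewrite (eq_bigr _ E) {E}; rewrite /b; case: (boolP (gadj (opt p) (opt q))) => [gpq|ngpq] /=; last first.
  rewrite big1 // => e eD; apply/negbTE/negP => /andP[+ _]; rewrite /isp => H.
  case/negP: ngpq; have := gadj_pq eD; move: H; rewrite !xpair_eqE.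
  case: (boolP (_ && _)) => [/andP[/eqP -> /eqP ->] //|_ /= /andP[/eqP -> /eqP ->]].
  by rewrite gadj_sym.
case: (boolP (bd K _ _)) => [Hbd|_]; last by rewrite big1 // => e _; rewrite andbF.
have Up' := asboolW pU.
have [h1 h2 h3 h4] := nbr_bnd Up' gpq.
case: (bd_supp gpq h1 h2 h3 h4 Hbd) => [[u [u1 u2]]|[e eD eH]].
  by case/asboolP: qU; rewrite (U_disj Up' u1).
rewrite (bigD1 e) //= eH /= big1 ?addbF // => e' /andP[eD' ne].
rewrite andbT; apply/negbTE/negP => eH'.
have : isp e (ep e') (eq e') by move: eH eH'; rewrite /isp !xpair_eqE; do ![case: eqP => //= ?]; congruence.
by rewrite isp_cross // eq_sym (negPf ne).
Qed.

Let bd_root K w w' : bd K w w' -> K = fingraph.root crel (toc (cellA w w')) \/ K = fingraph.root crel (toc (cellB w w')).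
Proof. by rewrite /bd; case: eqP => [->|_]; [left|case: eqP => [->|]; [right|]]. Qed.

Let F_le2 e : e \in D -> #|[set f in F | e \in f]| <= 2.
Proof.
move=> eD; apply: leq_trans (_ : #|[set fK (fingraph.root crel (toc (cellA (ep e) (eq e))));
   fK (fingraph.root crel (toc (cellB (ep e) (eq e))))]| <= 2); last by rewrite cards2; case: (_ != _).
apply/subset_leq_card/subsetP => f; rewrite inE in_setD1 => /andP[/andP[_ /imsetP[K _ ->]]].
by rewrite inE => /andP[_ /bd_root[->|->]]; rewrite !inE eqxx ?orbT.
Qed.

(** The walks of the edges of [Z] sum to an even chain [WZ], which bounds a set [s] of squares. As
    [WZ] vanishes outside [supp], [s] is a union of classes of squares, and the boundaries of these
    classes sum to [Z]. *)
Let F_span (Z : {set {set V}}) : Z \subset D -> even_set Z ->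
  exists2 T : {set {set {set V}}}, T \subset F & forall e, e \in D -> (e \in Z) = \xor_(f in T) (e \in f).
Proof.
move=> ZD Zev.
have ZinD e : e \in Z -> e \in D by apply: (subsetP ZD).
pose WZ w w' := \xor_(e in Z) W e w w'.
have [||| s sP] := @even_grid_boundary WZ.
- by move=> w w'; apply: eq_bigr => e _; exact: W_sym.
- by move=> w w' w0; apply: big1 => e /ZinD eD; exact: W_off.
- move=> w w1 w2; rewrite /WZ exchange_big /=.
  under eq_bigr => e eZ do rewrite W_star ?ZinD //.
  transitivity (\xor_(v : V) ((o v == w) && \xor_(e in Z) (v \in e))); last first.
    by apply: big1 => v _; rewrite Zev andbF.
  under [RHS]eq_bigr do rewrite big_distrr.
  rewrite exchange_big; apply: eq_bigr => e /ZinD eD /=.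
  transitivity (\xor_(v : V) (((ex e == v) && (o v == w)) (+) ((ey e == v) && (o v == w)))).
    by rewrite big_split !xor_pred1.
  by apply: eq_bigr => v _; rewrite mem_e // -andb_addl andbC !(eq_sym v).
have s_root c : s (ofc (fingraph.root crel c)) = s (ofc c).
  have /connectP[p pth ->] := connect_root crel c.
  elim: p c pth => [|c' p IH] c //= /andP[/asboolP[w [w' [gw nS H]]] pth].
  rewrite IH //; have := sP _ _ gw.
  have -> : WZ w w' = false.
    by apply: big1 => e /ZinD eD; apply/negP => H'; apply: nS; exact: W_supp eD H'.
  by move=> E; case: H => -[-> ->]; move: E; case: (s (cellA w w')); case: (s (cellB w w')).
have memZ e : e \in D -> (e \in Z) = \xor_(K : cell) (s (ofc K) && (e \in fK K)).
  move=> eD; transitivity (WZ (ep e) (eq e)).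
    rewrite /WZ; under eq_bigr => e' /ZinD eD' do rewrite W_cross //.
    transitivity (\xor_(e' in Z) ((e == e') && true)); first by rewrite xor_pred1 andbT.
    by apply: eq_bigr => e' _; rewrite andbT eq_sym.
  have [h1 h2 h3 h4] := pq_bnd eD; have ge := gadj_pq eD.
  have [eA eB] := cell_bnd ge h1 h2 h3 h4.
  rewrite sP // -eA -eB -(s_root (toc (cellA _ _))) -(s_root (toc (cellB _ _))).
  transitivity (\xor_(K : cell) (((fingraph.root crel (toc (cellA (ep e) (eq e))) == K) && s (ofc K)) (+)
      ((fingraph.root crel (toc (cellB (ep e) (eq e))) == K) && s (ofc K)))).
    by rewrite big_split !xor_pred1.
  by apply: eq_bigr => K _; rewrite inE eD /= -andb_addl andbC.
(* Several classes may have the same boundary [f], so [f] is taken when an odd number of its classes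
   is selected. *)
exists [set f in F | \xor_(K | fK K == f) s (ofc K)].
  by apply/subsetP => f; rewrite inE => /andP[].
move=> e eD; rewrite memZ //.
rewrite (partition_big fK predT) //=.
transitivity (\xor_(f : {set {set V}}) ((e \in f) && \xor_(K | fK K == f) s (ofc K))).
  apply: eq_bigr => f _; rewrite big_distrr /=; apply: eq_bigr => K /eqP <-; by rewrite andbC.
rewrite [RHS]big_mkcond; apply: eq_bigr => f _ /=; rewrite inE.
case: (boolP (f \in F)) => [_|fF]; first by rewrite andbC.
have [->|f0] := eqVneq f set0; first by rewrite inE.
rewrite big1 ?andbF // => K /eqP Kf; case/negP: fF; rewrite in_setD1 f0 -Kf.
by rewrite imset_f.
Qed.

Lemma bounded_minor_facial_family : exists F0, facial_family D F0.
Proof.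
exists F; split; [|exact: F_le2|exact: F_span].
move=> f; rewrite in_setD1 => /andP[f0 /imsetP[K _ fE]]; rewrite fE in f0 *; split=> //.
by apply/subsetP => e; rewrite inE => /andP[].
Qed.

End MacLane.

Lemma grid_minor_facial_family (V : finType) (D : {set {set V}}) :
  grid_minor D -> exists F, facial_family D F.
Proof.
case: (set_0Vmem D) => [-> _|[e0 e0D]].
  exists set0; split.
  - by move=> f; rewrite inE.
  - by move=> e; rewrite inE.
  - by move=> Z _ _; exists set0; [exact: sub0set | move=> e; rewrite inE].
case=> U [o [Ud Upos Ue]].
pose UM M v w := [/\ U v w, w.1 < M & w.2 < M].
have [M HM] : exists M, forall e, e \in D -> exists x y p q,
    [/\ e = [set x; y], x != y, gstep p q, reach (UM M x) (o x) p & reach (UM M y) (o y) q].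
  pose P e M0 := e \in D -> forall M, M0 <= M -> exists x y p q,
    [/\ e = [set x; y], x != y, gstep p q, reach (UM M x) (o x) p & reach (UM M y) (o y) q].
  have [M PM] : exists M, forall e, P e M.
    apply: uniform_nat => [e n n' nn' Pn eD M n'M | e]; first by apply: Pn => //; exact: leq_trans nn' n'M.
    case: (boolP (e \in D)) => [eD|/negPf eD]; last by exists 0; rewrite /P eD.
    have [x [y [p [q [E ne pq r1 r2]]]]] := Ue e eD.
    have [m1 h1] := reach_bounded r1; have [m2 h2] := reach_bounded r2.
    exists (maxn m1 m2) => _ M; rewrite geq_max => /andP[m1M m2M].
    exists x, y, p, q; split=> //; [exact: h1|exact: h2].
  by exists M => e eD; exact: PM.
pose data : Type := (V * V * (nat * nat) * (nat * nat) * (nat * (nat -> nat * nat)) * (nat * (nat -> nat * nat)))%type.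
have [v0 _] : exists v0 : V, True by have [x _] := Ue e0 e0D; exists x.
have /choice[f Hf] : forall e, exists t : data, e \in D ->
   let: (x, y, p, q, (n1, g1), (n2, g2)) := t in
   [/\ e = [set x; y], x != y, gstep p q,
    [/\ g1 0 = o x, g1 n1 = p, forall k, k <= n1 -> UM M x (g1 k) & forall k, k < n1 -> gstep (g1 k) (g1 k.+1)] &
    [/\ g2 0 = o y, g2 n2 = q, forall k, k <= n2 -> UM M y (g2 k) & forall k, k < n2 -> gstep (g2 k) (g2 k.+1)]].
  move=> e; case: (boolP (e \in D)) => [eD|_]; last first.
    by exists (v0, v0, (0,0), (0,0), (0, fun _ => (0,0)), (0, fun _ => (0,0))).
  have [x [y [p [q [E ne pq [n1 [g1 H1]] [n2 [g2 H2]]]]]]] := HM e eD.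
  by exists (x, y, p, q, (n1, g1), (n2, g2)).
apply: (@bounded_minor_facial_family V D (UM M) o M _ _
  (fun e => (f e).1.1.1.1.1) (fun e => (f e).1.1.1.1.2) (fun e => (f e).1.1.1.2) (fun e => (f e).1.1.2)
  (fun e => (f e).1.2.1) (fun e => (f e).2.1) (fun e => (f e).1.2.2) (fun e => (f e).2.2)).
- by move=> u v p [h1 _ _] [h2 _ _]; exact: Ud h1 h2.
- by move=> v p [h1 h2 h3]; case: (Upos v p h1).
- by move=> e /Hf; case: (f e) => [[[[[x y] p] q] [n1 g1]] [n2 g2]] [].
- by move=> e /Hf; case: (f e) => [[[[[x y] p] q] [n1 g1]] [n2 g2]] [].
- by move=> e /Hf; case: (f e) => [[[[[x y] p] q] [n1 g1]] [n2 g2]] [].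
- by move=> e /Hf; case: (f e) => [[[[[x y] p] q] [n1 g1]] [n2 g2]] [].
Qed.

(** * Euler's inequality by counting *)

Section Euler.
Variables (V : finType) (D : {set {set V}}) (F : {set {set {set V}}}).
Hypothesis D2 : forall e, e \in D -> #|e| = 2.
Implicit Types A B : {set {set V}}.

Let bnd A : {set V} := [set v | \xor_(e in A) (v \in e)].
Let symd A B : {set {set V}} := [set e | (e \in A) (+) (e \in B)].

Let symdK A B : symd A (symd A B) = B.
Proof. by apply/setP => e; rewrite !inE addbA addbb. Qed.

Let bnd_symd A B v : (v \in bnd (symd A B)) = (v \in bnd A) (+) (v \in bnd B).
Proof.
rewrite !inE [LHS]big_mkcond [X in X (+) _]big_mkcond [X in _ (+) X]big_mkcond -big_split /=.
by apply: eq_bigr => e _; rewrite !inE; case: (e \in A); case: (e \in B); case: (v \in e).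
Qed.

Let handshake A : A \subset D -> \xor_(v : V) (v \in bnd A) = false.
Proof.
move=> AD; under eq_bigr do rewrite inE.
rewrite exchange_big big1 //= => e eA.
by rewrite -odd_card_xor D2 // (subsetP AD).
Qed.

(** Rank and nullity over two elements: [phi] sends the [2 ^ #|D|] subsets of [D] to at most
    [2 ^ (#|cover D| - 1)] values, and a fibre is no larger than the cycle space, which has at most
    [2 ^ #|F|] elements because [F] spans it. *)
Lemma facial_family_euler : D != set0 -> facial_family D F -> #|D| < #|F| + #|cover D|.
Proof.
case/set0Pn=> e0 e0D [_ _ span].
have /card_gt0P[v0 v0e] : 0 < #|e0| by rewrite D2.
have v0C : v0 \in cover D by apply/bigcupP; exists e0.
pose phi A : {set V} := bnd A :\ v0.
pose Zs := [set Z in powerset D | bnd Z == set0].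
have cZ : #|Zs| <= 2 ^ #|F|.
  rewrite -card_powerset.
  pose psi (T : {set {set {set V}}}) : {set {set V}} := [set e in D | \xor_(f in T) (e \in f)].
  apply: leq_trans (leq_imset_card psi _); apply/subset_leq_card/subsetP => Z.
  rewrite inE powersetE => /andP[ZD /eqP Z0].
  have [|T TF TP] := span Z ZD; first by move=> v; move/setP/(_ v): Z0; rewrite !inE.
  apply/imsetP; exists T; rewrite ?powersetE //; apply/setP => e; rewrite inE.
  by case: (boolP (e \in D)) => [/TP //|eD]; apply: contraNF eD => /(subsetP ZD).
(* Symmetric difference with one member [A0] embeds the fibre into the cycle space. By [handshake]
   the degree at [v0] is even once all others are. *)
have fib (B : {set V}) : #|[set A in powerset D | phi A == B]| <= #|Zs|.
  case: (set_0Vmem [set A in powerset D | phi A == B]) => [->|[A0]]; first by rewrite cards0.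
  rewrite inE powersetE => /andP[A0D /eqP A0B].
  rewrite -(card_in_imset (f := symd A0)); last by move=> A A' _ _ /(congr1 (symd A0)); rewrite !symdK.
  apply/subset_leq_card/subsetP => _ /imsetP[A + ->]; rewrite !inE => /andP[AD /eqP AB].
  have sD : symd A0 A \subset D.
    apply/subsetP => e; rewrite inE.
    by case: (boolP (e \in A0)) => [/(subsetP A0D)//|_]; case: (boolP (e \in A)) => [/(subsetP AD)|].
  rewrite sD /=; apply/eqP/setP => v; rewrite in_set0.
  have off w : w != v0 -> (w \in bnd (symd A0 A)) = false.
    move=> wv; rewrite bnd_symd; move/setP/(_ w): AB; move/setP/(_ w): A0B.
    by rewrite !in_setD1 wv /= => -> ->; rewrite addbb.
  have [->|/off //] := eqVneq v v0.
  by have := handshake sD; rewrite (bigD1 v0) //= big1 ?addbF //.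
have : 2 ^ #|D| <= 2 ^ (#|cover D|.-1 + #|F|).
  rewrite expnD -card_powerset -sum1_card.
  have cC : #|cover D :\ v0| = #|cover D|.-1 by rewrite (cardsD1 v0 (cover D)) v0C.
  rewrite -cC -card_powerset.
  rewrite (partition_big phi (mem (powerset (cover D :\ v0)))) /=.
    apply: leq_trans (_ : \sum_(x in powerset (cover D :\ v0)) 2 ^ #|F| <= _); last by rewrite sum_nat_const.
    apply: leq_sum => B _; apply: leq_trans (leq_trans (fib B) cZ).
    by rewrite -sum1_card; apply: eq_leq; apply: eq_bigl => A; rewrite !inE.
  move=> A; rewrite !powersetE => AD; apply: setSD; apply/subsetP => v; rewrite inE => vA.
  have : [exists e in A, v \in e].
    apply: contraTT vA => /exists_inPn nh; rewrite big1 // => e /nh.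
    by move/negbTE.
  by case/exists_inP => e eA ve; apply/bigcupP; exists e => //; exact: (subsetP AD).
rewrite leq_exp2l //.
have : 0 < #|cover D| by apply/card_gt0P; exists v0.
lia.
Qed.

End Euler.

(** * Partial total colourings *)

Lemma set2C (T : finType) (a b : T) : [set a; b] = [set b; a].
Proof. exact: setUC. Qed.

Lemma set2_inj (T : finType) (v a b : T) : [set v; a] = [set v; b] -> a = b.
Proof.
move=> E; have : a \in [set v; b] by rewrite -E !inE eqxx orbT.
have : b \in [set v; a] by rewrite E !inE eqxx orbT.
by rewrite !inE => /orP[/eqP->|/eqP->//] /orP[/eqP->|/eqP->].
Qed.

Definition upd (A : eqType) (B : Type) (f : A -> B) (x : A) (c : B) : A -> B :=
  fun y => if y == x then c else f y.

Lemma upd_same (A : eqType) (B : Type) (f : A -> B) x c : upd f x c x = c.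
Proof. by rewrite /upd eqxx. Qed.

Lemma upd_other (A : eqType) (B : Type) (f : A -> B) x c y : y != x -> upd f x c y = f y.
Proof. by rewrite /upd => /negPf ->. Qed.

Lemma exists_outside (T : finType) (A : {set T}) : #|A| < #|T| -> exists c, c \notin A.
Proof.
move=> h; have /card_gt0P[c] : 0 < #|~: A| by rewrite cardsCs setCK subn_gt0.
by rewrite inE; exists c.
Qed.

Section Colour.
Variable V : finType.
Implicit Types (D : {set {set V}}) (B : {set V}) (vc : V -> 'I_7) (ec : {set V} -> 'I_7).
Implicit Types (u v w x y : V) (e : {set V}).

Definition star D v : {set {set V}} := [set e in D | v \in e].
Definition deg D v : nat := #|star D v|.
Definition nb D v : {set V} := [set w | (w != v) && ([set v; w] \in D)].

Definition pairs D := forall e, e \in D -> exists x y, x != y /\ e = [set x; y].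

(** Only the vertices in [B] count as coloured; the values of [vc] elsewhere are arbitrary, which
    avoids partial functions. *)
Definition ok D B vc ec : Prop :=
  [/\ forall u v, u \in B -> v \in B -> u != v -> [set u; v] \in D -> vc u != vc v,
      forall u e, u \in B -> e \in D -> u \in e -> vc u != ec e &
      forall u e e', e \in D -> e' \in D -> e != e' -> u \in e -> u \in e' -> ec e != ec e'].

(** What a new edge has to avoid at its end [v]; with [B] empty, what [v] itself has to avoid
    because of its edges. *)
Definition forb D B vc ec v : {set 'I_7} :=
  [set ec e | e in star D v] :|: (if v \in B then [set vc v] else set0).

Lemma star_in D v e : (e \in star D v) = (e \in D) && (v \in e).
Proof. by rewrite inE. Qed.

Lemma forbP D B vc ec v c :
  reflect ((exists e, [/\ e \in D, v \in e & c = ec e]) \/ (v \in B /\ c = vc v)) (c \in forb D B vc ec v).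
Proof.
apply: (iffP idP).
  rewrite in_setU => /orP[/imsetP[e]|].
    by rewrite star_in => /andP[eD ve] ->; left; exists e.
  by case: ifP => vB; rewrite ?inE // => /eqP; right.
case=> [[e [eD ve ->]]|[vB ->]]; rewrite in_setU.
  by rewrite imset_f // star_in eD.
by rewrite vB inE eqxx orbT.
Qed.

Lemma card_forb D B vc ec v : #|forb D B vc ec v| <= deg D v + (v \in B).
Proof.
apply: leq_trans (leq_card_setU _ _) _; apply: leq_add; first exact: leq_imset_card.
by case: ifP; rewrite ?cards1 ?cards0.
Qed.

Lemma okS D B D' B' vc ec : D' \subset D -> B' \subset B -> ok D B vc ec -> ok D' B' vc ec.
Proof.
move=> /subsetP DD /subsetP BB [h1 h2 h3]; split.
- by move=> u v /BB uB /BB vB uv /DD; exact: h1.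
- by move=> u e /BB uB /DD; exact: h2.
- by move=> u e e' /DD eD /DD; exact: h3.
Qed.

Lemma forbS D B D' B' vc ec v : D' \subset D -> B' \subset B ->
  forb D' B' vc ec v \subset forb D B vc ec v.
Proof.
move=> /subsetP DD /subsetP BB; apply/subsetP => c /forbP H; apply/forbP.
by case: H => [[e [/DD eD ve E]]|[/BB vB E]]; [left; exists e|right].
Qed.

Lemma notin_forbS D D' B vc ec v c : D' \subset D ->
  c \notin forb D B vc ec v -> c \notin forb D' B vc ec v.
Proof. by move=> DD; apply: contra; apply: (subsetP (forbS vc ec v DD (subxx B))). Qed.

Lemma add_edge D B vc ec e c : ok D B vc ec -> (forall v, v \in e -> c \notin forb D B vc ec v) ->
  (forall u v, u \in B -> v \in B -> u != v -> [set u; v] = e -> vc u != vc v) ->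
  ok (e |: D) B vc (upd ec e c).
Proof.
move=> [h1 h2 h3] hc hv; split.
- by move=> u v uB vB uv; rewrite in_setU1 => /orP[/eqP|]; [exact: hv|exact: h1].
- move=> u f uB; rewrite in_setU1 /upd; case: (eqVneq f e) => [-> _|fe /= fD] uf; last exact: h2.
  by apply: contra (hc u uf) => /eqP E; apply/forbP; right.
- move=> u f f' + + ff' uf uf'; rewrite !in_setU1 /upd.
  case: (eqVneq f e) => [fe|fe] /=; case: (eqVneq f' e) => [fe'|fe'] /= fD fD'.
  + by rewrite fe fe' eqxx in ff'.
  + rewrite fe in uf; apply: contra (hc u uf) => /eqP E; apply/forbP; left; by exists f'.
  + rewrite fe' in uf'; rewrite eq_sym.
    by apply: contra (hc u uf') => /eqP E; apply/forbP; left; exists f.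
  + exact: h3 ff' uf uf'.
Qed.

Lemma forb_add D B vc ec e c v c' : c' \in forb (e |: D) B vc (upd ec e c) v ->
  c' \in forb D B vc ec v \/ (v \in e /\ c' = c).
Proof.
move=> /forbP[[f [+ vf ->]]|[vB ->]]; last by left; apply/forbP; right.
rewrite in_setU1 /upd; case: (eqVneq f e) => [<- _|_ /= fD]; first by right.
by left; apply/forbP; left; exists f.
Qed.

Lemma forb_removed D B vc ec D' e v : ok D B vc ec -> e \in D -> v \in e -> D' \subset D -> e \notin D' ->
  ec e \notin forb D' B vc ec v.
Proof.
move=> [h1 h2 h3] eD ve /subsetP DD eD'; apply/negP => /forbP[[f [fD vf E]]|[vB E]].
  have fe : e != f by apply: contraNneq eD' => ->.
  by have := h3 v e f eD (DD _ fD) fe ve vf; rewrite E eqxx.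
by have := h2 v e vB eD ve; rewrite E eqxx.
Qed.

Lemma add_vertex D B vc ec x c : ok D B vc ec -> c \notin forb D set0 vc ec x ->
  (forall u, u \in B -> u \in nb D x -> vc u != c) -> ok D (x |: B) (upd vc x c) ec.
Proof.
move=> [h1 h2 h3] hc hn; split=> //.
- move=> u v; rewrite !in_setU1 /upd; case: (eqVneq u x) => [->|ux /= uB].
    case: (eqVneq v x) => [->|vx _ /= vB _ xv]; first by rewrite eqxx.
    by rewrite eq_sym; apply: hn => //; rewrite inE vx.
  case: (eqVneq v x) => [-> _ _ ux'|vx /= vB]; last exact: h1.
  by apply: hn => //; rewrite inE ux set2C.
- move=> u e; rewrite in_setU1 /upd; case: (eqVneq u x) => [-> _ eD xe|_ /=]; last exact: h2.
  by apply: contraNneq hc => E; apply/forbP; left; exists e.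
Qed.

Section Pairs.
Variable D : {set {set V}}.
Hypothesis Dp : pairs D.

Lemma pairs_neq u v : [set u; v] \in D -> u != v.
Proof.
move=> /Dp[x [y [xy E]]]; apply: contraNneq xy => uv.
have : #|[set x; y]| = #|[set u; v]| by rewrite E.
by rewrite uv setUid cards1 cards2; case: (x == y).
Qed.

Lemma starP v e : e \in star D v -> exists2 w, w \in nb D v & e = [set v; w].
Proof.
rewrite star_in => /andP[eD ve]; case: (Dp eD) => x [y [xy E]].
move: ve; rewrite E !inE => /orP[/eqP vx|/eqP vy].
  by exists y; rewrite ?inE vx // eq_sym xy -E.
by exists x; rewrite ?inE vy // ?xy set2C // -E.
Qed.

Lemma star_nb v : star D v = [set [set v; w] | w in nb D v].
Proof.
apply/setP => e; apply/idP/imsetP => [/starP//|[w + ->]].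
by rewrite star_in !inE => /andP[_ ->]; rewrite eqxx.
Qed.

Lemma card_nb v : #|nb D v| = deg D v.
Proof. by rewrite /deg star_nb card_in_imset // => a b _ _; exact: set2_inj. Qed.

Lemma nb_edge u v : (v \in nb D u) = ([set u; v] \in D).
Proof. by rewrite inE; case: (boolP (_ \in D)) => [/pairs_neq|]; rewrite ?andbF // eq_sym => ->. Qed.

Lemma nb_sym u v : (v \in nb D u) = (u \in nb D v).
Proof. by rewrite !nb_edge set2C. Qed.

Lemma deg_remove (S : {set {set V}}) v : S \subset D -> deg (D :\: S) v = deg D v - #|star S v|.
Proof.
move=> SD; have -> : star S v = star D v :&: S.
  by apply/setP => e; rewrite !inE; case: (boolP (e \in S)) => [/(subsetP SD) ->|_] /=; rewrite ?andbT ?andbF.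
rewrite /deg -cardsD; apply: eq_card => e; rewrite !inE; case: (e \in D); case: (v \in e); by rewrite ?andbF ?andbT.
Qed.

End Pairs.

Definition colourable D := exists vc ec, ok D setT vc ec.

(** A vertex of [S] sees at most three edges and three neighbours, so one of seven colours is left;
    as [S] is independent, the choices do not interfere. *)
Lemma colour_small D (S : {set V}) vc ec : pairs D -> (forall x, x \in S -> deg D x <= 3) ->
  (forall x y, x \in S -> y \in S -> [set x; y] \notin D) -> ok D (~: S) vc ec -> colourable D.
Proof.
move=> Dp S3 Sind h.
have Hc x : exists c, (x \in S) ==> (c \notin forb D set0 vc ec x :|: [set vc u | u in nb D x]).
  case: (boolP (x \in S)) => xS; last by exists ord0.
  have [|c cP] := @exists_outside _ (forb D set0 vc ec x :|: [set vc u | u in nb D x]); last by exists c.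
  rewrite card_ord; apply: leq_ltn_trans (leq_card_setU _ _) _.
  have h1 := card_forb D set0 vc ec x; rewrite inE addn0 in h1.
  have h2 : #|[set vc u | u in nb D x]| <= deg D x by rewrite -(card_nb Dp) leq_imset_card.
  have h3 := S3 x xS.
  exact: leq_ltn_trans (leq_add (leq_trans h1 h3) (leq_trans h2 h3)) _.
pose f x := xchoose (Hc x).
have fP x : x \in S -> f x \notin forb D set0 vc ec x :|: [set vc u | u in nb D x] by apply/implyP; exact: (xchooseP (Hc x)).
exists (fun x => if x \in S then f x else vc x), ec; case: h => h1 h2 h3; split=> //.
- have key u v : u \in S -> v \notin S -> [set u; v] \in D -> f u != vc v.
    move=> uS vS uv; have := fP u uS; rewrite in_setU negb_or => /andP[_].
    by apply: contraNneq => ->; apply: imset_f; rewrite nb_edge.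
  move=> u v _ _ uv uvD; case: ifP => uS; case: ifP => vS.
  + by have := Sind u v uS vS; rewrite uvD.
  + by apply: key => //; rewrite vS.
  + by rewrite eq_sym; apply: key => //; rewrite ?uS // set2C.
  + by apply: h1; rewrite ?inE ?uS ?vS.
- move=> u e _ eD ue; case: ifP => uS; last by apply: h2; rewrite ?inE ?uS.
  have := fP u uS; rewrite in_setU negb_or => /andP[+ _]; apply: contraNneq => E.
  by apply/forbP; left; exists e.
Qed.

End Colour.

(** * List colourings of the 4-cycle and of the octahedron *)

Section Lists.
Variable T : finType.
Implicit Types (A B C E W X Y Z : {set T}).

Lemma pick_notin1 A (p : T) : 1 < #|A| -> exists2 a, a \in A & a != p.
Proof.
move=> hA; have : 0 < #|A :\ p| by have := cardsD1 p A; case: (p \in A); lia.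
by case/card_gt0P => a; rewrite !inE => /andP[ap aA]; exists a.
Qed.

Lemma pick_notin2 A (p q : T) : 2 < #|A| -> exists a, [/\ a \in A, a != p & a != q].
Proof.
move=> hA; have : 1 < #|A :\ p| by have := cardsD1 p A; case: (p \in A); lia.
by case/(pick_notin1 q) => a; rewrite !inE => /andP[ap aA] aq; exists a.
Qed.

(** If a list is not contained in the next one, start with a colour missing there and go round the
    other way, so that the last choice is restricted by one neighbour only. Otherwise the lists
    increase, and two colours of [A] alternate. *)
Lemma list_colour_C4 A B C E : 1 < #|A| -> 1 < #|B| -> 1 < #|C| -> 1 < #|E| ->
  exists a b c d, [/\ [/\ a \in A, b \in B, c \in C & d \in E], a != b, b != c, c != d & d != a].
Proof.
have key A' B' C' E' : 1 < #|A'| -> 1 < #|B'| -> 1 < #|C'| -> 1 < #|E'| -> ~~ (A' \subset B') ->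
  exists a b c d, [/\ [/\ a \in A', b \in B', c \in C' & d \in E'], a != b, b != c, c != d & d != a].
  move=> hA hB hC hE /subsetPn[a aA aB].
  have [d dE da] := pick_notin1 a hE; have [c cC cd] := pick_notin1 d hC.
  have [b bB bc] := pick_notin1 c hB; exists a, b, c, d; split=> //.
  by apply: contraNneq aB => ->.
move=> hA hB hC hE.
case: (boolP (A \subset B)) => AB; last exact: key.
case: (boolP (B \subset C)) => BC; last first.
  have [b [c [d [a [[? ? ? ?] ? ? ? ?]]]]] := key B C E A hB hC hE hA BC.
  by exists a, b, c, d.
case: (boolP (C \subset E)) => CE; last first.
  have [c [d [a [b [[? ? ? ?] ? ? ? ?]]]]] := key C E A B hC hE hA hB CE.
  by exists a, b, c, d.
have [p [q [pA qA pq]]] : exists p q, [/\ p \in A, q \in A & p != q].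
  have /card_gt0P[p pA] : 0 < #|A| by lia.
  by have [q qA qp] := pick_notin1 p hA; exists p, q; rewrite eq_sym.
exists p, q, p, q; rewrite !pq eq_sym pq (subsetP AB) // (subsetP BC) ?(subsetP AB) //.
by rewrite (subsetP CE) // (subsetP BC) // (subsetP AB).
Qed.

(* The conflict graph is the octahedron: only the pairs (X, X'), (Y, Y'), (Z, Z') may
   share a colour. *)
Definition octahedral (x x' y y' z z' : T) : Prop :=
  [/\ [/\ x != y, x != y', x' != y & x' != y'],
      [/\ x != z, x != z', x' != z & x' != z'] &
      [/\ y != z, y != z', y' != z & y' != z']].

(** A common colour for [X] and [X'] leaves a 4-cycle with two colours in each list. *)
Lemma list_colour_octahedron_meet X X' Y Y' Z Z' :
  2 < #|Y| -> 2 < #|Y'| -> 2 < #|Z| -> 2 < #|Z'| -> ~~ [disjoint X & X'] ->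
  exists x x' y y' z z', [/\ [/\ x \in X & x' \in X'], [/\ y \in Y & y' \in Y'],
    [/\ z \in Z & z' \in Z'] & octahedral x x' y y' z z'].
Proof.
move=> hY hY' hZ hZ' /pred0Pn[p /= /andP[pX pX']].
have D1 (A : {set T}) : 2 < #|A| -> 1 < #|A :\ p| by have := cardsD1 p A; case: (p \in A); lia.
have [y [z [y' [z' [[+ + + +] yz zy' yz' zy]]]]] := list_colour_C4 (D1 _ hY) (D1 _ hZ) (D1 _ hY') (D1 _ hZ').
rewrite !in_setD1 => /andP[py yY] /andP[pz zZ] /andP[py' yY'] /andP[pz' zZ'].
exists p, p, y, y', z, z'; split=> //; split; split; rewrite // eq_sym //.
Qed.

Let quad (y y' z z' : T) : {set T} := [set y; y'] :|: [set z; z'].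

Let valid Y Y' Z Z' y y' z z' := [/\ [/\ y \in Y, y' \in Y', z \in Z & z' \in Z'],
  y != z, y != z', y' != z & y' != z'].

Let disj A B a b : [disjoint A & B] -> a \in A -> b \in B -> a != b.
Proof. by move=> dAB aA bB; apply: contraTneq bB => <-; rewrite (disjointFr dAB aA). Qed.

Let card_quad y y' z z' : #|quad y y' z z'| <= 4.
Proof.
apply: leq_trans (leq_card_setU _ _) _; rewrite !cards2.
by case: (y != y'); case: (z != z').
Qed.

(** Two elements of [W2] other than [r2], together with three of [W], would not fit into the at most
    four colours of [N]. *)
Let replace_one W W2 (N N1 : {set T}) (r r2 : T) : 2 < #|W| -> 2 < #|W2| -> [disjoint W & W2] ->
  #|N| <= 4 -> W \subset N -> r \in W -> r \notin N1 -> N1 \subset r2 |: N ->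
  ~~ (W \subset N1) /\ ~~ (W2 \subset N1).
Proof.
move=> hW hW2 dW N4 WN rW rN1 N1N; split; first by apply: contra rN1 => /subsetP; apply.
apply/negP => W2N1.
have W2N : W2 :\ r2 \subset N.
  apply/subsetP => a; rewrite in_setD1 => /andP[ar aW2].
  by have := subsetP N1N a (subsetP W2N1 a aW2); rewrite in_setU1 (negPf ar).
have : #|W :|: (W2 :\ r2)| <= 4 by apply: leq_trans N4; apply: subset_leq_card; rewrite subUset WN.
rewrite cardsU disjoint_setI0; last by apply: disjointWr dW; exact: subsetDl.
rewrite cards0 subn0; have := cardsD1 r2 W2; case: (r2 \in W2); lia.
Qed.

(** If [y] and [y'] both lie in [Z], any other colour of [Z'] can replace [z'], by disjointness.
    Otherwise one of them lies outside [Z], and [Z] has a third colour that avoids [z] and the other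
    one. *)
Let avoid_swap Y Y' Z Z' W W2 y y' z z' : 2 < #|Z| -> 2 < #|Z'| -> [disjoint Z & Z'] ->
  2 < #|W| -> 2 < #|W2| -> [disjoint W & W2] ->
  valid Y Y' Z Z' y y' z z' -> W \subset quad y y' z z' -> z \in W -> z' \in W ->
  exists z1 z1', [/\ valid Y Y' Z Z' y y' z1 z1', ~~ (W \subset quad y y' z1 z1') &
    ~~ (W2 \subset quad y y' z1 z1')].
Proof.
move=> hZ hZ' dZ hW hW2 dW [[yY yY' zZ zZ'] h1 h2 h3 h4] WN zW zW'.
have zz' := disj dZ zZ zZ'.
case: (boolP ([set y; y'] \subset Z)) => yyZ.
  have [r rZ' rz] := @pick_notin1 Z' z' (ltnW hZ').
  have yr : y != r by apply: (disj dZ) => //; apply: (subsetP yyZ); rewrite !inE eqxx.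
  have y'r : y' != r by apply: (disj dZ) => //; apply: (subsetP yyZ); rewrite !inE eqxx orbT.
  have n1 : z' \notin quad y y' z r.
    by rewrite !inE !negb_or (eq_sym z' y) h2 (eq_sym z' y') h4 (eq_sym z' z) zz' eq_sym rz.
  have n2 : quad y y' z r \subset r |: quad y y' z z'.
    by apply/subsetP => a; rewrite !inE => /orP[/orP[]|/orP[]] ->; rewrite ?orbT.
  have [? ?] := replace_one hW hW2 dW (card_quad _ _ _ _) WN zW' n1 n2.
  by exists z, r.
have [r [rZ ry ry' rz]] : exists r, [/\ r \in Z, y != r, y' != r & r != z].
  have [w [wyy wZ]] : exists w, w \in [set y; y'] /\ w \notin Z by case/subsetPn: yyZ => w; exists w.
  move: wyy; rewrite !inE => /orP[] /eqP E; rewrite E in wZ.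
    have [r [rZ rz ry]] := @pick_notin2 Z z y' hZ; exists r; rewrite (eq_sym y') ry; split=> //.
    by apply: contraNneq wZ => ->.
  have [r [rZ rz ry]] := @pick_notin2 Z z y hZ; exists r; rewrite (eq_sym y) ry; split=> //.
  by apply: contraNneq wZ => ->.
have rz' := disj dZ rZ zZ'.
have n1 : z \notin quad y y' r z'.
  by rewrite !inE !negb_or (eq_sym z y) h1 (eq_sym z y') h3 (eq_sym z r) rz zz'.
have n2 : quad y y' r z' \subset r |: quad y y' z z'.
  by apply/subsetP => a; rewrite !inE => /orP[/orP[]|/orP[]] ->; rewrite ?orbT.
have [? ?] := replace_one hW hW2 dW (card_quad _ _ _ _) WN zW n1 n2.
by exists r, z'.
Qed.

Let valid_swap Y Y' Z Z' y y' z z' : valid Y Y' Z Z' y y' z z' -> valid Z Z' Y Y' z z' y y'.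
Proof. by case=> -[? ? ? ?] ? ? ? ?; split=> //; rewrite eq_sym. Qed.

(** As [W] has three of the at most four colours used, it contains both of one opposite pair, and
    that pair is changed by [avoid_swap]. *)
Let avoid_both Y Y' Z Z' W W2 y y' z z' :
  2 < #|Y| -> 2 < #|Y'| -> 2 < #|Z| -> 2 < #|Z'| -> [disjoint Y & Y'] -> [disjoint Z & Z'] ->
  2 < #|W| -> 2 < #|W2| -> [disjoint W & W2] ->
  valid Y Y' Z Z' y y' z z' -> W \subset quad y y' z z' ->
  exists y y' z z', [/\ valid Y Y' Z Z' y y' z z', ~~ (W \subset quad y y' z z') &
    ~~ (W2 \subset quad y y' z z')].
Proof.
move=> hY hY' hZ hZ' dY dZ hW hW2 dW V0 WN.
case: (boolP ((z \in W) && (z' \in W))) => [/andP[zW zW']|nz].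
  by have [z1 [z1' H]] := avoid_swap hZ hZ' dZ hW hW2 dW V0 WN zW zW'; exists y, y', z1, z1'.
have [yW yW'] : y \in W /\ y' \in W.
  have [[yY yY' zZ zZ'] h1 h2 h3 h4] := V0; have zz' := disj dZ zZ zZ'.
  have yy' := disj dY yY yY'.
  have two a b : a \in quad y y' z z' -> b \in quad y y' z z' -> a != b -> a \notin W -> b \in W.
    move=> aN bN ab aW; apply/negPn/negP => bW.
    have WN2 : W \subset quad y y' z z' :\ a :\ b.
      apply/subsetP => c cW; rewrite !in_setD1 (subsetP WN) // andbT; apply/andP; split.
        by apply: contraNneq bW => <-.
      by apply: contraNneq aW => <-.
    have bN1 : b \in quad y y' z z' :\ a by rewrite in_setD1 bN eq_sym ab.
    have := leq_trans (leq_trans hW (subset_leq_card WN2)) (leqnn _).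
    have := card_quad y y' z z'; rewrite (cardsD1 a) aN (cardsD1 b) bN1 !add1n !ltnS => h5 h6.
    by have := leq_trans h6 h5; rewrite ltnn.
  move: nz; rewrite negb_and => /orP[] nz; split; apply: two nz; rewrite ?inE ?eqxx ?orbT // eq_sym //.
have WN' : W \subset quad z z' y y' by rewrite /quad setUC.
have [y1 [y1' [V1 n1 n2]]] := avoid_swap hY hY' dY hW hW2 dW (valid_swap V0) WN' yW yW'.
exists y1, y1', z, z'; rewrite /quad setUC; split=> //; exact: valid_swap.
Qed.

(** The octahedron is 3-choosable. When opposite lists are disjoint, a colouring of the 4-cycle
    extends to [X] and [X'] unless one of these lists is used up entirely, which [avoid_both]
    repairs. *)
Lemma list_colour_octahedron X X' Y Y' Z Z' :
  2 < #|X| -> 2 < #|X'| -> 2 < #|Y| -> 2 < #|Y'| -> 2 < #|Z| -> 2 < #|Z'| ->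
  exists x x' y y' z z', [/\ [/\ x \in X & x' \in X'], [/\ y \in Y & y' \in Y'],
    [/\ z \in Z & z' \in Z'] & octahedral x x' y y' z z'].
Proof.
move=> hX hX' hY hY' hZ hZ'.
case: (boolP [disjoint X & X']) => dX; last exact: list_colour_octahedron_meet.
case: (boolP [disjoint Y & Y']) => dY; last first.
  have [y [y' [x [x' [z [z' [? ? ? [[? ? ? ?] [? ? ? ?] [? ? ? ?]]]]]]]]] :=
    list_colour_octahedron_meet hX hX' hZ hZ' dY.
  by exists x, x', y, y', z, z'; split=> //; split; split; rewrite // eq_sym.
case: (boolP [disjoint Z & Z']) => dZ; last first.
  have [z [z' [x [x' [y [y' [? ? ? [[? ? ? ?] [? ? ? ?] [? ? ? ?]]]]]]]]] :=
    list_colour_octahedron_meet hX hX' hY hY' dZ.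
  by exists x, x', y, y', z, z'; split=> //; split; split; rewrite // eq_sym.
suff [y [y' [z [z' [[[yY yY' zZ zZ'] h1 h2 h3 h4] /subsetPn[x xX +] /subsetPn[x' xX' +]]]]]] :
  exists y y' z z', [/\ valid Y Y' Z Z' y y' z z', ~~ (X \subset quad y y' z z') &
    ~~ (X' \subset quad y y' z z')].
  rewrite !inE !negb_or => /andP[/andP[? ?] /andP[? ?]] /andP[/andP[? ?] /andP[? ?]].
  by exists x, x', y, y', z, z'.
have /card_gt0P[y yY] : 0 < #|Y| by lia.
have /card_gt0P[y' yY'] : 0 < #|Y'| by lia.
have [z [zZ zy zy']] := @pick_notin2 Z y y' hZ.
have [z' [zZ' zy1 zy1']] := @pick_notin2 Z' y y' hZ'.
have V0 : valid Y Y' Z Z' y y' z z' by split; rewrite // eq_sym.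
case: (boolP (X \subset quad y y' z z')) => XN.
  exact: avoid_both hY hY' hZ hZ' dY dZ hX hX' dX V0 XN.
case: (boolP (X' \subset quad y y' z z')) => XN'; last by exists y, y', z, z'.
have dX' : [disjoint X' & X] by rewrite disjoint_sym.
have [y1 [y1' [z1 [z1' [? ? ?]]]]] := avoid_both hY hY' hZ hZ' dY dZ hX' hX dX' V0 XN'.
by exists y1, y1', z1, z1'.
Qed.

End Lists.

(** * Critical edge sets *)

Lemma setD1C (T : finType) (A : {set T}) (x y : T) : A :\ x :\ y = A :\ y :\ x.
Proof. by apply/setP => a; rewrite !inE andbCA. Qed.

Definition critical (V : finType) (D : {set {set V}}) : Prop :=
  [/\ pairs D, forall v, deg D v <= 6, ~ colourable D &
      forall D' : {set {set V}}, D' \proper D -> colourable D'].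

Section Critical.
Variables (V : finType) (D : {set {set V}}).
Hypothesis Dc : critical D.
Implicit Types (u v w x y : V) (e : {set V}).

Lemma crit_pairs : pairs D. Proof. by case: Dc. Qed.
Lemma crit_deg v : deg D v <= 6. Proof. by case: Dc. Qed.
Let Dp := crit_pairs.

Lemma deg_setD1 v e : e \in star D v -> deg (D :\ e) v = (deg D v).-1.
Proof.
move=> es; rewrite deg_remove ?sub1set; last by move: es; rewrite star_in => /andP[].
suff -> : star [set e] v = [set e] by rewrite cards1 subn1.
by move: es; rewrite star_in => /andP[_ ve]; apply/setP => f; rewrite !inE; case: eqP => // ->.
Qed.

(** If the edge and [u] lose their colours, the ends forbid at most [deg D u - 1] and [deg D v]
    colours to the edge. Were this at most 6, the edge could be coloured, and [u] after it. *)
Lemma small_edge u v : [set u; v] \in D -> deg D u <= 3 -> 8 <= deg D u + deg D v.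
Proof.
move=> eD du; rewrite leqNgt; apply/negP => sml.
have uv := pairs_neq Dp eD; pose e := [set u; v].
have ue : e \in star D u by rewrite star_in eD !inE eqxx.
have ve : e \in star D v by rewrite star_in eD !inE eqxx orbT.
have du1 : 0 < deg D u by apply/card_gt0P; exists e.
have dv1 : 0 < deg D v by apply/card_gt0P; exists e.
case: Dc => _ _ nc /(_ (D :\ e) (properD1 eD))[vc [ec h]].
apply: nc; pose B := ~: [set u].
have h' : ok (D :\ e) B vc ec by apply: okS (subxx _) (subsetT _) h.
pose fu := forb (D :\ e) B vc ec u; pose fv := forb (D :\ e) B vc ec v.
have cu : #|fu| <= (deg D u).-1.
  by apply: leq_trans (card_forb _ _ _ _ _) _; rewrite deg_setD1 // !inE eqxx addn0.
have cv : #|fv| <= deg D v.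
  apply: leq_trans (card_forb _ _ _ _ _) _; rewrite deg_setD1 // !inE eq_sym uv addn1 prednK //.
have [|c] := @exists_outside _ (fu :|: fv).
  rewrite card_ord; apply: leq_ltn_trans (leq_card_setU _ _) _; lia.
rewrite in_setU negb_or => /andP[cnu cnv].
have h2 : ok D B vc (upd ec e c).
  rewrite -(setD1K eD); apply: add_edge h' _ _.
    by move=> w; rewrite /e in_set2 => /orP[/eqP->|/eqP->].
  move=> a b; rewrite !inE => au bu ab E.
  by have := set21 u v; rewrite -E !inE !(eq_sym u) (negPf au) (negPf bu).
apply: (@colour_small _ D [set u] vc (upd ec e c)) => //.
- by move=> x; rewrite inE => /eqP ->.
- by move=> x y; rewrite !inE => /eqP -> /eqP ->; apply/negP => /(pairs_neq Dp); rewrite eqxx.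
Qed.

(* Vertices outside [big] are coloured last: [colour_small] colours them whatever the rest looks
   like, so partial colourings below are only required to be proper on [big]. *)
Definition big : {set V} := [set v | 3 < deg D v].

Lemma small_nb u v : [set u; v] \in D -> u \notin big -> v \in big.
Proof. by move=> uv; rewrite !inE -leqNgt => du; have := small_edge uv du; lia. Qed.

Lemma not_ok_big vc ec : ~ ok D big vc ec.
Proof.
move=> h; case: Dc => _ _ nc _; apply: nc; apply: (@colour_small _ D (~: big) vc ec) => //.
- by move=> x; rewrite !inE -leqNgt.
- by move=> x y; rewrite !inE => xb yb; apply/negP => /small_nb; rewrite !inE (negPf yb) => /(_ xb).
- by rewrite setCK.
Qed.

Lemma ok_proper (D' : {set {set V}}) : D' \proper D -> exists vc ec, ok D' big vc ec.
Proof.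
by move=> pD; case: Dc => _ _ _ /(_ D' pD)[vc [ec h]]; exists vc, ec; apply: okS h; rewrite ?subsetT.
Qed.

Lemma add_small_edge D' vc ec u v c : u \notin big -> ok D' big vc ec ->
  c \notin forb D' big vc ec u -> c \notin forb D' big vc ec v ->
  ok ([set u; v] |: D') big vc (upd ec [set u; v] c).
Proof.
move=> ub h cu cv; apply: add_edge => //.
  by move=> w; rewrite in_set2 => /orP[/eqP->|/eqP->].
move=> a b aB bB _ E; have := set21 u v; rewrite -E !inE => /orP[] /eqP E'.
  by rewrite E' aB in ub.
by rewrite E' bB in ub.
Qed.

Lemma deg2_star u v w e : deg D u = 2 -> [set u; v] \in D -> [set u; w] \in D -> v != w ->
  e \in D -> u \in e -> e = [set u; v] \/ e = [set u; w].
Proof.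
move=> du uv uw vw eD ue.
have S : [set [set u; v]; [set u; w]] \subset star D u.
  by rewrite subUset !sub1set !star_in uv uw !inE !eqxx.
have ne : [set u; v] != [set u; w] by apply: contraNneq vw => /set2_inj ->.
have /eqP E : [set [set u; v]; [set u; w]] == star D u.
  by rewrite eqEcard S cards2 ne /= -/(deg D u) du.
have : e \in star D u by rewrite star_in eD.
by rewrite -E !inE => /orP[] /eqP; [left|right].
Qed.

Lemma deg2_other u v : deg D u = 2 -> [set u; v] \in D -> exists2 w, v != w & [set u; w] \in D.
Proof.
move=> du uv; have : 1 < #|nb D u| by rewrite (card_nb Dp) du.
case/(pick_notin1 v) => w; rewrite (nb_edge Dp) => uw wv; exists w; by rewrite // eq_sym.
Qed.

Lemma deg2_nb u v : deg D u = 2 -> [set u; v] \in D -> deg D v = 6.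
Proof. move=> du uv; have := small_edge uv; have := crit_deg v; rewrite du; lia. Qed.

Lemma deg2_small u : deg D u = 2 -> u \notin big.
Proof. by rewrite inE => ->. Qed.

Lemma missing_colour vc ec u v : [set u; v] \in D -> exists c, c \notin forb (D :\ [set u; v]) big vc ec v.
Proof.
move=> uv; apply: exists_outside; rewrite card_ord.
apply: leq_ltn_trans (card_forb _ _ _ _ _) _.
have vs : [set u; v] \in star D v by rewrite star_in uv !inE eqxx orbT.
have d1 : 0 < deg D v by apply/card_gt0P; exists [set u; v].
by rewrite deg_setD1 //; have := crit_deg v; case: (v \in big); lia.
Qed.

(** As [u] is coloured last, the colour of [uw] is all that [uv] has to avoid at [u]; a different
    colour missing at [v] would complete the colouring. *)
Lemma deg2_stuck vc ec u v w c : deg D u = 2 -> [set u; v] \in D -> [set u; w] \in D -> v != w ->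
  ok (D :\ [set u; v]) big vc ec -> c \notin forb (D :\ [set u; v]) big vc ec v ->
  ec [set u; w] = c.
Proof.
move=> du uv uw vw h cv; apply/eqP/negPn/negP => ne.
apply: (@not_ok_big vc (upd ec [set u; v] c)); rewrite -{1}(setD1K uv).
apply: add_small_edge => //; first exact: deg2_small.
apply/negP => /forbP[[e [+ ue E]]|[ub _]]; last by rewrite (negPf (deg2_small du)) in ub.
rewrite in_setD1 => /andP[euv eD]; case: (deg2_star du uv uw vw eD ue) => E'.
  by rewrite E' eqxx in euv.
by rewrite E E' eqxx in ne.
Qed.

(** With [xv] uncoloured, a colour [c] missing at [v] sits on the other edge at [x]. Recolouring the
    triangle makes another colour missing at [v], against [deg2_stuck]. *)
Lemma triangle_deg2 u v w x : deg D u = 2 -> [set u; v] \in D -> [set u; w] \in D -> [set v; w] \in D ->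
  deg D x = 2 -> [set x; v] \in D -> x = u.
Proof.
move=> du uv uw vw dx xv; apply/eqP/negPn/negP => xu.
have vw' := pairs_neq Dp vw; have uv' := pairs_neq Dp uv; have uw' := pairs_neq Dp uw.
have [y vy xy] := deg2_other dx xv.
have [vc [ec h]] := ok_proper (properD1 xv).
have [c cv] := missing_colour vc ec xv.
have xc := deg2_stuck dx xv xy vy h cv.
pose D1 := D :\ [set x; v].
have uvxv : [set u; v] != [set x; v].
  by apply: contraNneq xu; rewrite ![[set _; v]]set2C => /set2_inj ->.
have uvD1 : [set u; v] \in D1 by rewrite in_setD1 uvxv.
have notc e : e \in D1 -> v \in e -> ec e != c.
  by move=> eD ve; apply: contraNneq cv => <-; apply/forbP; left; exists e.
have [h1 h2 h3] := h.
(* Here [vw] and [uw] exchange their colours [b] and [c], which makes [b] missing at [v]. *)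
case: (eqVneq (ec [set u; w]) c) => [uwc|uwc].
  pose D2 := D1 :\ [set v; w] :\ [set u; w].
  have D2s : D2 \subset D1 by apply: subset_trans (subsetDl _ _) (subsetDl _ _).
  have xw : x != w.
    by apply: contra_eq_neq dx => ->; rewrite (deg2_nb du uw).
  have xv' := pairs_neq Dp xv.
  have uwD1 : [set u; w] \in D1.
    by rewrite in_setD1 uw andbT; apply/eqP => E; have := set21 x v; rewrite -E !inE (negPf xu) (negPf xw).
  have vwD1 : [set v; w] \in D1.
    by rewrite in_setD1 vw andbT; apply/eqP => E; have := set21 x v; rewrite -E !inE (negPf xv') (negPf xw).
  have vwuw : [set v; w] != [set u; w].
    by apply: contraNneq uv' => E; have := set21 v w; rewrite E !inE (negPf vw') orbF eq_sym.
  pose b := ec [set v; w].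
  have bc : b != c by apply: notc; rewrite // set21.
  have vwD2 : [set v; w] \notin D2 by rewrite !in_setD1 eqxx andbF.
  have uwD2 : [set u; w] \notin D2 by rewrite !in_setD1 eqxx.
  have hD2 := okS D2s (subxx _) h.
  have h4 : ok ([set v; w] |: D2) big vc (upd ec [set v; w] c).
    apply: add_edge => //.
      move=> a; rewrite in_set2 => /orP[] /eqP ->.
        exact: notin_forbS D2s cv.
      by rewrite -uwc; apply: forb_removed h uwD1 _ D2s uwD2; rewrite set22.
    by move=> s t sB tB st E; apply: h1; rewrite // E.
  have h5 : ok ([set u; w] |: ([set v; w] |: D2)) big vc (upd (upd ec [set v; w] c) [set u; w] b).
    apply: add_small_edge => //; first exact: deg2_small.
      apply/negP => /forb_add[/forbP[[e [eD2 ue E]]|[ub _]]|[+ _]].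
      - have := eD2; rewrite !in_setD1 => /andP[euw /andP[_ /andP[_ eD]]].
        case: (deg2_star du uv uw vw' eD ue) => E'; last by rewrite E' eqxx in euw.
        rewrite E' in E; have := h3 v _ _ uvD1 vwD1 _ (set22 _ _) (set21 _ _).
        rewrite -E eqxx => /(_ _)/notF; apply.
        by apply/eqP => E2; have := set21 u v; rewrite E2 !inE (negPf uv') (negPf uw').
      - by rewrite (negPf (deg2_small du)) in ub.
      - by rewrite !inE (negPf uv') (negPf uw').
    apply/negP => /forb_add[|[_ /eqP]]; last by rewrite (negPf bc).
    by apply/negP; apply: forb_removed h vwD1 _ D2s vwD2; rewrite set22.
  have DE : [set u; w] |: ([set v; w] |: D2) = D1.
    by rewrite setUCA setD1K ?setD1K // in_setD1 eq_sym vwuw.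
  have bv : b \notin forb D1 big vc (upd (upd ec [set v; w] c) [set u; w] b) v.
    rewrite -DE; apply/negP => /forb_add[/forb_add[|[_ /eqP]]|[+ _]].
    - by apply/negP; apply: forb_removed h vwD1 _ D2s vwD2; rewrite set21.
    - by rewrite (negPf bc).
    - by rewrite !inE eq_sym (negPf uv') (negPf vw').
  rewrite DE in h5; have := deg2_stuck dx xv xy vy h5 bv.
  rewrite !upd_other; first by move=> E; rewrite -E xc eqxx in bc.
    by apply/eqP => E; have := set21 x y; rewrite E !inE (negPf xv') (negPf xw).
  by apply/eqP => E; have := set21 x y; rewrite E !inE (negPf xu) (negPf xw).
(* Now [uv] can take [c], and its old colour [a] becomes missing at [v]. *)
pose a := ec [set u; v]; have ac : a != c by apply: notc; rewrite // set22.
pose D2 := D1 :\ [set u; v].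
have D2s : D2 \subset D1 := subsetDl _ _.
have uvD2 : [set u; v] \notin D2 by rewrite in_setD1 eqxx.
have h4 : ok ([set u; v] |: D2) big vc (upd ec [set u; v] c).
  apply: add_small_edge; first exact: deg2_small.
  - exact: okS D2s (subxx _) h.
  - apply/negP => /forbP[[e [+ ue E]]|[ub _]]; last by rewrite (negPf (deg2_small du)) in ub.
    rewrite !in_setD1 => /andP[euv /andP[_ eD]].
    case: (deg2_star du uv uw vw' eD ue) => E'; first by rewrite E' eqxx in euv.
    by rewrite E E' eqxx in uwc.
  - exact: notin_forbS D2s cv.
have av : a \notin forb D1 big vc (upd ec [set u; v] c) v.
  rewrite -(setD1K uvD1); apply/negP => /forb_add[|[_ /eqP]]; last by rewrite (negPf ac).
  by apply/negP; apply: forb_removed h uvD1 _ D2s uvD2; rewrite set22.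
rewrite setD1K // in h4; have := deg2_stuck dx xv xy vy h4 av.
have -> : upd ec [set u; v] c [set x; y] = c by rewrite /upd xc; case: ifP.
by move=> E; rewrite E eqxx in ac.
Qed.

Section Walk.
Variable X : {set V}.
Hypothesis X2 : forall u, u \in X -> deg D u = 2.
Hypothesis Xnext : forall u y, u \in X -> [set u; y] \in D ->
  exists u', [/\ u' \in X, u' != u & [set u'; y] \in D].

(* Shifting the uncoloured edge along a path of [X]-edges keeps the colour [c] on the
   edges that the walk leaves behind, so the walk never returns to a vertex of [S]. *)
Lemma deg2_walk n (S : {set V}) vc ec u y z c : #|V| <= n + #|S| ->
  u \in X -> [set u; y] \in D -> [set u; z] \in D -> y != z -> y \notin S ->
  ok (D :\ [set u; y]) big vc ec -> ec [set u; z] = c ->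
  c \notin forb (D :\ [set u; y]) big vc ec y ->
  (forall y', y' \in S -> exists w, [/\ w \in X, [set w; y'] \in D, ec [set w; y'] = c,
     nb D w \subset y |: S & y \in nb D w -> w = u]) -> False.
Proof.
elim: n S vc ec u y z => [|n IH] S vc ec u y z hS uX uy uz yz yS h zc cy inv.
  have : #|y |: S| <= #|V| by exact: max_card.
  by rewrite cardsU1 yS add1n => /(leq_trans)/(_ hS); rewrite add0n ltnn.
have [u' [uX' uu' u'y]] := Xnext uX uy.
have du := X2 uX; have du' := X2 uX'.
have [z' yz' u'z'] := deg2_other du' u'y.
have dy := deg2_nb du uy; have dz' := deg2_nb du' u'z'; have dz := deg2_nb du uz.
have d26 a b : deg D a = 2 -> deg D b = 6 -> a != b.
  by move=> da; apply: contra_eq_neq => <-; rewrite da.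
have uy' := d26 _ _ du dy; have u'y' := d26 _ _ du' dy; have uz' := d26 _ _ du dz'; have u'z2 := d26 _ _ du' dz'.
pose D1 := D :\ [set u; y].
have u'yuy : [set u'; y] != [set u; y].
  by apply/eqP => E; have := set21 u' y; rewrite E !inE (negPf uu') (negPf u'y').
have u'zuy : [set u'; z'] != [set u; y].
  by apply/eqP => E; have := set21 u' z'; rewrite E !inE (negPf uu') (negPf u'y').
have u'yz : [set u'; y] != [set u'; z'] by apply: contraNneq yz' => /set2_inj ->.
have u'yD1 : [set u'; y] \in D1 by rewrite in_setD1 u'yuy.
have u'zD1 : [set u'; z'] \in D1 by rewrite in_setD1 u'zuy.
pose g := ec [set u'; y].
have gc : g != c by apply: contraNneq cy => <-; apply/forbP; left; exists [set u'; y]; rewrite u'yD1 set22.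
have uzu'y : [set u; z] != [set u'; y].
  by apply/eqP => E; have := set21 u z; rewrite E !inE eq_sym (negPf uu') (negPf uy').
(* Otherwise [u'y] could take [c], and its old colour [g] would be free for [uy]. *)
have z'c : ec [set u'; z'] = c.
  apply/eqP/negPn/negP => nz'.
  pose D2 := D1 :\ [set u'; y]; have D2s : D2 \subset D1 := subsetDl _ _.
  have u'yD2 : [set u'; y] \notin D2 by rewrite in_setD1 eqxx.
  have h4 : ok D1 big vc (upd ec [set u'; y] c).
    rewrite -(setD1K u'yD1); apply: add_small_edge; first exact: deg2_small.
    - exact: okS D2s (subxx _) h.
    - apply/negP => /forbP[[e [+ ue E]]|[ub _]]; last by rewrite (negPf (deg2_small du')) in ub.
      rewrite !in_setD1 => /andP[euv /andP[_ eD]].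
      case: (deg2_star du' u'y u'z' yz' eD ue) => E'; first by rewrite E' eqxx in euv.
      by rewrite E E' eqxx in nz'.
    - exact: notin_forbS D2s cy.
  have gy : g \notin forb D1 big vc (upd ec [set u'; y] c) y.
    rewrite -(setD1K u'yD1); apply/negP => /forb_add[|[_ /eqP]]; last by rewrite (negPf gc).
    by apply/negP; apply: forb_removed h u'yD1 _ D2s u'yD2; rewrite set22.
  have := deg2_stuck du uy uz yz h4 gy; rewrite upd_other // zc => E.
  by rewrite E eqxx in gc.
(* The edge of colour [c] at [z'] that the invariant provides must be [u'z']; but then [y] is a
   neighbour of its end [u'], which forces [u' = u]. *)
have z'S : z' \notin S.
  apply/negP => /inv[w [wX wz' wc _ wy]].
  have wE : w = u'.
    apply/eqP/negPn/negP => wu'.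
    have wD1 : [set w; z'] \in D1.
      rewrite in_setD1 wz' andbT; apply/eqP => E; have := set22 w z'; rewrite E !inE.
      by rewrite eq_sym (negPf uz') eq_sym (negPf yz').
    case: h => _ _ h3; have := h3 z' _ _ wD1 u'zD1 _ (set22 _ _) (set22 _ _).
    rewrite wc z'c eqxx => /(_ _)/notF; apply.
    by apply: contraNneq wu'; rewrite ![[set _; z']]set2C => /set2_inj ->.
  move: wy; rewrite wE (nb_edge Dp) => /(_ u'y) E; by rewrite E eqxx in uu'.
(* The gap moves on: [u'y] takes [c], [uy] takes [g], and [u'z'] becomes uncoloured, so that [c] is
   missing at [z']. *)
pose D2 := D1 :\ [set u'; y] :\ [set u'; z'].
have D2s : D2 \subset D1 by apply: subset_trans (subsetDl _ _) (subsetDl _ _).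
have u'yD2 : [set u'; y] \notin D2 by rewrite !in_setD1 eqxx andbF.
have u'zD2 : [set u'; z'] \notin D2 by rewrite !in_setD1 eqxx.
have h4 : ok ([set u'; y] |: D2) big vc (upd ec [set u'; y] c).
  apply: add_small_edge; first exact: deg2_small.
  - exact: okS D2s (subxx _) h.
  - apply/negP => /forbP[[e [+ ue E]]|[ub _]]; last by rewrite (negPf (deg2_small du')) in ub.
    rewrite !in_setD1 => /andP[euz /andP[euy /andP[_ eD]]].
    by case: (deg2_star du' u'y u'z' yz' eD ue) => E'; [rewrite E' eqxx in euy|rewrite E' eqxx in euz].
  - exact: notin_forbS D2s cy.
have h5 : ok ([set u; y] |: ([set u'; y] |: D2)) big vc (upd (upd ec [set u'; y] c) [set u; y] g).
  apply: add_small_edge => //; first exact: deg2_small.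
    apply/negP => /forb_add[/forbP[[e [+ ue E]]|[ub _]]|[+ _]].
    - rewrite !in_setD1 => /andP[_ /andP[_ /andP[euy eD]]].
      case: (deg2_star du uy uz yz eD ue) => E'; first by rewrite E' eqxx in euy.
      by rewrite E' zc in E; rewrite E eqxx in gc.
    - by rewrite (negPf (deg2_small du)) in ub.
    - by rewrite !inE eq_sym (negPf uu') (negPf uy').
  apply/negP => /forb_add[|[_ /eqP]]; last by rewrite (negPf gc).
  by apply/negP; apply: forb_removed h u'yD1 _ D2s u'yD2; rewrite set22.
have DE : [set u; y] |: ([set u'; y] |: D2) = D :\ [set u'; z'].
  have -> : [set u'; y] |: D2 = D1 :\ [set u'; z'].
    by rewrite /D2 setD1C setD1K // in_setD1 u'yz u'yD1.
  by rewrite /D1 setD1C setD1K // in_setD1 eq_sym u'zuy.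
apply: (IH (y |: S) vc (upd (upd ec [set u'; y] c) [set u; y] g) u' z' y) => //.
- by rewrite cardsU1 yS addnA addn1.
- by rewrite eq_sym.
- by rewrite in_setU1 negb_or z'S eq_sym yz'.
- by rewrite -DE.
- by rewrite upd_other // upd_same.
- rewrite -DE; apply/negP => /forb_add[/forb_add[|[+ _]]|[+ _]].
  + by rewrite -z'c; apply/negP; apply: forb_removed h u'zD1 _ D2s u'zD2; rewrite set22.
  + by rewrite !inE eq_sym (negPf u'z2) eq_sym (negPf yz').
  + by rewrite !inE eq_sym (negPf uz') eq_sym (negPf yz').
move=> y'; rewrite in_setU1 => /orP[/eqP ->|y'S].
  exists u'; split=> //; first by rewrite upd_other // upd_same.
  apply/subsetP => t; rewrite (nb_edge Dp) => ut.
  case: (deg2_star du' u'y u'z' yz' ut (set21 _ _)) => /set2_inj ->; by rewrite !inE eqxx ?orbT.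
have [w [wX wy' wc wS wu]] := inv y' y'S.
have dy' := deg2_nb (X2 wX) wy'.
have y'y : y' != y by apply: contraNneq yS => <-.
exists w; split=> //.
- rewrite !upd_other //; apply/eqP => E; have := set22 w y'; rewrite E !inE (negPf y'y) orbF eq_sym.
    by rewrite (negPf (d26 _ _ du' dy')).
  by rewrite (negPf (d26 _ _ du dy')).
- by apply: subset_trans wS _; exact: subsetUr.
- by move=> /(subsetP wS); rewrite in_setU1 eq_sym (negPf yz') (negPf z'S).
Qed.

End Walk.

(** If some neighbour [y] of [u] has no other neighbour in [X], removing [u] loses [y], and
    induction applies. Otherwise the walk of [deg2_walk] could always go on to new vertices. *)
Lemma deg2_expand (X : {set V}) : X != set0 -> (forall u, u \in X -> deg D u = 2) ->
  #|X| < #|\bigcup_(u in X) nb D u|.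
Proof.
have [n Hn] : exists n, #|X| <= n by exists #|X|.
elim: n X Hn => [|n IH] X cX X0 X2.
  by move: X0; rewrite -card_gt0; move: cX; case: #|X|.
rewrite ltnNge; apply/negP => hX.
have [u0 u0X] := set0Pn _ X0.
have Xnext u y : u \in X -> [set u; y] \in D -> exists u', [/\ u' \in X, u' != u & [set u'; y] \in D].
  move=> uX uy.
  case: (boolP [exists u' in X, (u' != u) && ([set u'; y] \in D)]) => [/exists_inP[u' uX' /andP[? ?]]|nex].
    by exists u'.
  have {}nex u' : u' \in X -> u' != u -> [set u'; y] \notin D.
    by move=> h1 h2; move/exists_inPn/(_ u' h1): nex; rewrite h2.
  have sub : \bigcup_(v in X :\ u) nb D v \subset (\bigcup_(v in X) nb D v) :\ y.
    apply/bigcupsP => v; rewrite in_setD1 => /andP[vu vX]; apply/subsetP => t tv.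
    rewrite in_setD1; apply/andP; split; last by apply/bigcupP; exists v.
    by apply: contraTneq tv => ->; rewrite (nb_edge Dp); apply: nex.
  have yN : y \in \bigcup_(v in X) nb D v by apply/bigcupP; exists u; rewrite ?(nb_edge Dp).
  have := subset_leq_card sub; have := cardsD1 y (\bigcup_(v in X) nb D v).
  have := cardsD1 u X; rewrite uX yN => cX1 cN1.
  case: (eqVneq (X :\ u) set0) => [E|XU0].
    have : #|nb D u| <= #|\bigcup_(v in X) nb D v|.
      by apply: subset_leq_card; apply: bigcup_sup.
    rewrite (card_nb Dp) X2 //; move: cX1; rewrite E cards0; lia.
  have : #|X :\ u| < #|\bigcup_(v in X :\ u) nb D v|.
    apply: IH => //; first by lia.
    by move=> v; rewrite in_setD1 => /andP[_]; exact: X2.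
  lia.
have /card_gt0P[y] : 0 < #|nb D u0| by rewrite (card_nb Dp) X2.
rewrite (nb_edge Dp) => uy; have [z yz uz] := deg2_other (X2 _ u0X) uy.
have [vc [ec h]] := ok_proper (properD1 uy).
have [c cy] := missing_colour vc ec uy.
have zc := deg2_stuck (X2 _ u0X) uy uz yz h cy.
apply: (@deg2_walk X X2 Xnext #|V| set0 vc ec u0 y z c) => //; rewrite ?inE ?leq_addr //.
by move=> y'; rewrite inE.
Qed.

Lemma deg_setD_ge2 (S : {set {set V}}) v (e f : {set V}) : S \subset D -> e \in S -> f \in S -> e != f ->
  v \in e -> v \in f -> deg (D :\: S) v <= deg D v - 2.
Proof.
move=> SD eS fS ef ve vf; rewrite deg_remove //; apply: leq_sub2l.
have -> : 2 = #|[set e; f]| by rewrite cards2 ef.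
by apply: subset_leq_card; rewrite subUset !sub1set !star_in eS fS ve vf.
Qed.

Let in_compl_setU (c : 'I_7) (A B : {set 'I_7}) : c \in ~: (A :|: B) -> c \notin A /\ c \notin B.
Proof. by rewrite in_setC in_setU negb_or => /andP. Qed.

Let avail (T : {set 'I_7}) n : #|T| <= 7 - n -> n <= 7 -> n <= #|~: T|.
Proof. by move=> h1 h2; have := cardsC T; rewrite card_ord => h; move: h1; lia. Qed.

Lemma card_forb_setD (S : {set {set V}}) B vc ec v (e f : {set V}) : S \subset D -> e \in S -> f \in S ->
  e != f -> v \in e -> v \in f -> #|forb (D :\: S) B vc ec v| <= deg D v - 2 + (v \in B).
Proof.
move=> SD eS fS ef ve vf; apply: leq_trans (card_forb _ _ _ _ _) _.
by rewrite leq_add2r; exact: deg_setD_ge2 eS fS ef ve vf.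
Qed.

(** With the cycle uncoloured and [x], [y] left for the end, each edge has to avoid at most 4
    colours at its end of degree 5 and 1 at its end of degree 3. Two remain, and the four edges
    conflict in a 4-cycle. *)
Lemma no_alternating_C4 v x w y : uniq [:: v; x; w; y] ->
  [set v; x] \in D -> [set x; w] \in D -> [set w; y] \in D -> [set y; v] \in D ->
  deg D v = 5 -> deg D w = 5 -> deg D x = 3 -> deg D y = 3 -> False.
Proof.
rewrite /= !inE !negb_or andbT => /and3P[/and3P[vx vw vy] /andP[xw xy] wy].
move=> vxD xwD wyD yvD dv dw dx dy.
have ne (a b c d : V) : a != c -> a != d -> [set a; b] != [set c; d].
  by move=> ac ad; apply/eqP => E; have := set21 a b; rewrite E !inE (negPf ac) (negPf ad).
have ne' (a b c d : V) : b != c -> b != d -> [set a; b] != [set c; d].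
  by move=> ac ad; apply/eqP => E; have := set22 a b; rewrite E !inE (negPf ac) (negPf ad).
pose S := [set [set v; x]; [set x; w]; [set w; y]; [set y; v]].
have SD : S \subset D by rewrite !subUset !sub1set vxD xwD wyD yvD.
have [vc [ec h]] : exists vc ec, ok (D :\: S) big vc ec.
  apply: ok_proper; rewrite properE subsetDl /=; apply/subsetPn; exists [set v; x] => //.
  by rewrite !inE eqxx.
set D0 := D :\: S in h.
have xb : x \notin big by rewrite inE dx.
have yb : y \notin big by rewrite inE dy.
have S1 : [set v; x] \in S by rewrite !inE eqxx.
have S2 : [set x; w] \in S by rewrite !inE eqxx ?orbT.
have S3 : [set w; y] \in S by rewrite !inE eqxx ?orbT.
have S4 : [set y; v] \in S by rewrite !inE eqxx ?orbT.
have bv : v \in big by rewrite inE dv.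
have bw : w \in big by rewrite inE dw.
have e14 : [set v; x] != [set y; v] by apply: ne'; rewrite // eq_sym.
have e12 : [set v; x] != [set x; w] by apply: ne.
have e23 : [set x; w] != [set w; y] by apply: ne.
have e34 : [set w; y] != [set y; v] by apply: ne; rewrite // eq_sym.
have fv := card_forb_setD big vc ec SD S1 S4 e14 (set21 _ _) (set22 _ _).
have fx := card_forb_setD big vc ec SD S1 S2 e12 (set22 _ _) (set21 _ _).
have fw := card_forb_setD big vc ec SD S2 S3 e23 (set22 _ _) (set21 _ _).
have fy := card_forb_setD big vc ec SD S3 S4 e34 (set22 _ _) (set21 _ _).
rewrite -/D0 dv bv in fv; rewrite -/D0 dw bw in fw; rewrite -/D0 dx (negPf xb) in fx; rewrite -/D0 dy (negPf yb) in fy.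
have av a b : #|forb D0 big vc ec a| <= 4 -> #|forb D0 big vc ec b| <= 1 ->
    1 < #|~: (forb D0 big vc ec a :|: forb D0 big vc ec b)|.
  by move=> ha hb; apply: avail => //; apply: leq_trans (leq_card_setU _ _) (leq_add ha hb).
have [c1 [c2 [c3 [c4 [[]]]]]] := list_colour_C4 (av v x fv fx) (av w x fw fx) (av w y fw fy) (av v y fv fy).
move=> /in_compl_setU[c1v c1x] /in_compl_setU[c2w c2x] /in_compl_setU[c3w c3y] /in_compl_setU[c4v c4y] c12 c23 c34 c41.
have nin (a b d : V) : a != b -> a != d -> (a \in [set b; d]) = false.
  by move=> ab ad; rewrite in_set2 (negPf ab) (negPf ad).
have xv : x != v by rewrite eq_sym. have wv : w != v by rewrite eq_sym.
have yv : y != v by rewrite eq_sym. have wx : w != x by rewrite eq_sym.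
have yx : y != x by rewrite eq_sym. have yw : y != w by rewrite eq_sym.
have h1 : ok ([set x; v] |: D0) big vc (upd ec [set x; v] c1) by apply: add_small_edge.
have h2 : ok ([set x; w] |: ([set x; v] |: D0)) big vc (upd (upd ec [set x; v] c1) [set x; w] c2).
  apply: add_small_edge => //; apply/negP => /forb_add[]; try exact/negP.
    by case=> _ /eqP; rewrite eq_sym (negPf c12).
  by rewrite nin // => -[].
have h3 : ok ([set y; w] |: ([set x; w] |: ([set x; v] |: D0))) big vc
    (upd (upd (upd ec [set x; v] c1) [set x; w] c2) [set y; w] c3).
  apply: add_small_edge => //; apply/negP => /forb_add[/forb_add[]|]; try exact/negP.
  - by rewrite nin // => -[].
  - by rewrite nin // => -[].
  - by rewrite nin // => -[].
  - by case=> _ /eqP; rewrite eq_sym (negPf c23).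
have h4 : ok ([set y; v] |: ([set y; w] |: ([set x; w] |: ([set x; v] |: D0)))) big vc
    (upd (upd (upd (upd ec [set x; v] c1) [set x; w] c2) [set y; w] c3) [set y; v] c4).
  apply: add_small_edge => //; apply/negP => /forb_add[/forb_add[/forb_add[]|]|]; try exact/negP.
  - by rewrite nin // => -[].
  - by rewrite nin // => -[].
  - by case=> _ /eqP; rewrite eq_sym (negPf c34).
  - by case=> _ /eqP; rewrite (negPf c41).
  - by rewrite nin // => -[].
  - by rewrite nin // => -[].
apply: not_ok_big; apply: okS h4 => //; apply/subsetP => e eD.
rewrite !in_setU1 in_setD eD andbT (set2C x v) (set2C y w) /S !inE.
by do 4 case: (e == _).
Qed.

(** All three edges and vertices lose their colours. Each of the six then has to avoid at most four,
    and only a vertex and its opposite edge may agree, so the conflicts form an octahedron. *)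
Lemma no_444_triangle x y z : [set x; y] \in D -> [set y; z] \in D -> [set z; x] \in D ->
  deg D x = 4 -> deg D y = 4 -> deg D z = 4 -> False.
Proof.
move=> xyD yzD zxD dx dy dz.
have xy := pairs_neq Dp xyD; have yz := pairs_neq Dp yzD; have zx := pairs_neq Dp zxD.
have yx : y != x by rewrite eq_sym. have zy : z != y by rewrite eq_sym. have xz : x != z by rewrite eq_sym.
have ne (a b c d : V) : a != c -> a != d -> [set a; b] != [set c; d].
  by move=> ac ad; apply/eqP => E; have := set21 a b; rewrite E !inE (negPf ac) (negPf ad).
pose S := [set [set x; y]; [set y; z]; [set z; x]].
have SD : S \subset D by rewrite !subUset !sub1set xyD yzD zxD.
have S1 : [set x; y] \in S by rewrite !inE eqxx.
have S2 : [set y; z] \in S by rewrite !inE eqxx ?orbT.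
have S3 : [set z; x] \in S by rewrite !inE eqxx ?orbT.
have [vc [ec h]] : exists vc ec, ok (D :\: S) big vc ec.
  by apply: ok_proper; rewrite properE subsetDl /=; apply/subsetPn; exists [set x; y]; rewrite // in_setD S1.
set D0 := D :\: S in h.
pose B0 := big :\: [set x; y; z].
have {}h : ok D0 B0 vc ec by apply: okS h; rewrite // subsetDl.
have B0x : x \in B0 = false by rewrite !inE eqxx.
have B0y : y \in B0 = false by rewrite !inE eqxx ?orbT.
have B0z : z \in B0 = false by rewrite !inE eqxx ?orbT.
have e12 : [set x; y] != [set y; z] by exact: ne.
have e23 : [set y; z] != [set z; x] by exact: ne.
have e31 : [set z; x] != [set x; y] by exact: ne.
have fx := card_forb_setD B0 vc ec SD S1 S3 (negbT (etrans (eq_sym _ _) (negPf e31))) (set21 _ _) (set22 _ _).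
have fy := card_forb_setD B0 vc ec SD S1 S2 e12 (set22 _ _) (set21 _ _).
have fz := card_forb_setD B0 vc ec SD S2 S3 e23 (set22 _ _) (set21 _ _).
rewrite -/D0 dx B0x in fx; rewrite -/D0 dy B0y in fy; rewrite -/D0 dz B0z in fz.
pose Q a b c := forb D0 B0 vc ec a :|: [set vc u | u in nb D a :\ b :\ c].
have cQ a b c : deg D a = 4 -> b \in nb D a -> c \in nb D a -> b != c ->
    #|forb D0 B0 vc ec a| <= 2 -> 2 < #|~: Q a b c|.
  move=> da ba ca bc fa; apply: avail => //; apply: leq_trans (leq_card_setU _ _) _.
  rewrite -[7 - 3]/(2 + 2); apply: leq_add => //; apply: leq_trans (leq_imset_card _ _) _.
  have e1 := cardsD1 b (nb D a); have e2 := cardsD1 c (nb D a :\ b).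
  rewrite in_setD1 ca eq_sym bc add1n in e2; rewrite ba (card_nb Dp) da e2 add1n in e1.
  by case: e1 => <-.
have cE a b : #|forb D0 B0 vc ec a| <= 2 -> #|forb D0 B0 vc ec b| <= 2 ->
    2 < #|~: (forb D0 B0 vc ec a :|: forb D0 B0 vc ec b)|.
  by move=> ha hb; apply: avail => //; apply: leq_trans (leq_card_setU _ _) (leq_add ha hb).
have nE a b : [set a; b] \in D -> b \in nb D a by rewrite (nb_edge Dp).
have LX : 2 < #|~: Q x y z| by apply: cQ => //; apply: nE; rewrite // set2C.
have LY : 2 < #|~: Q y z x| by apply: cQ => //; apply: nE; rewrite // set2C.
have LZ : 2 < #|~: Q z x y| by apply: cQ => //; apply: nE; rewrite // set2C.
have [px [pyz [py [pzx [pz [pxy [[qx qyz] [qy qzx] [qz qxy] [o1 o2 o3]]]]]]]] :=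
  list_colour_octahedron LX (cE y z fy fz) LY (cE z x fz fx) LZ (cE x y fx fy).
move: qx qy qz qyz qzx qxy => /in_compl_setU[qx qx'] /in_compl_setU[qy qy'] /in_compl_setU[qz qz'].
move=> /in_compl_setU[yzy yzz] /in_compl_setU[zxz zxx] /in_compl_setU[xyx xyy].
case: o1 => [xy1 x_zx yz_y yz_zx]; case: o2 => [xz1 x_xy yz_z yz_xy]; case: o3 => [yz1 y_xy zx_z zx_xy].
have nin (a b d : V) : a != b -> a != d -> (a \in [set b; d]) = false.
  by move=> ab ad; rewrite in_set2 (negPf ab) (negPf ad).
have nv a b s t : s \in B0 -> t \in B0 -> s != t -> [set s; t] = [set a; b] -> a \in B0 = false -> vc s != vc t.
  move=> sB tB _ E aB; have := set21 a b; rewrite -E in_set2 => /orP[] /eqP E'.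
    by rewrite E' sB in aB.
  by rewrite E' tB in aB.
pose ec1 := upd ec [set y; z] pyz; pose ec2 := upd ec1 [set z; x] pzx; pose ec3 := upd ec2 [set x; y] pxy.
have h1 : ok ([set y; z] |: D0) B0 vc ec1.
  apply: add_edge => //; first by move=> a; rewrite in_set2 => /orP[] /eqP ->.
  by move=> s t sB tB st E; exact: (nv y z).
have h2 : ok ([set z; x] |: ([set y; z] |: D0)) B0 vc ec2.
  apply: add_edge => //; last by move=> s t sB tB st E; exact: (nv z x).
  move=> a; rewrite in_set2 => /orP[] /eqP ->; apply/negP => /forb_add[]; try exact/negP.
    by case=> _ /eqP; rewrite eq_sym (negPf yz_zx).
  by rewrite nin // => -[].
have h3 : ok ([set x; y] |: ([set z; x] |: ([set y; z] |: D0))) B0 vc ec3.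
  apply: add_edge => //; last by move=> s t sB tB st E; exact: (nv x y).
  move=> a; rewrite in_set2 => /orP[] /eqP ->; apply/negP => /forb_add[/forb_add[]|]; try exact/negP.
  - by rewrite nin // => -[].
  - by case=> _ /eqP; rewrite eq_sym (negPf zx_xy).
  - by case=> _ /eqP; rewrite eq_sym (negPf yz_xy).
  - by rewrite nin // => -[].
have DE : D \subset [set x; y] |: ([set z; x] |: ([set y; z] |: D0)).
  apply/subsetP => e eD; rewrite !in_setU1 in_setD eD andbT /S !inE.
  by do 3 case: (e == _).
have {}h3 : ok D B0 vc ec3 by apply: okS h3.
have nx c : c \notin forb D0 B0 vc ec x -> c != pxy -> c != pzx -> c \notin forb D set0 vc ec3 x.
  move=> cx c1 c2; apply/negP => /(subsetP (forbS vc ec3 x DE (sub0set B0))).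
  move=> /forb_add[/forb_add[/forb_add[]|]|]; try exact/negP.
  - by rewrite nin // => -[].
  - by case=> _ /eqP; rewrite (negPf c2).
  - by case=> _ /eqP; rewrite (negPf c1).
have ny c : c \notin forb D0 B0 vc ec y -> c != pxy -> c != pyz -> c \notin forb D set0 vc ec3 y.
  move=> cx c1 c2; apply/negP => /(subsetP (forbS vc ec3 y DE (sub0set B0))).
  move=> /forb_add[/forb_add[/forb_add[]|]|]; try exact/negP.
  - by case=> _ /eqP; rewrite (negPf c2).
  - by rewrite nin // => -[].
  - by case=> _ /eqP; rewrite (negPf c1).
have nz c : c \notin forb D0 B0 vc ec z -> c != pzx -> c != pyz -> c \notin forb D set0 vc ec3 z.
  move=> cx c1 c2; apply/negP => /(subsetP (forbS vc ec3 z DE (sub0set B0))).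
  move=> /forb_add[/forb_add[/forb_add[]|]|]; try exact/negP.
  - by case=> _ /eqP; rewrite (negPf c2).
  - by case=> _ /eqP; rewrite (negPf c1).
  - by rewrite nin // => -[].
have outer a b c u p : p \notin [set vc u | u in nb D a :\ b :\ c] -> u \in B0 -> b \in B0 = false ->
    c \in B0 = false -> u \in nb D a -> vc u != p.
  move=> pn uB bB cB ua; apply: contraNneq pn => <-; apply: imset_f.
  rewrite !in_setD1 ua andbT; apply/andP; split; first by apply: contraTneq uB => ->; rewrite cB.
  by apply: contraTneq uB => ->; rewrite bB.
pose vc1 := upd vc x px; pose vc2 := upd vc1 y py.
have v1 : ok D (x |: B0) vc1 ec3.
  apply: add_vertex => //; first by apply: nx => //; rewrite eq_sym // eq_sym.
  by move=> u uB ux; apply: (outer x y z) ux => //.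
have forb0 f g a : forb D set0 f ec3 a = forb D set0 g ec3 a by rewrite /forb !in_set0.
have v2 : ok D (y |: (x |: B0)) vc2 ec3.
  apply: add_vertex => //; first by rewrite (forb0 _ vc); apply: ny => //; rewrite eq_sym.
  move=> u; rewrite in_setU1 /vc1 /upd; case: eqP => [-> //|_ /= uB uy].
  by apply: (outer y z x) uy => //.
have v3 : ok D (z |: (y |: (x |: B0))) (upd vc2 z pz) ec3.
  apply: add_vertex => //; first by rewrite (forb0 _ vc); apply: nz => //; rewrite eq_sym.
  move=> u; rewrite !in_setU1 /vc2 /upd; case: (eqVneq u y) => [_ _ _|uy /=]; first exact: yz1.
  rewrite /vc1 /upd; case: (eqVneq u x) => [_ _ _|ux /= uB uz]; first exact: xz1.
  by apply: (outer z x y) uz => //.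
apply: (@not_ok_big (upd vc2 z pz) ec3); apply: okS v3 => //.
apply/subsetP => a ab; rewrite !in_setU1 in_setD ab andbT !inE.
by do 3 case: (a == _).
Qed.

End Critical.

(** * Short cycles *)

Section EvenSets.
Variable V : finType.
Implicit Types (D f g : {set {set V}}) (a b c d e v : V).

Definition cyc3 a b c : {set {set V}} := [set [set a; b]; [set b; c]; [set c; a]].
Definition cyc4 a b c d : {set {set V}} := [set [set a; b]; [set b; c]; [set c; d]; [set d; a]].
Definition cyc5 a b c d e : {set {set V}} :=
  [set [set a; b]; [set b; c]; [set c; d]; [set d; e]; [set e; a]].

Lemma edge_neq (a b c d : V) : a != c -> a != d -> [set a; b] != [set c; d].
Proof. by move=> ac ad; apply/eqP => E; have := set21 a b; rewrite E !inE (negPf ac) (negPf ad). Qed.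

Lemma edge_neq_r (a b c d : V) : b != c -> b != d -> [set a; b] != [set c; d].
Proof. by rewrite set2C; exact: edge_neq. Qed.

Lemma edge_neq_share (a b c : V) : b != c -> [set a; b] != [set a; c].
Proof. by apply: contraNneq => /set2_inj ->. Qed.

Let mem2 v a b : a != b -> (v == a) || (v == b) = (v == a) (+) (v == b).
Proof. by move=> ab; case: eqP => [->|_]; [rewrite (negPf ab)|case: eqP]. Qed.

Lemma cyc3_seq a b c : cyc3 a b c =i [:: [set a; b]; [set b; c]; [set c; a]].
Proof. by move=> x; rewrite !inE -!orbA. Qed.

Lemma cyc4_seq a b c d : cyc4 a b c d =i [:: [set a; b]; [set b; c]; [set c; d]; [set d; a]].
Proof. by move=> x; rewrite !inE -!orbA. Qed.

Lemma cyc5_seq a b c d e :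
  cyc5 a b c d e =i [:: [set a; b]; [set b; c]; [set c; d]; [set d; e]; [set e; a]].
Proof. by move=> x; rewrite !inE -!orbA. Qed.

Lemma cyc3_uniq a b c : uniq [:: a; b; c] -> uniq [:: [set a; b]; [set b; c]; [set c; a]].
Proof.
rewrite /= !inE !negb_or !andbT => /andP[/andP[ab ac] bc].
have ba : b != a by rewrite eq_sym.
by rewrite (edge_neq _ ab ac) (edge_neq_r _ bc ba) (edge_neq _ bc ba).
Qed.

Lemma cyc4_uniq a b c d : uniq [:: a; b; c; d] ->
  uniq [:: [set a; b]; [set b; c]; [set c; d]; [set d; a]].
Proof.
rewrite /= !inE !negb_or !andbT => /and3P[/and3P[ab ac ad] /andP[bc bd] cd].
have ba : b != a by rewrite eq_sym. have ca : c != a by rewrite eq_sym.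
by rewrite (edge_neq _ ab ac) (edge_neq _ ac ad) (edge_neq_r _ bd ba) (edge_neq _ bc bd) (edge_neq _ bd ba) (edge_neq _ cd ca).
Qed.

Lemma cyc5_uniq a b c d e : uniq [:: a; b; c; d; e] ->
  uniq [:: [set a; b]; [set b; c]; [set c; d]; [set d; e]; [set e; a]].
Proof.
rewrite /= !inE !negb_or !andbT => /and4P[/and4P[ab ac ad ae] /and3P[bc bd be] /andP[cd ce] de].
have ba : b != a by rewrite eq_sym. have ca : c != a by rewrite eq_sym. have da : d != a by rewrite eq_sym.
rewrite (edge_neq _ ab ac) (edge_neq _ ac ad) (edge_neq _ ad ae) (edge_neq_r _ be ba).
by rewrite (edge_neq _ bc bd) (edge_neq _ bd be) (edge_neq _ be ba) (edge_neq _ cd ce) (edge_neq _ ce ca) (edge_neq _ de da).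
Qed.

Lemma card_seq (T : finType) (A : {set T}) (s : seq T) : A =i s -> uniq s -> #|A| = size s.
Proof. by move=> E u; rewrite (eq_card E); apply/card_uniqP. Qed.

Lemma xor_seq (T : finType) (A : {set T}) (s : seq T) (h : T -> bool) : A =i s -> uniq s ->
  \xor_(x in A) h x = \xor_(x <- s) h x.
Proof. by move=> E u; rewrite big_uniq //; apply: eq_bigl. Qed.

Lemma cyc3_even a b c : uniq [:: a; b; c] -> even_set (cyc3 a b c).
Proof.
move=> u v; rewrite (xor_seq _ (@cyc3_seq a b c)) ?cyc3_uniq // !big_cons big_nil /=.
move: u; rewrite /= !inE !negb_or !andbT => /andP[/andP[ab ac] bc].
have ca : c != a by rewrite eq_sym.
by rewrite !mem2 //; case: (v == a); case: (v == b); case: (v == c).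
Qed.

Lemma cyc4_even a b c d : uniq [:: a; b; c; d] -> even_set (cyc4 a b c d).
Proof.
move=> u v; rewrite (xor_seq _ (@cyc4_seq a b c d)) ?cyc4_uniq // !big_cons big_nil /=.
move: u; rewrite /= !inE !negb_or !andbT => /and3P[/and3P[ab ac ad] /andP[bc bd] cd].
have da : d != a by rewrite eq_sym.
by rewrite !mem2 //; case: (v == a); case: (v == b); case: (v == c); case: (v == d).
Qed.

Lemma cyc5_even a b c d e : uniq [:: a; b; c; d; e] -> even_set (cyc5 a b c d e).
Proof.
move=> u v; rewrite (xor_seq _ (@cyc5_seq a b c d e)) ?cyc5_uniq // !big_cons big_nil /=.
move: u; rewrite /= !inE !negb_or !andbT => /and4P[/and4P[ab ac ad ae] /and3P[bc bd be] /andP[cd ce] de].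
have ea : e != a by rewrite eq_sym.
rewrite !mem2 //; by case: (v == a); case: (v == b); case: (v == c); case: (v == d); case: (v == e).
Qed.

Lemma even_setD f g : even_set f -> even_set g -> g \subset f -> even_set (f :\: g).
Proof.
move=> fe ge gf v; have := fe v; rewrite (big_setID g) /= (setIidPr gf) ge addFb //.
Qed.

Section Walk.
Variable f : {set {set V}}.
Hypothesis fp : pairs f.
Hypothesis fe : even_set f.

Lemma even_next a b : [set a; b] \in f -> exists c, [/\ c != a, c != b & [set b; c] \in f].
Proof.
move=> ab; have := fe b; rewrite (bigD1 _ ab) /= set22.
case: (boolP [exists e in f, (e != [set a; b]) && (b \in e)]) => [|nex].
  case/exists_inP => e ef /andP[ne be] _.
  have [|c] := @starP _ _ fp b e; first by rewrite star_in ef.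
  rewrite (nb_edge fp) => bc E; exists c; split; rewrite -?E //.
    by apply: contraNneq ne => <-; rewrite E set2C.
  by rewrite eq_sym; exact: pairs_neq bc.
rewrite big1 // => e /andP[ef ne]; apply/negbTE; apply: contra nex => be.
by apply/exists_inP; exists e; rewrite // ne be.
Qed.
End Walk.

Lemma card_even f : pairs f -> even_set f -> f != set0 -> 3 <= #|f|.
Proof.
move=> fp fe /set0Pn[e ef]; have [a [b [ab E]]] := fp e ef; rewrite E in ef.
have [c [ca cb bc]] := even_next fp fe ef; have [d [db dc cd]] := even_next fp fe bc.
have S : [set [set a; b]; [set b; c]; [set c; d]] \subset f by rewrite !subUset !sub1set ef bc cd.
apply: leq_trans (subset_leq_card S).
rewrite (@card_seq _ _ [:: [set a; b]; [set b; c]; [set c; d]]) //; first by move=> x; rewrite !inE -!orbA.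
have ac : a != c by rewrite eq_sym.
have bd : b != d by rewrite eq_sym. have bc' : b != c by rewrite eq_sym.
by rewrite /= !inE !negb_or (edge_neq _ ab ac) (edge_neq _ bc' bd) eq_sym (edge_neq _ ca cb).
Qed.

Lemma pairsS f g : pairs f -> g \subset f -> pairs g.
Proof. by move=> fp /subsetP gf e /gf /fp. Qed.

(** The rest of [f] is even as well, so it is empty or has three edges, too many besides the three
    of [g]. *)
Lemma even_subset_eq f g : pairs f -> even_set f -> #|f| <= 5 -> even_set g -> g \subset f ->
  3 <= #|g| -> f = g.
Proof.
move=> fp fe f5 ge gf g3; apply/eqP; rewrite eqEsubset gf andbT -setD_eq0; apply/negPn/negP => ne.
have := card_even (pairsS fp (subsetDl f g)) (even_setD fe ge gf) ne.
by have := cardsID g f; rewrite (setIidPr gf); lia.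
Qed.

Variant small_even_spec f a b : nat -> Prop :=
| SmallEven3 c of uniq [:: a; b; c] & f = cyc3 a b c : small_even_spec f a b 3
| SmallEven4 c d of uniq [:: a; b; c; d] & f = cyc4 a b c d : small_even_spec f a b 4
| SmallEven5 c d e of uniq [:: a; b; c; d; e] & f = cyc5 a b c d e : small_even_spec f a b 5.

(** From [ab], evenness continues a walk that never turns back. Closing up at [a] gives a cycle that
    is all of [f]; closing up elsewhere gives one without [ab], against [even_subset_eq]; not
    closing up in time gives six edges. *)
Lemma small_even f a b : pairs f -> even_set f -> #|f| <= 5 -> [set a; b] \in f ->
  small_even_spec f a b #|f|.
Proof.
move=> fp fe f5 abf; have ab := pairs_neq fp abf.
have [c [ca cb bc]] := even_next fp fe abf; have [d [db dc cd]] := even_next fp fe bc.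
have full g : even_set g -> g \subset f -> 3 <= #|g| -> f = g by exact: even_subset_eq.
have c3 x y z : uniq [:: x; y; z] -> #|cyc3 x y z| = 3.
  by move=> u; rewrite (card_seq (@cyc3_seq x y z)) ?cyc3_uniq.
have c4 x y z t : uniq [:: x; y; z; t] -> #|cyc4 x y z t| = 4.
  by move=> u; rewrite (card_seq (@cyc4_seq x y z t)) ?cyc4_uniq.
have c5 x y z t w : uniq [:: x; y; z; t; w] -> #|cyc5 x y z t w| = 5.
  by move=> u; rewrite (card_seq (@cyc5_seq x y z t w)) ?cyc5_uniq.
have is3 x y z : uniq [:: x; y; z] -> [set x; y] \in f -> [set y; z] \in f -> [set z; x] \in f -> f = cyc3 x y z.
  by move=> u h1 h2 h3; apply: full; rewrite ?c3 //; [exact: cyc3_even|rewrite !subUset !sub1set h1 h2].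
have is4 x y z t : uniq [:: x; y; z; t] -> [set x; y] \in f -> [set y; z] \in f -> [set z; t] \in f ->
    [set t; x] \in f -> f = cyc4 x y z t.
  by move=> u h1 h2 h3 h4; apply: full; rewrite ?c4 //; [exact: cyc4_even|rewrite !subUset !sub1set h1 h2 h3].
have is5 x y z t w : uniq [:: x; y; z; t; w] -> [set x; y] \in f -> [set y; z] \in f -> [set z; t] \in f ->
    [set t; w] \in f -> [set w; x] \in f -> f = cyc5 x y z t w.
  by move=> u h1 h2 h3 h4 h5; apply: full; rewrite ?c5 //; [exact: cyc5_even|rewrite !subUset !sub1set h1 h2 h3 h4].
have ac0 : a != c by rewrite eq_sym.
have off x y : a != x -> a != y -> [set a; b] != [set x; y] by exact: edge_neq.
have u3 : uniq [:: a; b; c] by rewrite /= !inE !negb_or ab eq_sym ca eq_sym cb.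
have [ad|ad] := eqVneq a d.
  have E : f = cyc3 a b c by apply: is3; rewrite // ad.
  by rewrite E c3 // -E; constructor 1 with c.
have u4 : uniq [:: a; b; c; d].
  by rewrite /= !inE !negb_or ab ad (eq_sym a) ca (eq_sym b) cb (eq_sym b) db (eq_sym c) dc.
have [e [ec ed de]] := even_next fp fe cd.
have [ae|ae] := eqVneq a e.
  have E : f = cyc4 a b c d by apply: is4; rewrite // ae.
  by rewrite E c4 // -E; constructor 2 with c d.
have [be|be] := eqVneq b e.
  have E : f = cyc3 b c d by apply: is3; rewrite ?be // -?be //; case/andP: u4.
  by move: abf; rewrite {1}E cyc3_seq !inE (negPf (off b c ab ac0)) (negPf (off c d ac0 ad)) (negPf (off d b ad ab)).
have u5 : uniq [:: a; b; c; d; e].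
  rewrite /= !inE !negb_or ab ad ae be (eq_sym a) ca (eq_sym b) cb (eq_sym b) db (eq_sym c) dc.
  by rewrite (eq_sym c) ec (eq_sym d) ed.
have [g [gd ge eg]] := even_next fp fe de.
have [ag|ag] := eqVneq a g.
  have E : f = cyc5 a b c d e by apply: is5; rewrite // ag.
  by rewrite E c5 // -E; constructor 3 with c d e.
have [bg|bg] := eqVneq b g.
  have E : f = cyc4 b c d e by apply: is4; rewrite ?bg // -?bg //; case/andP: u5.
  by move: abf; rewrite {1}E cyc4_seq !inE (negPf (off b c ab ac0)) (negPf (off c d ac0 ad)) (negPf (off d e ad ae)) (negPf (off e b ae ab)).
have [cg|cg] := eqVneq c g.
  have E : f = cyc3 c d e by apply: is3; rewrite ?cg // -?cg //; case/and3P: u5.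
  by move: abf; rewrite {1}E cyc3_seq !inE (negPf (off c d ac0 ad)) (negPf (off d e ad ae)) (negPf (off e c ae ac0)).
have [h [he hg gh]] := even_next fp fe eg.
have S : [set [set a; b]; [set b; c]; [set c; d]; [set d; e]; [set e; g]; [set g; h]] \subset f.
  by rewrite !subUset !sub1set abf bc cd de eg gh.
have : 6 <= #|f|; last by rewrite leqNgt ltnS f5.
apply: leq_trans (subset_leq_card S).
rewrite (@card_seq _ _ [:: [set a; b]; [set b; c]; [set c; d]; [set d; e]; [set e; g]; [set g; h]]) //.
  by move=> x; rewrite !inE -!orbA.
have := u5; rewrite /= !inE !negb_or !andbT => /and4P[/and4P[_ ac _ _] /and3P[bc' bd' _] /andP[cd' ce'] de'].
have ga : g != a by rewrite eq_sym.
have gb : g != b by rewrite eq_sym.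
have gc : g != c by rewrite eq_sym.
have last_ne x y : g != x -> g != y -> [set x; y] != [set g; h].
  by move=> gx gy; rewrite eq_sym; exact: edge_neq.
rewrite (edge_neq _ ab ac) (edge_neq _ ac ad) (edge_neq _ ad ae) (edge_neq _ ae ag) last_ne //.
rewrite (edge_neq _ bc' bd') (edge_neq _ bd' be) (edge_neq _ be bg) last_ne //.
rewrite (edge_neq _ cd' ce') (edge_neq _ ce' cg) last_ne //.
have dg : d != g by rewrite eq_sym.
have eg' : e != g by rewrite eq_sym. have eh : e != h by rewrite eq_sym.
by rewrite (edge_neq _ de' dg) last_ne // (edge_neq _ eg' eh).
Qed.

End EvenSets.

(** * Discharging *)

(* Amount, in 24ths of a unit of charge, that a vertex of degree [dv] sends along an edge to a
   vertex of degree [dw] into an incident face of length [n]; [t2] tells whether that face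
   contains a vertex of degree 2. *)
Definition paydeg (n dv dw : nat) (t2 : bool) : nat :=
  if dv <= 3 then 0 else
  match n with
  | 3 => if dv == 4 then 9 else if [|| dw == 2, dw == 4 | t2] then 18 else 16
  | 4 => if dv == 4 then 6 else if dv == 5 then 9 else if dw == 2 then 8 else 16
  | 5 => if dv == 4 then 3 else if dw == 4 then 2 else 4
  | _ => 0
  end.

Definition edgepay n x y t2 := paydeg n x y t2 + paydeg n y x t2.

Definition degadj (x y : nat) : bool :=
  [&& 2 <= x <= 6, 2 <= y <= 6, (x <= 3) ==> (8 <= x + y) & (y <= 3) ==> (8 <= x + y)].

Lemma degrange (P : nat -> bool) x : all P (iota 2 5) -> 2 <= x <= 6 -> P x.
Proof. by move=> /allP h /andP[h1 h2]; apply: h; rewrite mem_iota h1. Qed.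

Lemma degadj_range x y : degadj x y -> 2 <= x <= 6.
Proof. by case/and4P. Qed.

Lemma paydeg_ge5 n dv dw t : 5 <= n -> 5 <= dv -> paydeg n dv dw t <= (if dw == 4 then 2 else 4).
Proof.
case: n => [|[|[|[|[|[|n]]]]]] // _; case: dv => [|[|[|[|[|dv]]]]] // _; rewrite /paydeg /=;
by case: (dw == 4).
Qed.

Lemma paydeg4_ge5 n dw t : 5 <= n -> paydeg n 4 dw t <= 3.
Proof. by case: n => [|[|[|[|[|[|n]]]]]]. Qed.

Lemma paydeg4_ge4 n dw t : 4 <= n -> paydeg n 4 dw t <= 6.
Proof. by case: n => [|[|[|[|[|[|n]]]]]]. Qed.

Lemma paydeg5_ge4 n dw t : 4 <= n -> paydeg n 5 dw t <= 9.
Proof. by case: n => [|[|[|[|[|[|n]]]]]] // _; rewrite /paydeg /=; case: (dw == 4). Qed.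

Lemma paydeg_ge6 n dv dw t : 6 <= n -> paydeg n dv dw t = 0.
Proof. by case: n => [|[|[|[|[|[|n]]]]]] // _; rewrite /paydeg; case: ifP. Qed.

Lemma paydeg_small n dv dw t : dv <= 3 -> paydeg n dv dw t = 0.
Proof. by rewrite /paydeg => ->. Qed.

Lemma sum_le_two (T : finType) (S : {set T}) (h : T -> nat) m : #|S| <= 2 ->
  (forall x, x \in S -> h x <= m) -> \sum_(x in S) h x <= 2 * m.
Proof.
move=> S2 hm; apply: leq_trans (_ : #|S| * m <= _); last by rewrite leq_mul2r S2 orbT.
by rewrite -sum_nat_const; apply: leq_sum.
Qed.

Lemma sum_le_first (T : finType) (S : {set T}) (h : T -> nat) m y : #|S| <= 2 -> y \in S ->
  (forall x, x \in S -> x != y -> h x <= m) -> \sum_(x in S) h x <= h y + m.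
Proof.
move=> S2 yS hm; rewrite (big_setD1 y yS) /= leq_add2l.
apply: leq_trans (_ : #|S :\ y| * m <= _).
  by rewrite -sum_nat_const; apply: leq_sum => x; rewrite in_setD1 => /andP[xy xS]; exact: hm.
by move: S2; rewrite (cardsD1 y S) yS ltnS; case: #|_| => [|[|n]] //=; rewrite ?mul0n ?mul1n.
Qed.

Lemma double_count (S T : finType) (A : {set S}) (B : {set T}) (Q : S -> T -> bool) k :
  (forall x, x \in A -> k <= #|[set y in B | Q x y]|) ->
  (forall x x' y, x \in A -> x' \in A -> y \in B -> Q x y -> Q x' y -> x = x') -> k * #|A| <= #|B|.
Proof.
move=> hA hB; rewrite mulnC -sum_nat_const.
apply: leq_trans (_ : \sum_(x in A) \sum_(y in B) Q x y <= _).
  apply: leq_sum => x /hA; rewrite -sum1_card big_mkcond /= [\sum_(y in B) _]big_mkcond /=.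
  by move/leq_trans; apply; apply: leq_sum => y _; rewrite inE; case: (y \in B); case: (Q x y).
rewrite exchange_big /= -[#|B|]muln1 -sum_nat_const; apply: leq_sum => y yB.
rewrite -big_mkcondr /= sum1_card; apply/card_le1_eqP => x x'.
by move=> /andP[xA Qx] /andP[xA2 Qx2]; exact: esym (hB _ _ _ xA xA2 yB Qx Qx2).
Qed.

(** A triangular face needs [72 = 24 * 3]; the last term is what [xtra] supplies when a vertex has
    degree 3. The degrees are finitely many, so the bound is computed. *)
Lemma triangle_pay x y z : degadj x y -> degadj y z -> degadj z x ->
  ~~ [&& x == 4, y == 4 & z == 4] -> let t2 := [|| x == 2, y == 2 | z == 2] in
  72 <= edgepay 3 x y t2 + (edgepay 3 y z t2 + edgepay 3 z x t2) + (if [|| x == 3, y == 3 | z == 3] then 8 else 0).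
Proof.
have H : all (fun x => all (fun y => all (fun z => [&& degadj x y, degadj y z, degadj z x &
  ~~ [&& x == 4, y == 4 & z == 4]] ==> let t2 := [|| x == 2, y == 2 | z == 2] in
  (72 <= edgepay 3 x y t2 + (edgepay 3 y z t2 + edgepay 3 z x t2) + (if [|| x == 3, y == 3 | z == 3] then 8 else 0)))
  (iota 2 5)) (iota 2 5)) (iota 2 5) by vm_compute.
move=> h1 h2 h3 h4.
have /implyP := degrange (degrange (degrange H (degadj_range h1)) (degadj_range h2)) (degadj_range h3).
by apply; rewrite h1 h2 h3.
Qed.

Lemma quad_pay x y z t (t2 : bool) : degadj x y -> degadj y z -> degadj z t -> degadj t x ->
  ~~ ([&& x == 2 & z == 2] || [&& y == 2 & t == 2]) ->
  ~~ ([&& x == 5, y == 3, z == 5 & t == 3] || [&& x == 3, y == 5, z == 3 & t == 5]) ->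
  48 <= edgepay 4 x y t2 + (edgepay 4 y z t2 + (edgepay 4 z t t2 + edgepay 4 t x t2)).
Proof.
have H : all (fun x => all (fun y => all (fun z => all (fun t => [&& degadj x y, degadj y z, degadj z t, degadj t x,
  ~~ ([&& x == 2 & z == 2] || [&& y == 2 & t == 2]) &
  ~~ ([&& x == 5, y == 3, z == 5 & t == 3] || [&& x == 3, y == 5, z == 3 & t == 5])] ==>
  (48 <= edgepay 4 x y false + (edgepay 4 y z false + (edgepay 4 z t false + edgepay 4 t x false))))
  (iota 2 5)) (iota 2 5)) (iota 2 5)) (iota 2 5) by vm_compute.
move=> h1 h2 h3 h4 h5 h6.
have /implyP := degrange (degrange (degrange (degrange H (degadj_range h1)) (degadj_range h2)) (degadj_range h3)) (degadj_range h4).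
by apply; rewrite h1 h2 h3 h4 h5.
Qed.

Lemma pent_pay x y z t s (t2 : bool) : degadj x y -> degadj y z -> degadj z t -> degadj t s -> degadj s x ->
  24 <= edgepay 5 x y t2 + (edgepay 5 y z t2 + (edgepay 5 z t t2 + (edgepay 5 t s t2 + edgepay 5 s x t2))).
Proof.
have H : all (fun x => all (fun y => all (fun z => all (fun t => all (fun s =>
  [&& degadj x y, degadj y z, degadj z t, degadj t s & degadj s x] ==>
  (24 <= edgepay 5 x y false + (edgepay 5 y z false + (edgepay 5 z t false + (edgepay 5 t s false + edgepay 5 s x false)))))
  (iota 2 5)) (iota 2 5)) (iota 2 5)) (iota 2 5)) (iota 2 5) by vm_compute.
move=> h1 h2 h3 h4 h5.
have /implyP := degrange (degrange (degrange (degrange (degrange H (degadj_range h1)) (degadj_range h2)) (degadj_range h3)) (degadj_range h4)) (degadj_range h5).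
by apply; rewrite h1 h2 h3 h4.
Qed.

Section Discharging.
Variables (V : finType) (D : {set {set V}}) (F : {set {set {set V}}}).
Hypothesis Dc : critical D.
Hypothesis HF : facial_family D F.
Implicit Types (v w x y z u : V) (f g : {set {set V}}).

Hypothesis quad_triangle : forall a b c d t, uniq [:: a; b; c; d] -> cyc4 a b c d \subset D ->
  uniq [:: a; b; t] -> cyc3 a b t \subset D -> False.
Hypothesis quad_six : forall v a f g, deg D v = 6 -> f \subset D -> g \subset D -> f != g ->
  small_even_spec f v a 4 -> small_even_spec g v a #|g| -> False.

Let Dp : pairs D := crit_pairs Dc.
Let d v := deg D v.

Let FD f : f \in F -> f \subset D. Proof. by case: HF => h _ _ /h[]. Qed.
Let Fp f : f \in F -> pairs f. Proof. by move=> fF; apply: pairsS Dp (FD fF). Qed.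
Let Fe f : f \in F -> even_set f. Proof. by case: HF => h _ _ /h[]. Qed.
Let F3 f : f \in F -> 3 <= #|f|.
Proof. by move=> fF; apply: card_even; [exact: Fp|exact: Fe|case: HF => h _ _; case: (h f fF)]. Qed.
Let Fspec f a b : f \in F -> #|f| <= 5 -> [set a; b] \in f -> small_even_spec f a b #|f|.
Proof. by move=> fF; apply: small_even; [exact: Fp|exact: Fe]. Qed.

Let face_edge f e : f \in F -> e \in f -> exists a b, e = [set a; b] /\ a != b.
Proof. by move=> fF ef; have [a [b [ab E]]] := Fp fF ef; exists a, b. Qed.

Let Fspec3 f a b : f \in F -> #|f| = 3 -> [set a; b] \in f -> exists2 c, uniq [:: a; b; c] & f = cyc3 a b c.
Proof.
move=> fF f3 ab; have := @Fspec f a b fF; rewrite f3 => /(_ isT ab) H.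
have : 3 = 3 by []. case: {-1}_ / H => // c u E _; by exists c.
Qed.

(** If [g] were a triangle too, the four edges of [f] and [g] other than [e] would form a 4-cycle
    adjacent to [f]; if [g] had length 4, it would itself be such a cycle. *)
Lemma triangle_face_edge f g e : f \in F -> g \in F -> f != g -> e \in f -> e \in g -> #|f| = 3 -> 5 <= #|g|.
Proof.
move=> fF gF fg ef eg f3; have [a [b [E ab]]] := face_edge fF ef; rewrite E in ef eg.
have [c uc fE] := Fspec3 fF f3 ef.
rewrite leqNgt; apply/negP => g4.
have fD := FD fF; have gD := FD gF; rewrite fE in fD fg.
have S := Fspec gF (ltnW g4 : #|g| <= 5) eg; move: g4; case: S => //.
- move=> c' uc' gE _; rewrite gE in gD fg.
  have cc' : c != c' by apply: contraNneq fg => ->.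
  apply: (@quad_triangle a c b c' b).
  + move: uc uc'; rewrite /= !inE !negb_or !andbT => /andP[/andP[h1 h2] h3] /andP[/andP[h4 h5] h6].
    by rewrite h2 h1 h5 eq_sym h3 cc'.
  + rewrite !subUset !sub1set in fD gD *; move: fD gD => /andP[/andP[h1 h2] h3] /andP[/andP[h4 h5] h6].
    by rewrite (set2C a c) h3 (set2C c b) h2 h5 h6.
  + move: uc; rewrite /= !inE !negb_or !andbT => /andP[/andP[h1 h2] h3].
    by rewrite h2 h1 eq_sym h3.
  + rewrite !subUset !sub1set in fD *; move: fD => /andP[/andP[h1 h2] h3].
    by rewrite (set2C a c) h3 (set2C c b) h2 (set2C b a) h1.
- move=> c' d' uc' gE _; rewrite gE in gD.
  exact: (quad_triangle uc' gD uc fD).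
Qed.

Lemma quad_face_six v a f g : d v = 6 -> f \in F -> g \in F -> f != g -> [set v; a] \in f -> [set v; a] \in g ->
  #|f| = 4 -> 6 <= #|g|.
Proof.
move=> dv fF gF fg vf vg f4; rewrite leqNgt; apply/negP; rewrite ltnS => g5.
apply: (quad_six dv (FD fF) (FD gF) fg _ (Fspec gF g5 vg)).
by have := @Fspec f v a fF; rewrite f4 => /(_ isT vf).
Qed.

Let nb3 x p q z : d x = 3 -> p != q -> p \in nb D x -> q \in nb D x -> z \in nb D x -> z != p -> z != q ->
  forall c, c \in nb D x -> [\/ c = p, c = q | c = z].
Proof.
move=> dx pq px qx zx zp zq c cx.
have S : [set p; q; z] \subset nb D x by rewrite !subUset !sub1set px qx zx.
have /eqP E : [set p; q; z] == nb D x.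
  rewrite eqEcard S (card_nb Dp) -/(d x) dx (@card_seq _ _ [:: p; q; z]) //.
    by move=> t; rewrite !inE -!orbA.
  by rewrite /= !inE !negb_or pq (eq_sym p) zp (eq_sym q) zq.
by move: cx; rewrite -E !inE => /orP[/orP[]|] /eqP ->; [constructor 1|constructor 2|constructor 3].
Qed.

Let cover_edge f x : f \in F -> x \in cover f -> exists p, [set x; p] \in f.
Proof.
move=> fF /bigcupP[e ef xe]; have [|p pn E] := @starP _ f (Fp fF) x e; first by rewrite star_in ef.
by exists p; rewrite -E.
Qed.

(** A face through [zx] continues at [x] along one of the other two edges, and both are edges of the
    triangle [f]. *)
Lemma third_edge_face x z f g : d x = 3 -> f \in F -> #|f| = 3 -> x \in cover f ->
  [set z; x] \in D -> [set z; x] \notin f -> g \in F -> [set z; x] \in g -> 5 <= #|g|.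
Proof.
move=> dx fF f3 xf zxD zxf gF zxg; rewrite leqNgt; apply/negP => g4.
have fg : f != g by apply: contraNneq zxf => ->.
have [p xp] := cover_edge fF xf; have [q u fE] := Fspec3 fF f3 xp.
have xq : [set x; q] \in f by rewrite fE !inE (set2C x q) eqxx !orbT.
move: u; rewrite /= !inE !negb_or !andbT => /andP[/andP[h1 h2] pq].
have fD := subsetP (FD fF).
have zp : z != p by apply: contraNneq zxf => ->; rewrite set2C.
have zq : z != q by apply: contraNneq zxf => ->; rewrite set2C.
have [c [cz cx xc]] := even_next (Fp gF) (Fe gF) zxg.
have cnb : c \in nb D x by rewrite (nb_edge Dp); apply: (subsetP (FD gF)).
have px : p \in nb D x by rewrite (nb_edge Dp) fD.
have qx : q \in nb D x by rewrite (nb_edge Dp) fD.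
have zx : z \in nb D x by rewrite (nb_edge Dp) set2C.
have H : c = p \/ c = q.
  case: (nb3 dx pq px qx zx zp zq cnb) => E; [by left|by right|].
  by rewrite E eqxx in cz.
have xcf : [set x; c] \in f by case: H => ->.
by have := triangle_face_edge fF gF fg xcf xc f3; rewrite leqNgt g4.
Qed.

Lemma degadjP v w : [set v; w] \in D -> degadj (d v) (d w).
Proof.
move=> vw; have wv : [set w; v] \in D by rewrite set2C.
have h1 := small_edge Dc vw; have h2 := small_edge Dc wv.
have h3 := crit_deg Dc v; have h4 := crit_deg Dc w.
have h5 : 0 < d v by apply/card_gt0P; exists [set v; w]; rewrite star_in vw set21.
have h6 : 0 < d w by apply/card_gt0P; exists [set v; w]; rewrite star_in vw set22.
rewrite -/(d v) -/(d w) in h1 h2 h3 h4; move: (d v) (d w) h1 h2 h3 h4 h5 h6 => a b h1 h2 h3 h4 h5 h6.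
clear -h1 h2 h3 h4 h5 h6; apply/and4P; split; lia.
Qed.

Let has2 f : bool := [exists u, (d u == 2) && (u \in cover f)].
Let pay v w f : nat := paydeg #|f| (d v) (d w) (has2 f).
Let triF x f : bool := [&& f \in F, #|f| == 3 & x \in cover f].
(* [z] also sends 8 to a triangular face at its neighbour [x] of degree 3 that avoids [zx]; that
   face is unique by [xtra_unique]. *)
Let xtra z x : nat := if (d x == 3) && [exists f, triF x f && ([set z; x] \notin f)] then 8 else 0.
Let T2 v : bool := [exists f, triF v f && has2 f].
Let nb2 v : {set V} := [set u in nb D v | d u == 2].
(* What [v] sends to the vertices of degree 2, each of which needs 48. Those on a triangular face
   get 24 from both neighbours. The other ones get 12 from both neighbours, and the remaining 24
   from a pot fed by all their neighbours, which suffices by [deg2_expand]. *)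
Let two v : nat := if d v != 6 then 0 else if T2 v then 24 else if #|nb2 v| == 0 then 0 else 24 + 12 * #|nb2 v|.
Let faces v w : {set {set {set V}}} := [set f in F | [set v; w] \in f].
Let cost v w : nat := \sum_(f in faces v w) pay v w f + xtra v w.

Let facesP v w f : (f \in faces v w) = (f \in F) && ([set v; w] \in f).
Proof. by rewrite inE. Qed.

Let card_faces v w : [set v; w] \in D -> #|faces v w| <= 2.
Proof. by case: HF => _ h _; exact: h. Qed.

Let xtra_le v w : xtra v w <= 8.
Proof. by rewrite /xtra; case: ifP. Qed.

Let xtra_deg v w : d w != 3 -> xtra v w = 0.
Proof. by rewrite /xtra => /negPf ->. Qed.

Let xtra_short v w f : f \in faces v w -> #|f| <= 4 -> [set v; w] \in D -> xtra v w = 0.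
Proof.
rewrite facesP => /andP[fF vf] f4 vw; rewrite /xtra; case: ifP => // /andP[/eqP dw].
case/existsP => g /andP[/and3P[gF /eqP g3 wg] ng].
by have := third_edge_face dw gF g3 wg vw ng fF vf; rewrite leqNgt ltnS f4.
Qed.

Let cover_end f a b : [set a; b] \in f -> a \in cover f /\ b \in cover f.
Proof. by move=> ab; split; apply/bigcupP; exists [set a; b]; rewrite ?set21 ?set22. Qed.

(** The triangle gets 16 and the other face at most 4, or 18 and 2 if [d w = 4]. *)
Let cost_triangle v w f : [set v; w] \in D -> 5 <= d v -> f \in faces v w -> #|f| = 3 -> ~~ has2 f ->
  cost v w <= 20.
Proof.
move=> vw dv fvw f3 nh; rewrite /cost (xtra_short fvw) ?f3 // addn0.
have [fF vf] : f \in F /\ [set v; w] \in f by move: fvw; rewrite facesP => /andP.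
pose m := if d w == 4 then 2 else 4.
apply: leq_trans (sum_le_first (m := m) (card_faces vw) fvw _) _.
  move=> g; rewrite facesP => /andP[gF vg] gf; apply: paydeg_ge5 => //.
  by apply: triangle_face_edge fF gF _ vf vg f3; rewrite eq_sym.
have dw : d w != 2.
  apply: contra nh => dw; apply/existsP; exists w; rewrite dw /=.
  by case: (cover_end vf).
have e1 : (d v <= 3) = false by rewrite leqNgt (leq_trans _ dv).
have e2 : (d v == 4) = false by rewrite gtn_eqF.
rewrite /pay /m f3 /paydeg e1 e2 (negPf dw) (negPf nh) orbF /=.
by case: (d w == 4).
Qed.

(** At most [9 + 3] with a triangular face, and at most [6 + 6] without. *)
Let cost4 v w : [set v; w] \in D -> d v = 4 -> cost v w <= 12.
Proof.
move=> vw dv; rewrite /cost.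
have -> : xtra v w = 0.
  by apply: xtra_deg; apply/eqP => dw; have := degadjP vw; rewrite dv dw.
rewrite addn0.
case: (boolP [exists f in faces v w, #|f| == 3]) => [/exists_inP[f fvw /eqP f3]|noT].
  have [fF vf] : f \in F /\ [set v; w] \in f by move: fvw; rewrite facesP => /andP.
  apply: leq_trans (sum_le_first (m := 3) (card_faces vw) fvw _) _; last by rewrite /pay f3 dv.
  move=> g; rewrite facesP => /andP[gF vg] gf; rewrite /pay dv; apply: paydeg4_ge5.
  by apply: triangle_face_edge fF gF _ vf vg f3; rewrite eq_sym.
apply: (@sum_le_two _ _ _ 6 (card_faces vw)) => g gvw; rewrite /pay dv; apply: paydeg4_ge4.
rewrite ltn_neqAle eq_sym; move/exists_inPn: noT => ->//.
by move: gvw; rewrite facesP => /andP[/F3].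
Qed.

Let no_triangle_face v w : ~~ [exists f in faces v w, #|f| == 3] -> forall g, g \in faces v w -> 4 <= #|g|.
Proof.
move=> noT g gvw; rewrite ltn_neqAle eq_sym; move/exists_inPn: noT => ->//.
by move: gvw; rewrite facesP => /andP[/F3].
Qed.

Let no_quad_face v w : ~~ [exists f in faces v w, #|f| == 3] -> ~~ [exists f in faces v w, #|f| == 4] ->
  forall g, g \in faces v w -> 5 <= #|g|.
Proof.
move=> noT noQ g gvw; rewrite ltn_neqAle eq_sym (no_triangle_face noT gvw) andbT.
by move/exists_inPn: noQ; apply.
Qed.

Let cost_long v w : [set v; w] \in D -> 5 <= d v -> ~~ [exists f in faces v w, #|f| == 3] ->
  ~~ [exists f in faces v w, #|f| == 4] -> \sum_(f in faces v w) pay v w f <= 8.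
Proof.
move=> vw dv noT noQ; apply: (@sum_le_two _ _ _ 4 (card_faces vw)) => g gvw.
apply: leq_trans (paydeg_ge5 _ _ (no_quad_face noT noQ gvw) dv) _; by case: ifP.
Qed.

Let triangle_other v u f : triF v f -> u \in cover f -> u != v ->
  exists2 w, uniq [:: v; u; w] & f = cyc3 v u w.
Proof.
move=> /and3P[fF /eqP f3 vf] uf uv; have [p up] := cover_edge fF uf; have [q uq fE] := Fspec3 fF f3 up.
have H : v \in [set u; p; q].
  move: vf; rewrite fE => /bigcupP[e]; rewrite !inE => /orP[/orP[]|] /eqP ->; rewrite !inE => /orP[] ->;
  by rewrite ?orbT.
apply: (Fspec3 fF f3); move: H; rewrite !inE => /orP[/orP[]|] /eqP E.
- by rewrite E eqxx in uv.
- by rewrite E set2C.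
- by rewrite E fE !inE eqxx !orbT.
Qed.

Let cyc3_in (a b c : V) : [/\ [set a; b] \in cyc3 a b c, [set b; c] \in cyc3 a b c & [set a; c] \in cyc3 a b c].
Proof. by rewrite !inE !eqxx (set2C a c) eqxx !orbT. Qed.

Let no_has2_5 v f : d v = 5 -> triF v f -> ~~ has2 f.
Proof.
move=> dv vf; apply/existsPn => u; rewrite negb_and -implybE; apply/implyP => /eqP du.
apply/negP => uf; have uv : u != v by apply: contra_eq_neq du => ->; rewrite dv.
have [w _ fE] := triangle_other vf uf uv.
have vu : [set v; u] \in D.
  by case/and3P: vf => fF _ _; apply: (subsetP (FD fF)); rewrite fE; case: (cyc3_in v u w).
by have := deg2_nb Dc du; rewrite set2C in vu => /(_ _ vu); rewrite -/(d v) dv.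
Qed.

Let Tset v : {set V} := [set w in nb D v | [exists f in faces v w, #|f| == 3]].

(** Distinct triangular faces share no edge, and each has an even number of edges at [v]. *)
Let Tset_even v : ~~ odd #|Tset v|.
Proof.
rewrite odd_card_xor.
have E w : (w \in Tset v) = \xor_(f | (f \in F) && (#|f| == 3)) (w \in nb f v).
  rewrite inE; case: (boolP [exists f in faces v w, #|f| == 3]) => [/exists_inP[f fvw f3]|nT].
    have [fF vf] : f \in F /\ [set v; w] \in f by move: fvw; rewrite facesP => /andP.
    rewrite (nb_edge Dp) (subsetP (FD fF)) //= (bigD1 f) ?fF //= (nb_edge (Fp fF)) vf big1 //.
    move=> g /andP[/andP[gF g3] gf]; rewrite (nb_edge (Fp gF)); apply/negbTE/negP => vg.
    by have := triangle_face_edge fF gF _ vf vg (eqP f3); rewrite eq_sym gf (eqP g3) => /(_ isT).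
  rewrite andbF big1 // => g /andP[gF g3]; apply/negbTE; apply: contra nT; rewrite (nb_edge (Fp gF)) => vg.
  by apply/exists_inP; exists g; rewrite ?facesP ?gF.
rewrite (eq_bigr _ (fun w _ => E w)) exchange_big big1 //= => f /andP[fF _].
rewrite -odd_card_xor (card_nb (Fp fF)) /deg odd_card_xor -[RHS](Fe fF v) [RHS]big_mkcond.
by apply: eq_bigr => e _; rewrite star_in; case: (e \in f).
Qed.

Let Tset_sub v : Tset v \subset nb D v.
Proof. by apply/subsetP => w; rewrite inE => /andP[]. Qed.

Let sum_split v c : #|nb D v| = 5 -> (forall w, w \in Tset v -> cost v w <= 20) ->
  (forall w, w \in nb D v :\: Tset v -> cost v w <= c) ->
  \sum_(w in nb D v) cost v w <= #|Tset v| * 20 + (5 - #|Tset v|) * c.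
Proof.
move=> n5 h1 h2; rewrite (big_setID (Tset v)) /= (setIidPr (Tset_sub v)).
have e : #|nb D v :\: Tset v| = 5 - #|Tset v| by rewrite cardsD (setIidPr (Tset_sub v)) n5.
by apply: leq_add; rewrite -?e -sum_nat_const; apply: leq_sum.
Qed.

(** Parity excludes [t = 5], for which the cost would be 100. *)
Let arith_5a t : ~~ odd t -> t <= 5 -> t * 20 + (5 - t) * 16 <= 96.
Proof. by case: t => [|[|[|[|[|[|t]]]]]]. Qed.

Let arith_5b t : ~~ odd t -> t <= 3 -> t * 20 + (5 - t) * 18 <= 96.
Proof. by case: t => [|[|[|[|t]]]]. Qed.

(** An edge on a triangular face costs at most 20, any other at most 16, or 18 in the presence of
    faces of length 4. *)
Let five_vertex v : d v = 5 -> \sum_(w in nb D v) cost v w <= 96.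
Proof.
move=> dv; have n5 : #|nb D v| = 5 by rewrite (card_nb Dp).
have dv5 : 5 <= d v by rewrite dv.
have hT w : w \in Tset v -> cost v w <= 20.
  rewrite inE => /andP[vw /exists_inP[f fvw /eqP f3]]; rewrite (nb_edge Dp) in vw.
  apply: (cost_triangle vw dv5 fvw f3); apply: (no_has2_5 dv).
  by move: fvw; rewrite facesP => /andP[fF vf]; rewrite /triF fF f3 /=; case: (cover_end vf).
have noT w : w \in nb D v :\: Tset v -> [set v; w] \in D /\ ~~ [exists f in faces v w, #|f| == 3].
  move=> /setDP[wn wT]; split; first by rewrite -(nb_edge Dp).
  by apply: contra wT => H; rewrite /Tset in_set wn.
case: (boolP [exists w in nb D v, [exists f in faces v w, #|f| == 4]]).
  case/exists_inP => w wv /exists_inP[f fvw /eqP f4].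
  have [fF vf] : f \in F /\ [set v; w] \in f by move: fvw; rewrite facesP => /andP.
  apply: leq_trans (@sum_split v 18 n5 hT _) _.
    move=> x xT; have [vx nT] := noT x xT.
    case: (boolP [exists g in faces v x, #|g| == 4]) => [/exists_inP[g gvx /eqP g4]|nQ].
      rewrite /cost (xtra_short gvx) ?g4 // addn0; apply: (@sum_le_two _ _ _ 9 (card_faces vx)) => h hvx.
      by rewrite /pay dv; apply: paydeg5_ge4; exact: no_triangle_face nT _ hvx.
    apply: leq_trans (leq_add (cost_long vx dv5 nT nQ) (xtra_le v x)) _ => //.
  (* The two edges at [v] of a face of length 4 lie on no triangular face, so at most three edges
     do. *)
  apply: arith_5b (Tset_even v) _.
  have S : small_even_spec f v w 4 by rewrite -f4; apply: Fspec; rewrite ?f4.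
  move: (erefl 4); case: {-1}_ / S => // c x u fE _.
  have vx : [set v; x] \in f by rewrite fE !inE (set2C v x) eqxx !orbT.
  have nTw y : [set v; y] \in f -> y \notin Tset v.
    move=> vy; rewrite inE negb_and; apply/orP; right; apply/exists_inPn => g; rewrite facesP => /andP[gF vg].
    apply/eqP => g3; have gf : g != f by apply/eqP => E; rewrite E f4 in g3.
    by have := triangle_face_edge gF fF gf vg vy g3; rewrite f4.
  have wx : w != x by move: u; rewrite /= !inE !negb_or => /andP[_ /andP[/andP[_ ->] _]].
  have : #|[set w; x]| <= #|nb D v :\: Tset v|.
    apply: subset_leq_card; rewrite subUset !sub1set !in_setD !nTw // wv (nb_edge Dp).
    exact: (subsetP (FD fF)).
  rewrite cards2 wx cardsD (setIidPr (Tset_sub v)) n5.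
  by case: #|Tset v| => [|[|[|[|[|[|t]]]]]].
move=> nQ; apply: leq_trans (@sum_split v 16 n5 hT _) _.
  move=> x xT; have [vx nT] := noT x xT.
  apply: leq_trans (leq_add (cost_long vx dv5 nT _) (xtra_le v x)) _ => //.
  by move/exists_inPn: nQ; apply; rewrite (nb_edge Dp).
apply: arith_5a (Tset_even v) _; rewrite -n5; exact: subset_leq_card (Tset_sub v).
Qed.

(** Beside a face of length 4 the other face gets nothing, which leaves 16, or [8 + 12] if
    [d w = 2]. Without such a face the faces get at most 8, to which [xtra] adds at most 8 or the
    degree 2 adds 12. *)
Let cost6_noT v w : [set v; w] \in D -> d v = 6 -> ~~ [exists f in faces v w, #|f| == 3] ->
  cost v w + (if d w == 2 then 12 else 0) <= 20.
Proof.
move=> vw dv nT; have dv5 : 5 <= d v by rewrite dv.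
case: (boolP [exists g in faces v w, #|g| == 4]) => [/exists_inP[g gvw /eqP g4]|nQ].
  rewrite /cost (xtra_short gvw) ?g4 // addn0.
  have [gF vg] : g \in F /\ [set v; w] \in g by move: gvw; rewrite facesP => /andP.
  have h : \sum_(f in faces v w) pay v w f <= pay v w g + 0.
    apply: (sum_le_first (card_faces vw) gvw) => f; rewrite facesP => /andP[fF vf] fg.
    by rewrite /pay paydeg_ge6 //; apply: (quad_face_six dv gF fF _ vg vf g4); rewrite eq_sym.
  apply: leq_trans (leq_add h (leqnn _)) _; rewrite addn0 /pay g4 dv /paydeg /=.
  by case: (d w == 2).
have h := cost_long vw dv5 nT nQ.
case: (boolP (d w == 2)) => [/eqP dw|_].
  by rewrite /cost xtra_deg ?dw // addn0; apply: leq_trans (leq_add h (leqnn 12)) _.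
by rewrite addn0; apply: leq_trans (leq_add h (xtra_le v w)) _.
Qed.

(** Six edges cost at most 20 each, including the 12 for a neighbour of degree 2; the remaining 24
    goes to the pot. *)
Let six_vertex_plain v : d v = 6 -> ~~ T2 v -> \sum_(w in nb D v) cost v w + two v <= 144.
Proof.
move=> dv nT2; have n6 : #|nb D v| = 6 by rewrite (card_nb Dp).
have dv5 : 5 <= d v by rewrite dv.
have h : \sum_(w in nb D v) (cost v w + (if d w == 2 then 12 else 0)) <= 120.
  apply: leq_trans (_ : #|nb D v| * 20 <= _); last by rewrite n6.
  rewrite -sum_nat_const; apply: leq_sum => w; rewrite (nb_edge Dp) => vw.
  case: (boolP [exists f in faces v w, #|f| == 3]) => [/exists_inP[f fvw /eqP f3]|]; last exact: cost6_noT.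
  have [fF vf] : f \in F /\ [set v; w] \in f by move: fvw; rewrite facesP => /andP.
  have nh : ~~ has2 f.
    apply: contra nT2 => hf; apply/existsP; exists f; rewrite hf /triF fF f3 /= andbT.
    by case: (cover_end vf).
  case: (boolP (d w == 2)) => [dw|_]; last by rewrite addn0; exact: cost_triangle fvw f3 nh.
  by case/existsP: nh; exists w; rewrite dw; case: (cover_end vf).
move: h; rewrite big_split /= -big_mkcondr /= sum_nat_const.
have -> : #|[pred w | (w \in nb D v) && (d w == 2)]| = #|nb2 v| by apply: eq_card => w; rewrite !inE.
rewrite /two dv (negPf nT2) /=; case: eqP => [->|_]; first by rewrite mul0n !addn0 => /leq_trans; apply.
move: (\sum_(w in _) _) #|nb2 v| => a b h; clear -h; lia.
Qed.

(** On the triangle [vuw] with [d u = 2], the edges [vu] and [vw] cost at most 18 and 22, the four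
    others at most 20 each, and [u], the only neighbour of degree 2, gets 24. The sum is 144. *)
Let six_vertex_T2 v : d v = 6 -> T2 v -> \sum_(w in nb D v) cost v w + two v <= 144.
Proof.
move=> dv T2v; have n6 : #|nb D v| = 6 by rewrite (card_nb Dp).
have dv5 : 5 <= d v by rewrite dv.
rewrite /two dv T2v /=.
have /existsP[f /andP[vf /existsP[u /andP[/eqP du uf]]]] := T2v.
have uv : u != v by apply: contra_eq_neq du => ->; rewrite dv.
have [w u3 fE] := triangle_other vf uf uv.
have [fF /eqP f3 _] := and3P vf; have fD := subsetP (FD fF).
have [vuf uwf vwf] : [/\ [set v; u] \in f, [set u; w] \in f & [set v; w] \in f] by rewrite fE; exact: cyc3_in.
have vuD := fD _ vuf; have uwD := fD _ uwf; have vwD := fD _ vwf.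
have uvD : [set u; v] \in D by rewrite set2C.
have [vu vw uw] : [/\ v != u, v != w & u != w].
  by move: u3; rewrite /= !inE !negb_or !andbT => /andP[/andP[-> ->] ->].
have dw : d w = 6 := deg2_nb Dc du uwD.
have fvu : f \in faces v u by rewrite facesP fF.
have fvw : f \in faces v w by rewrite facesP fF.
have cu : cost v u <= 18.
  rewrite /cost xtra_deg ?du // addn0.
  apply: leq_trans (sum_le_first (m := 0) (card_faces vuD) fvu _) _; last first.
    by rewrite addn0 /pay f3 dv /paydeg /=; case: ifP.
  (* The other face turns at [u] from [vu] into [uw]. With length at most 5 it would be the triangle
     itself, a 4-cycle adjacent to it, or a 5-cycle that becomes such a 4-cycle when [vw] bypasses
     [u]. *)
  move=> g; rewrite facesP => /andP[gF vg] gf; rewrite /pay paydeg_ge6 // leqNgt ltnS; apply/negP => g5.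
  have gD := FD gF; have S := Fspec gF g5 vg.
  have nxt c : [set u; c] \in g -> v != c -> c = w.
    move=> uc vc; case: (deg2_star du uvD uwD vw (subsetP gD _ uc) (set21 _ _)) => /set2_inj // E'.
    by rewrite E' eqxx in vc.
  move: gf; case: S => [c uc gE|c x uc gE|c x y uc gE] gf.
  - have vc : v != c by move: uc; rewrite /= !inE !negb_or => /andP[/andP[]].
    have cw : c = w by apply: nxt; rewrite // gE !inE eqxx ?orbT.
    by rewrite gE cw -fE eqxx in gf.
  - have vc : v != c by move: uc; rewrite /= !inE !negb_or => /andP[/and3P[]].
    have cw : c = w by apply: nxt; rewrite // gE !inE eqxx ?orbT.
    rewrite gE in gD; apply: (quad_triangle uc gD u3); rewrite -fE; exact: FD.
  - have vc : v != c by move: uc; rewrite /= !inE !negb_or => /andP[/and4P[]].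
    have cw : c = w by apply: nxt; rewrite // gE !inE eqxx ?orbT.
    rewrite cw in gE uc; apply: (@quad_triangle v w x y u).
    + move: uc; rewrite /= !inE !negb_or !andbT => /and4P[/and4P[_ -> -> ->] _ /andP[-> ->] ->].
      by [].
    + rewrite gE !subUset !sub1set in gD; rewrite !subUset !sub1set vwD.
      by case/andP: gD => /andP[/andP[/andP[_ _] ->] ->] ->.
    + by rewrite /= !inE !negb_or vw vu eq_sym uw.
    + by rewrite !subUset !sub1set vwD (set2C w u) uwD uvD.
have cw : cost v w <= 22.
  rewrite /cost xtra_deg ?dw // addn0.
  apply: leq_trans (sum_le_first (m := 4) (card_faces vwD) fvw _) _; last first.
    by rewrite /pay f3 dv /paydeg /=; case: ifP.
  move=> g; rewrite facesP => /andP[gF vg] gf.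
  apply: leq_trans (paydeg_ge5 _ _ _ dv5) _; last by case: ifP.
  by apply: (triangle_face_edge fF gF _ vwf vg f3); rewrite eq_sym.
have only_u x : [set v; x] \in D -> d x = 2 -> x = u.
  by move=> vx dx; apply: (triangle_deg2 Dc du uvD uwD vwD dx); rewrite set2C.
have co x : [set v; x] \in D -> x != u -> x != w -> cost v x <= 20.
  move=> vx xu xw; have dx : d x != 2 by apply: contraNneq xu => /(only_u x vx) ->.
  case: (boolP [exists g in faces v x, #|g| == 3]) => [/exists_inP[g gvx /eqP g3]|nT]; last first.
    by have := cost6_noT vx dv nT; rewrite (negPf dx) addn0.
  have [gF vg] : g \in F /\ [set v; x] \in g by move: gvx; rewrite facesP => /andP.
  apply: (cost_triangle vx dv5 gvx g3); apply/existsPn => t; rewrite negb_and -implybE; apply/implyP => /eqP dt.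
  apply/negP => tg; have tv : t != v by apply: contra_eq_neq dt => ->; rewrite dv.
  have vtri : triF v g by rewrite /triF gF g3 /=; case: (cover_end vg).
  have [y _ gE] := triangle_other vtri tg tv.
  have vt : [set v; t] \in g by rewrite gE; case: (cyc3_in v t y).
  have tu : t = u by apply: only_u dt; exact: (subsetP (FD gF)).
  rewrite tu in vt; case: (eqVneq f g) => [E|fg].
    rewrite -E fE !inE in vg; have := vg => /orP[/orP[]|] /eqP E2.
    - by have := set2_inj E2 => /eqP; rewrite (negPf xu).
    - by have := set21 v x; rewrite E2 !inE (negPf vu) (negPf vw).
    - by rewrite (set2C w v) in E2; have := set2_inj E2 => /eqP; rewrite (negPf xw).
  by have := triangle_face_edge fF gF fg vuf vt f3; rewrite g3.
have un : u \in nb D v by rewrite (nb_edge Dp).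
have wn : w \in nb D v :\ u by rewrite in_setD1 eq_sym uw (nb_edge Dp).
rewrite (big_setD1 u un) /= (big_setD1 w wn) /=.
have h : \sum_(x in nb D v :\ u :\ w) cost v x <= 80.
  apply: leq_trans (_ : #|nb D v :\ u :\ w| * 20 <= _).
    rewrite -sum_nat_const; apply: leq_sum => x; rewrite !in_setD1 (nb_edge Dp) => /andP[xw /andP[xu vx]].
    exact: co.
  have e1 := cardsD1 u (nb D v); have e2 := cardsD1 w (nb D v :\ u).
  by rewrite wn add1n in e2; rewrite un n6 e2 add1n in e1; case: e1 => <-.
apply: leq_trans (leq_add (leq_add cu (leq_add cw h)) (leqnn 24)) _.
by [].
Qed.

Let vertex_bound v : \sum_(w in nb D v) cost v w + two v <= 24 * (2 * d v - 6).
Proof.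
have n : #|nb D v| = d v by rewrite (card_nb Dp).
have d6 : d v <= 6 := crit_deg Dc v.
case: (leqP (d v) 3) => [d3|].
  have -> : two v = 0 by rewrite /two; case: eqP => // E; rewrite E in d3.
  rewrite addn0 big1 // => w; rewrite (nb_edge Dp) => vw.
  rewrite /cost big1; last by move=> f _; exact: paydeg_small.
  rewrite xtra_deg //; apply/eqP => dw; have := degadjP vw; rewrite dw => /and4P[_ _ + _].
  by rewrite d3 /= -ltn_subLR //; move: d3; case: (d v) => [|[|[|[|]]]].
case: (eqVneq (d v) 6) => [dv _|n6].
  rewrite [in X in _ <= X]dv; case: (boolP (T2 v)) => T2v; [exact: six_vertex_T2|exact: six_vertex_plain].
have -> : two v = 0 by rewrite /two n6.
rewrite addn0; case: (eqVneq (d v) 5) => [dv _|n5]; first by rewrite [in X in _ <= X]dv; exact: five_vertex.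
move=> d4; have dv : d v = 4.
  by move: d6 n6 n5 d4; case: (d v) => [|[|[|[|[|[|[|]]]]]]].
rewrite [in X in _ <= X]dv; apply: leq_trans (_ : #|nb D v| * 12 <= _); last by rewrite n dv.
by rewrite -sum_nat_const; apply: leq_sum => w; rewrite (nb_edge Dp) => vw; exact: cost4.
Qed.

Let epay f (e : {set V}) : nat := \sum_(v in e) \sum_(w in e :\ v) pay v w f.

Let pair_sum (a b : V) (h : V -> V -> nat) : a != b ->
  \sum_(v in [set a; b]) \sum_(w in [set a; b] :\ v) h v w = h a b + h b a.
Proof.
move=> ab; have ba : b != a by rewrite eq_sym.
have E1 : [set a; b] :\ a = [set b].
  by apply/setP => x; rewrite !inE; case: (eqVneq x a) => //= ->; rewrite (negPf ab).
have E2 : [set a; b] :\ b = [set a].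
  by apply/setP => x; rewrite !inE; case: (eqVneq x b) => [->|] /=; rewrite ?(negPf ba) ?orbF.
by rewrite (big_setD1 a) ?set21 //= E1 !big_set1 E2 big_set1.
Qed.

Let epay2 f a b : a != b -> epay f [set a; b] = edgepay #|f| (d a) (d b) (has2 f).
Proof. by move=> ab; rewrite /epay pair_sum. Qed.

Let sum_seq (A : {set {set V}}) (s : seq {set V}) (h : {set V} -> nat) : A =i s -> uniq s ->
  \sum_(x in A) h x = \sum_(x <- s) h x.
Proof. by move=> E u; rewrite big_uniq //; apply: eq_bigl. Qed.

Let T3 f : bool := (#|f| == 3) && [exists x, (d x == 3) && (x \in cover f)].

Let face_bound f : f \in F -> 24 * (6 - #|f|) <= \sum_(e in f) epay f e + (if T3 f then 8 else 0).
Proof.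
move=> fF; case: (leqP #|f| 5) => f5; last first.
  by have /eqP -> : 6 - #|f| == 0 by rewrite subn_eq0.
have [e ef] : exists e, e \in f by apply/set0Pn; rewrite -card_gt0; exact: leq_trans (F3 fF).
have [a [b [E ab]]] := face_edge fF ef; rewrite E in ef.
have fD := FD fF; have S := Fspec fF f5 ef; move: (erefl #|f|); case: {-1}_ / S.
- move=> c u fE f3; have u' := u.
  move: u'; rewrite /= !inE !negb_or !andbT => /andP[/andP[_ ac] bc].
  have ca : c != a by rewrite eq_sym.
  have fE' := fE; rewrite fE !subUset !sub1set in fD; move: fD => /andP[/andP[abD bcD] caD].
  have cov x : (x \in cover f) = [|| x == a, x == b | x == c].
    apply/bigcupP/idP => [[e' ]|].
      by rewrite fE !inE => /orP[/orP[]|] /eqP ->; rewrite !inE => /orP[] ->; rewrite ?orbT.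
    by case/or3P => /eqP ->; [exists [set a; b]|exists [set b; c]|exists [set c; a]]; rewrite ?fE !inE eqxx ?orbT.
  have h2 : has2 f = [|| d a == 2, d b == 2 | d c == 2].
    apply/existsP/idP => [[x /andP[dx]]|].
      by rewrite cov => /or3P[] /eqP E'; rewrite -E' dx ?orbT.
    by case/or3P => dx; [exists a|exists b|exists c]; rewrite dx cov eqxx ?orbT.
  have h3 : T3 f = [|| d a == 3, d b == 3 | d c == 3].
    rewrite /T3 f3 /=; apply/existsP/idP => [[x /andP[dx]]|].
      by rewrite cov => /or3P[] /eqP E'; rewrite -E' dx ?orbT.
    by case/or3P => dx; [exists a|exists b|exists c]; rewrite dx cov eqxx ?orbT.
  rewrite (@sum_seq f [:: [set a; b]; [set b; c]; [set c; a]] (epay f)); last exact: cyc3_uniq.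
    rewrite !big_cons big_nil !epay2 // f3 h2 h3 addn0.
    apply: triangle_pay; try exact: degadjP.
    by apply/negP => /and3P[/eqP da /eqP db /eqP dc]; exact: (no_444_triangle Dc abD bcD caD da db dc).
  by rewrite fE; exact: cyc3_seq.
- move=> c x u fE f4; have u' := u.
  move: u'; rewrite /= !inE !negb_or !andbT => /and3P[/and3P[_ ac ax] /andP[bc bx] cx].
  have xa : x != a by rewrite eq_sym.
  rewrite fE !subUset !sub1set in fD; move: fD => /andP[/andP[/andP[abD bcD] cxD] xaD].
  rewrite (@sum_seq f [:: [set a; b]; [set b; c]; [set c; x]; [set x; a]] (epay f)); last exact: cyc4_uniq.
    have -> : T3 f = false by rewrite /T3 f4.
    rewrite !big_cons big_nil !epay2 // f4 !addn0.
    (* Two vertices of degree 2 with the same two neighbours contradict [deg2_expand]. *)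
    have two2 p q r s : [set p; q] \in D -> [set q; r] \in D -> [set r; s] \in D -> [set s; p] \in D ->
       p != r -> q != s -> d p = 2 -> d r = 2 -> False.
      move=> pq qr rs sp pr qs dp dr.
      have ps : [set p; s] \in D by rewrite set2C. have rq : [set r; q] \in D by rewrite set2C.
      have : #|[set p; r]| < #|\bigcup_(t in [set p; r]) nb D t|.
        apply: (deg2_expand Dc); first by apply/set0Pn; exists p; rewrite set21.
        by move=> t; rewrite in_set2 => /orP[] /eqP ->.
      rewrite cards2 pr ltnNge => /negP; apply.
      apply: leq_trans (_ : #|[set q; s]| <= _); last by rewrite cards2 qs.
      apply: subset_leq_card; apply/bigcupsP => t; rewrite in_set2 => /orP[] /eqP ->; apply/subsetP => y.
        rewrite (nb_edge Dp) => py; case: (deg2_star dp pq ps qs py (set21 _ _)) => /set2_inj ->;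
        by rewrite ?set21 ?set22.
      rewrite (nb_edge Dp) => ry; case: (deg2_star dr rq rs qs ry (set21 _ _)) => /set2_inj ->;
      by rewrite ?set21 ?set22.
    apply: leq_trans (_ : 48 <= _) => //; apply: quad_pay; try exact: degadjP.
      apply/negP => /orP[] /andP[/eqP h1 /eqP h2]; first exact: (two2 a b c x).
      by apply: (two2 b c x a) => //; rewrite eq_sym.
    apply/negP => /orP[] /and4P[/eqP h1 /eqP h2 /eqP h3 /eqP h4].
      exact: (no_alternating_C4 Dc u abD bcD cxD xaD).
    apply: (no_alternating_C4 Dc _ bcD cxD xaD abD h2 h4 h3 h1).
    by rewrite /= !inE !negb_or bc bx cx (eq_sym b) ab (eq_sym c) ac xa.
  by rewrite fE; exact: cyc4_seq.
- move=> c x y u fE f5'; have u' := u.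
  move: u'; rewrite /= !inE !negb_or !andbT => /and4P[/and4P[_ ac ax ay] /and3P[bc bx byy] /andP[cx cy] xy].
  have ya : y != a by rewrite eq_sym.
  rewrite fE !subUset !sub1set in fD; move: fD => /andP[/andP[/andP[/andP[abD bcD] cxD] xyD] yaD].
  rewrite (@sum_seq f [:: [set a; b]; [set b; c]; [set c; x]; [set x; y]; [set y; a]] (epay f)); last exact: cyc5_uniq.
    have -> : T3 f = false by rewrite /T3 f5'.
    rewrite !big_cons big_nil !epay2 // f5' !addn0.
    by apply: leq_trans (_ : 24 <= _) => //; apply: pent_pay; exact: degadjP.
  by rewrite fE; exact: cyc5_seq.
Qed.


Let third_nb x f : d x = 3 -> triF x f -> exists2 z, z \in nb D x & [set z; x] \notin f.
Proof.
move=> dx /and3P[fF /eqP f3 xf]; have [p xp] := cover_edge fF xf; have [q u fE] := Fspec3 fF f3 xp.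
move: u; rewrite /= !inE !negb_or !andbT => /andP[/andP[h1 h2] pq].
have /subsetPn[z zx] : ~~ (nb D x \subset [set p; q]).
  apply/negP => /subset_leq_card; rewrite (card_nb Dp) -/(d x) dx cards2; by case: (p != q).
rewrite in_set2 negb_or => /andP[zp zq]; exists z => //.
have xz : x != z by apply: (pairs_neq Dp); rewrite -(nb_edge Dp).
rewrite fE !inE !negb_or (set2C z x) (set2C q x) (edge_neq _ h1 h2) andbT /=.
by rewrite !edge_neq_share.
Qed.

(** A triangular face at [x] without [zx] uses both other edges at [x], and two triangular faces
    share no edge. *)
Let xtra_unique x z f g : d x = 3 -> z \in nb D x -> triF x f -> triF x g ->
  [set z; x] \notin f -> [set z; x] \notin g -> f = g.
Proof.
move=> dx zx /and3P[fF /eqP f3 xf] /and3P[gF /eqP g3 xg] zf zg.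
have [p xp] := cover_edge fF xf; have [q u fE] := Fspec3 fF f3 xp; have [r xr] := cover_edge gF xg.
move: u; rewrite /= !inE !negb_or !andbT => /andP[/andP[h1 h2] pq].
have xq : [set x; q] \in f by rewrite fE !inE (set2C x q) eqxx !orbT.
have [fD gD] := (subsetP (FD fF), subsetP (FD gF)).
have zp : z != p by apply: contraNneq zf => ->; rewrite set2C.
have zq : z != q by apply: contraNneq zf => ->; rewrite set2C.
have xrf : [set x; r] \in f.
  have := nb3 dx pq _ _ zx zp zq; rewrite !(nb_edge Dp) => /(_ (fD _ xp) (fD _ xq)) H.
  have rn : r \in nb D x by rewrite (nb_edge Dp) gD.
  by case: (H r rn) => [->|->|E] //; rewrite E set2C (negPf zg) in xr.
apply/eqP/negPn/negP => fg; by have := triangle_face_edge fF gF fg xrf xr f3; rewrite g3.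
Qed.

Let xtra_sum : 8 * #|[set f in F | T3 f]| <= \sum_v \sum_(w in nb D v) xtra v w.
Proof.
pose B := [set p : V * V | (p.2 \in nb D p.1) && (0 < xtra p.1 p.2)].
have -> : \sum_v \sum_(w in nb D v) xtra v w = 8 * #|B|.
  rewrite pair_big_dep /= mulnC -sum_nat_const big_mkcond [RHS]big_mkcond /=.
  apply: eq_bigr => p _; have -> : (p \in B) = (p.2 \in nb D p.1) && (0 < xtra p.1 p.2) by rewrite inE.
  by rewrite /xtra; case: (_ \in _); case: ifP.
rewrite leq_mul2l /= -[#|[set f in F | T3 f]|]mul1n.
pose Q f (p : V * V) := [&& d p.2 == 3, triF p.2 f & [set p.1; p.2] \notin f].
apply: (@double_count _ _ _ _ Q) => [f|f g [z x]].
  rewrite inE => /andP[fF /andP[f3 /existsP[x /andP[dx xf]]]].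
  have tf : triF x f by rewrite /triF fF f3.
  have [z zx zf] := third_nb (eqP dx) tf.
  rewrite card_gt0; apply/set0Pn; exists (z, x); rewrite !inE /Q /= dx tf zf.
  have -> : 0 < xtra z x by rewrite /xtra dx; case: existsP => // H; case: H; exists f; rewrite tf.
  by move: zx; rewrite (nb_sym Dp) inE => ->.
move=> _ _; rewrite inE (nb_sym Dp) => /andP[/= zx _] /and3P[/eqP dx tf zf] /and3P[_ tg zg].
exact: xtra_unique dx zx tf tg zf zg.
Qed.

Let triangle_cyc3 u f : triF u f -> exists p q, [/\ uniq [:: u; p; q], f = cyc3 u p q,
  [set u; p] \in D, [set u; q] \in D & [set p; q] \in D].
Proof.
case/and3P=> fF /eqP f3 uf; have [p up] := cover_edge fF uf; have [q uu fE] := Fspec3 fF f3 up.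
exists p, q; have fD := FD fF; rewrite fE !subUset !sub1set (set2C q u) in fD.
by case/andP: fD => /andP[-> ->] ->.
Qed.

Let N2 : {set V} := [set u | d u == 2].
Let X1 : {set V} := [set u in N2 | [exists f, triF u f]].
Let X2 : {set V} := N2 :\: X1.
Let A2 : {set V} := [set v | (d v == 6) && T2 v].
Let Y : {set V} := \bigcup_(u in X2) nb D u.

(** Both neighbours of a vertex of [X1] lie in [A2], and by [triangle_deg2] no neighbour is
    shared. *)
Let card_X1 : 2 * #|X1| <= #|A2|.
Proof.
apply: (@double_count _ _ _ _ (fun u v => [set u; v] \in D)) => [u|u u' v].
  rewrite !inE => /andP[/eqP du /existsP[f tf]]; have [p [q [uu fE up uq pq]]] := triangle_cyc3 tf.
  have [fF f3 uf] := and3P tf.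
  have in2 p' : [set u; p'] \in D -> p' \in cover f -> p' \in [set v in A2 | [set u; v] \in D].
    move=> up' pf; rewrite !inE up' /d (deg2_nb Dc du up') eqxx andbT /=.
    apply/existsP; exists f; rewrite /triF fF f3 pf /=; apply/existsP; exists u; by rewrite du eqxx.
  have pq' := pairs_neq Dp pq.
  have -> : 2 = #|[set p; q]| by rewrite cards2 pq'.
  apply: subset_leq_card; rewrite subUset !sub1set !in2 //.
    by apply/bigcupP; exists [set p; q]; rewrite ?set22 // fE !inE eqxx ?orbT.
  by apply/bigcupP; exists [set p; q]; rewrite ?set21 // fE !inE eqxx ?orbT.
rewrite !inE => /andP[/eqP du /existsP[f tf]] /andP[/eqP du' _] _ uv u'v.
have [p [q [uu fE up uq pq]]] := triangle_cyc3 tf.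
have pq' := pairs_neq Dp pq.
case: (deg2_star du up uq pq' uv (set21 _ _)) => /set2_inj E; rewrite E in u'v.
  by apply/esym; exact: (triangle_deg2 Dc du up uq pq du' u'v).
by apply/esym; apply: (triangle_deg2 Dc du uq up _ du' u'v); rewrite set2C.
Qed.

(** If [v] had a triangular face with a vertex of degree 2, [triangle_deg2] would put its neighbour
    in [X2] on that face. *)
Let two_Y v : v \in Y -> v \notin A2 /\ two v = 24 + 12 * #|nb2 v|.
Proof.
case/bigcupP => u; rewrite in_setD => /andP[uX1 uN2]; rewrite (nb_edge Dp) => uv.
have du : d u = 2 by move: uN2; rewrite inE => /eqP.
have dv : d v = 6 := deg2_nb Dc du uv.
have nT2 : ~~ T2 v.
  apply/negP => /existsP[f /andP[tv /existsP[x /andP[/eqP dx xf]]]].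
  have [fF f3 vf] := and3P tv.
  have xv : x != v by apply: contra_eq_neq dx => ->; rewrite dv.
  have tx : triF x f by rewrite /triF fF f3.
  have [w _ fE] := triangle_other tv xf xv; have fD := subsetP (FD fF).
  have [vx xw vw] : [/\ [set v; x] \in f, [set x; w] \in f & [set v; w] \in f] by rewrite fE; exact: cyc3_in.
  have xvD : [set x; v] \in D by rewrite set2C fD.
  have E := triangle_deg2 Dc dx xvD (fD _ xw) (fD _ vw) du uv.
  by case/negP: uX1; rewrite inE uN2; apply/existsP; exists f; rewrite E.
split; first by rewrite inE (negPf nT2) andbF.
rewrite /two dv (negPf nT2) /=; case: eqP => // /eqP; rewrite cards_eq0 => /eqP E.
by have := in_set0 u; rewrite -E inE (nb_edge Dp) set2C uv -/(d u) du.
Qed.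

(** [A2] supplies [24 * #|A2|], at least 48 for each vertex of [X1]. The pot holds [24 * #|Y|], at
    least 24 for each vertex of [X2], which also gets 12 from both its neighbours. *)
Let two_sum : 48 * #|N2| <= \sum_v two v.
Proof.
have cN : #|N2| = #|X1| + #|X2|.
  by rewrite -(cardsID X1 N2) (setIidPr _) //; apply/subsetP => u; rewrite inE => /andP[].
have X2sub u : u \in X2 -> d u = 2 by rewrite in_setD => /andP[_]; rewrite inE => /eqP.
have YX : #|X2| <= #|Y|.
  case: (eqVneq X2 set0) => [->|ne]; first by rewrite cards0.
  exact: ltnW (deg2_expand Dc ne X2sub).
have nbY : 2 * #|X2| <= \sum_(v in Y) #|nb2 v|.
  rewrite mulnC -sum_nat_const.
  apply: leq_trans (_ : \sum_(u in X2) \sum_(v in Y) (v \in nb D u) <= _).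
    apply: leq_sum => u uX; rewrite -{1}(X2sub u uX) /d -(card_nb Dp) -sum1_card big_mkcond [X in _ <= X]big_mkcond /=.
    apply: leq_sum => v _; case: (boolP (v \in nb D u)) => vu //.
    by have -> : v \in Y by apply/bigcupP; exists u.
  rewrite exchange_big /=; apply: leq_sum => v vY; rewrite -big_mkcondr /= sum1_card.
  apply: subset_leq_card; apply/subsetP => u /andP[uX vu].
  by rewrite [u \in _]in_set (nb_sym Dp) vu X2sub.
have hA : 24 * #|A2| <= \sum_(v in A2) two v.
  rewrite mulnC -sum_nat_const; apply: leq_sum => v; rewrite inE => /andP[dv tv].
  by rewrite /two dv tv.
have hY : 24 * #|Y| + 12 * \sum_(v in Y) #|nb2 v| <= \sum_(v in Y) two v.
  rewrite big_distrr mulnC -sum_nat_const -big_split /=.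
  by apply: leq_sum => v /two_Y[_ ->].
have hs : \sum_(v in A2) two v + \sum_(v in Y) two v <= \sum_v two v.
  rewrite [X in _ <= X](bigID (mem A2)) /= leq_add2l.
  rewrite big_mkcond [X in _ <= X]big_mkcond /=; apply: leq_sum => v _.
  by case: (boolP (v \in Y)) => // /two_Y[-> _].
apply: leq_trans hs; apply: leq_trans (leq_add hA hY).
move: cN YX nbY card_X1; move: #|N2| #|X1| #|X2| #|A2| #|Y| (\sum_(v in Y) _) => n a b c y s; clear; lia.
Qed.

Let incidences g (h : V -> V -> nat) : pairs g ->
  \sum_(e in g) \sum_(v in e) \sum_(w in e :\ v) h v w = \sum_v \sum_(w in nb g v) h v w.
Proof.
move=> gp; rewrite (exchange_big_dep xpredT) //=; apply: eq_bigr => v _.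
rewrite (eq_bigl (mem (star g v))); last by move=> e; rewrite /= inE.
rewrite star_nb // big_imset /=; last by move=> a b _ _; exact: set2_inj.
apply: eq_bigr => w; rewrite inE => /andP[wv _].
suff -> : [set v; w] :\ v = [set w] by rewrite big_set1.
by apply/setP => x; rewrite !inE; case: (eqVneq x v) => //= ->; rewrite eq_sym (negPf wv).
Qed.

Let deg_sum : \sum_v d v = 2 * #|D|.
Proof.
transitivity (\sum_v \sum_(w in nb D v) 1); first by apply: eq_bigr => v _; rewrite sum1_card (card_nb Dp).
rewrite -(incidences (fun _ _ => 1) Dp) mulnC -sum_nat_const; apply: eq_bigr => e /Dp[a [b [ab ->]]].
exact: (pair_sum (fun _ _ => 1) ab).
Qed.

Let face_sum : \sum_(f in F) #|f| <= 2 * #|D|.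
Proof.
rewrite (eq_bigr (fun f => \sum_(e in f) 1)); last by move=> f _; rewrite sum1_card.
rewrite (exchange_big_dep (mem D)) /=; last by move=> f e /FD/subsetP; apply.
rewrite mulnC -sum_nat_const; apply: leq_sum => e eD; rewrite sum1_card.
case: HF => _ h _; apply: leq_trans (h e eD); apply: subset_leq_card; by apply/subsetP => f; rewrite !inE.
Qed.

Let pay_sum : \sum_(f in F) \sum_(e in f) epay f e = \sum_v \sum_(w in nb D v) \sum_(f in faces v w) pay v w f.
Proof.
rewrite (eq_bigr (fun f => \sum_v \sum_(w in nb f v) pay v w f)); last first.
  by move=> f fF; exact: incidences (fun v w => pay v w f) (Fp fF).
rewrite exchange_big /=; apply: eq_bigr => v _.
rewrite (exchange_big_dep (mem (nb D v))) /=; last first.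
  move=> f w fF; rewrite (nb_edge (Fp fF)) (nb_edge Dp); exact: subsetP (FD fF) _.
apply: eq_bigr => w _; apply: eq_bigl => f; rewrite facesP.
by case: (boolP (f \in F)) => //= fF; rewrite (nb_edge (Fp fF)).
Qed.

(** Subtraction in [nat] cuts off the charge -2 of a vertex of degree 2, and the term with [N2]
    restores it. Isolated vertices are outside [cover D] and contribute nothing. *)
Let deg_count v : (2 * d v - 6) + 6 * (v \in cover D) = 2 * d v + 2 * (v \in N2).
Proof.
have [vC|vC] := boolP (v \in cover D).
  have {vC}[w vw] : exists w, [set v; w] \in D.
    case/bigcupP: vC => e eD ve; have [|w _ E] := @starP _ D Dp v e; first by rewrite star_in eD.
    by exists w; rewrite -E.
  have /and4P[/andP[d2 _] _ _ _] := degadjP vw.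
  by rewrite inE; move: d2; case: (d v) => [|[|[|k]]] // _; rewrite /= ?addn0 ?muln0 ?muln1 subnK // mulnC; lia.
have d0 : d v = 0.
  apply/eqP; rewrite cards_eq0; apply/eqP/setP => e; rewrite !inE; apply/negP => /andP[eD ve].
  by case/negP: vC; apply/bigcupP; exists e.
by rewrite [v \in N2]in_set d0.
Qed.

(** The needs of the faces and of the vertices of degree 2 are met by what the vertices spend, so
    the total charge is not negative. This contradicts [facial_family_euler]. *)
Lemma discharging : #|F| + #|cover D| <= #|D|.
Proof.
have h1 : \sum_(f in F) 24 * (6 - #|f|) <=
    \sum_(f in F) \sum_(e in f) epay f e + 8 * #|[set f in F | T3 f]|.
  have -> : 8 * #|[set f in F | T3 f]| = \sum_(f in F) (if T3 f then 8 else 0).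
    rewrite mulnC -sum_nat_const -big_mkcondr /=; apply: eq_bigl => f; by rewrite inE.
  by rewrite -big_split /=; apply: leq_sum => f; exact: face_bound.
have h2 : \sum_v (\sum_(w in nb D v) cost v w + two v) <= \sum_v 24 * (2 * d v - 6).
  by apply: leq_sum => v _; exact: vertex_bound.
have E2 : \sum_v (\sum_(w in nb D v) cost v w + two v) =
    \sum_(f in F) \sum_(e in f) epay f e + \sum_v \sum_(w in nb D v) xtra v w + \sum_v two v.
  rewrite big_split /= pay_sum; congr (_ + _).
  by rewrite -big_split; apply: eq_bigr => v _; rewrite -big_split.
have h3 : 6 * #|F| <= \sum_(f in F) (6 - #|f|) + \sum_(f in F) #|f|.
  by rewrite mulnC -sum_nat_const -big_split /=; apply: leq_sum => f _; rewrite addnC -maxnE leq_maxr.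
have h4 : \sum_v (2 * d v - 6) + 6 * #|cover D| = 2 * (2 * #|D|) + 2 * #|N2|.
  rewrite -deg_sum big_distrr /= -!sum1_card !big_distrr /= [in LHS]big_mkcond [X in _ + X = _]big_mkcond /=.
  rewrite [X in _ = _ + X]big_mkcond -!big_split /=; apply: eq_bigr => v _.
  by have := deg_count v; case: (v \in cover D); case: (v \in N2).
rewrite E2 -big_distrr /= in h2; rewrite -big_distrr /= in h1.
move: h1 h2 h3 h4 face_sum two_sum xtra_sum.
move: (\sum_(f in F) (6 - #|f|)) (\sum_(f in F) \sum_(e in f) epay f e) #|[set f in F | T3 f]|
  (\sum_v \sum_(w in nb D v) xtra v w) (\sum_v two v) (\sum_v (2 * d v - 6)) (\sum_(f in F) #|f|)
  #|F| #|cover D| #|D| #|N2|.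
clear=> a b c x t y s m k n r; lia.
Qed.
End Discharging.

(** * Graphs without the forbidden 4-cycles *)

Section Cycles.
Variable G : sgraph.
Implicit Types (a b c u v : G) (f : {set {set G}}).

Lemma edgesE u v : ([set u; v] \in edges G) = adj u v.
Proof.
apply/imsetP/idP => [[[x y]]|uv]; last by exists (u, v); rewrite ?inE.
rewrite inE /= => xy E; have := set21 x y; have := set22 x y; rewrite -E !in_set2.
by case/orP=> /eqP y_; case/orP=> /eqP x_; move: xy; rewrite x_ y_ ?adj_irrefl // adj_sym.
Qed.

Lemma edges_pairs : pairs (edges G).
Proof.
move=> e /imsetP[[x y] + ->]; rewrite inE /= => xy; exists x, y; split=> //.
by apply: contraTneq xy => ->; rewrite adj_irrefl.
Qed.

Lemma deg_edges v : deg (edges G) v = degree v.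
Proof. by rewrite -(card_nb edges_pairs); apply: eq_card => u; rewrite (nb_edge edges_pairs) edgesE inE. Qed.

Lemma deg_le_degree (D : {set {set G}}) v : D \subset edges G -> deg D v <= degree v.
Proof.
move=> DE; rewrite -deg_edges; apply: subset_leq_card; apply/subsetP => e; rewrite !star_in => /andP[eD ->].
by rewrite (subsetP DE).
Qed.

Lemma degree_le_max v : degree v <= max_degree G.
Proof. exact: (leq_bigmax (F := @degree G)). Qed.

Lemma small_even_cycle f a b n : small_even_spec f a b n -> f \subset edges G ->
  exists s, [/\ is_cycle n s, cycle_edges s = f, a \in s & n <= 5].
Proof.
have nxt (s : seq G) (g : {set {set G}}) : [seq [set x; next s x] | x <- s] =i g -> cycle_edges s = g.
  by move=> E; apply/setP => e; rewrite -E; apply/imsetP/mapP => -[x xs ->]; exists x.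
case=> [c|c x|c x y] u ->; rewrite !subUset !sub1set !edgesE => H.
- exists [:: a; b; c]; split=> //; last by rewrite inE eqxx.
    by rewrite /is_cycle u /=; case/andP: H => /andP[-> ->] ->.
  apply: nxt => e; rewrite cyc3_seq.
  have /andP[] := u; rewrite !inE !negb_or => /andP[ab ac]; rewrite !andbT => bc.
  by rewrite /= !eqxx (eq_sym b) (negPf ab) (eq_sym c) (negPf ac) (eq_sym c) (negPf bc).
- exists [:: a; b; c; x]; split=> //; last by rewrite inE eqxx.
    by rewrite /is_cycle u /=; case/andP: H => /andP[/andP[-> ->] ->] ->.
  apply: nxt => e; rewrite cyc4_seq.
  move: u; rewrite /= !inE !negb_or !andbT => /and3P[/and3P[ab ac ax] /andP[bc bx] cx].
  rewrite !eqxx !(eq_sym _ a) (negPf ab) (negPf ac) (negPf ax) !(eq_sym _ b) (negPf bc) (negPf bx).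
  by rewrite (eq_sym x) (negPf cx).
- exists [:: a; b; c; x; y]; split=> //; last by rewrite inE eqxx.
    by rewrite /is_cycle u /=; case/andP: H => /andP[/andP[/andP[-> ->] ->] ->] ->.
  apply: nxt => e; rewrite cyc5_seq.
  move: u; rewrite /= !inE !negb_or !andbT => /and4P[/and4P[ab ac ax ay] /and3P[bc bx byy] /andP[cx cy] xy].
  rewrite !eqxx !(eq_sym _ a) (negPf ab) (negPf ac) (negPf ax) (negPf ay).
  rewrite !(eq_sym _ b) (negPf bc) (negPf bx) (negPf byy) !(eq_sym _ c) (negPf cx) (negPf cy).
  by rewrite (eq_sym y) (negPf xy).
Qed.

Lemma small_even_base f a b n : small_even_spec f a b n -> [set a; b] \in f.
Proof. by case=> [c|c x|c x y] _ ->; rewrite !inE eqxx. Qed.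

End Cycles.

Lemma colourable0 (V : finType) : colourable (set0 : {set {set V}}).
Proof. by exists (fun _ => ord0), (fun _ => ord0); split=> [u v|u e|u e e']; rewrite ?inE. Qed.

Lemma grid_minorS (V : finType) (D D' : {set {set V}}) : D' \subset D -> grid_minor D -> grid_minor D'.
Proof. by move=> /subsetP DD [U [o [h1 h2 h3]]]; exists U, o; split=> // e /DD; exact: h3. Qed.

Section SparseQuadrangles.
Variable G : sgraph.
Hypothesis minor : grid_minor (edges G).
Hypothesis degree6 : forall v : G, degree v <= 6.
Hypothesis quad_triangle : forall C T : seq G, is_cycle 4 C -> is_cycle 3 T -> ~ adjacent_cycles C T.
Hypothesis quad_six : forall (C C' : seq G) (v : G) k, is_cycle 4 C -> is_cycle k C' -> k <= 5 ->
  degree v = 6 -> v \in C -> v \in C' -> cycle_edges C' <> cycle_edges C -> ~ adjacent_cycles C C'.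

Lemma sparse_not_critical (D : {set {set G}}) : D \subset edges G -> ~ critical D.
Proof.
move=> DE Dc; have [F HF] := grid_minor_facial_family (grid_minorS DE minor).
have D0 : D != set0 by apply/eqP => E; case: Dc => _ _ + _; rewrite E; apply; exact: colourable0.
have D2 e : e \in D -> #|e| = 2 by case/(crit_pairs Dc) => x [y [xy ->]]; rewrite cards2 xy.
have := facial_family_euler D2 D0 HF; rewrite ltnNge => /negP; apply; apply: discharging => //.
- move=> a b c d t u4 sub4 u3 sub3.
  have [C [C4 CE _ _]] := small_even_cycle (SmallEven4 u4 erefl) (subset_trans sub4 DE).
  have [T [T3 TE _ _]] := small_even_cycle (SmallEven3 u3 erefl) (subset_trans sub3 DE).
  by apply: (quad_triangle C4 T3); exists [set a; b]; rewrite CE TE !inE eqxx.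
- move=> v a f g dv fD gD fg Sf Sg.
  have [C [C4 CE vC _]] := small_even_cycle Sf (subset_trans fD DE).
  have [C' [C'k CE' vC' k5]] := small_even_cycle Sg (subset_trans gD DE).
  (* Degree 6 in [D] forces degree 6 in [G], to which the condition on 4-cycles refers. *)
  have v6 : degree v = 6 by apply/eqP; rewrite eqn_leq degree6 -dv deg_le_degree.
  apply: (quad_six C4 C'k k5 v6 vC vC').
    by rewrite CE CE' => E; rewrite E eqxx in fg.
  by exists [set v; a]; rewrite CE CE' (small_even_base Sf) (small_even_base Sg).
Qed.

Lemma sparse_colourable : colourable (edges G).
Proof.
suff H n (D : {set {set G}}) : #|D| <= n -> D \subset edges G -> colourable D by exact: (H _ _ (leqnn _)).
elim: n D => [|n IH] D Dn DE.
  by move: Dn; rewrite leqn0 cards_eq0 => /eqP ->; exact: colourable0.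
apply: contrapT => nc; apply: (sparse_not_critical DE); split=> //.
- exact: pairsS (@edges_pairs G) DE.
- by move=> v; apply: leq_trans (deg_le_degree v DE) (degree6 v).
- move=> D' pD; apply: IH; last exact: subset_trans (proper_sub pD) DE.
  by rewrite -ltnS; apply: leq_trans (proper_card pD) Dn.
Qed.

End SparseQuadrangles.

Lemma colourable_total_coloring (G : sgraph) : colourable (edges G) ->
  exists f : element G -> 'I_7, total_coloring f.
Proof.
case=> vc [ec [h1 h2 h3]].
exists (fun x => match x with inl v => vc v | inr e => ec (val e) end) => -[u|e] [v|e'] /=.
- by move=> uv; apply/eqP; apply: h1; rewrite ?inE ?edgesE //; apply: contraTneq uv => ->; rewrite adj_irrefl.
- by move=> ue; apply/eqP; apply: h2; rewrite ?inE //; exact: valP.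
- by move=> ve; apply/nesym/eqP; apply: h2; rewrite ?inE //; exact: valP.
- by case/andP=> ne /existsP[u /andP[ue ue']]; apply/eqP; apply: h3 ue ue'; [exact: valP|exact: valP|].
Qed.

Theorem theorem1p1 (R : realType) (G : sgraph)
  (Gplanar : planar R G)
  (GDelta : max_degree G = 6)
  (Gno4 : ~ exists C : seq G, is_cycle 4 C /\
    [\/ chord_cycle C,
        exists T : seq G, is_cycle 3 T /\ adjacent_cycles C T |
        exists (v : G) (k : nat) (C' : seq G),
          [/\ degree v = 6, v \in C, k <= 5, is_cycle k C' &
              [/\ cycle_edges C' <> cycle_edges C,
                  adjacent_cycles C C' & v \in C']]]) :
  exists f : element G -> 'I_7, total_coloring f.
Proof.
have [pt [arc drawing]] := Gplanar.
apply: colourable_total_coloring; apply: sparse_colourable.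
- exact: planar_grid_minor drawing.
- by move=> v; rewrite -GDelta; exact: degree_le_max.
- by move=> C T C4 T3 CT; apply: Gno4; exists C; split=> //; constructor 2; exists T.
- move=> C C' v k C4 C'k k5 v6 vC vC' ne CC'; apply: Gno4; exists C; split=> //; constructor 3.
  by exists v, k, C'.
Qed.
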